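(* Let $T>0$, $y\in\mathbb{R}$, and let $(a_j)_{j\ge1}$ be a bounded sequence of real numbers such that $\frac1N\sum_{j=1}^Na_j\to a>0$ as $N\to\infty$. For each $N\ge1$ let $B=(B^1,\dots,B^N)$ be an $N$-dimensional Brownian sheet and let $Y^{i,N}$, $i=1,\dots,N$, be the solution of the linear $N$-particle system $$Y^{i,N}(t,x)=y+\int_0^t\int_0^x\Big(\frac1N\sum_{j=1}^Na_jY^{j,N}(\zeta_1,\zeta_2)-Y^{i,N}(\zeta_1,\zeta_2)\Big)d\zeta_1\,d\zeta_2+B^i(t,x),\qquad 0\le t,x\le T.$$ Then for all $i\ge1$ and $0\le t,x\le T$, as $N\to\infty$, $$Y^{i,N}(t,x)\overset{d}{\longrightarrow}Y(t,x):=f\big(tx(a-1)\big)\,y+\int_0^t\int_0^xf\big(-(t-u)(x-v)\big)\,B(du,dv),$$ where here $B$ denotes a (one-dimensional) Brownian sheet and $f(r)=\sum_{n\ge0}\frac{1}{(n!)^2}r^n$. Moreover, $Y(t,x)$, $0\le t,x\le T$, solves the mean-field hyperbolic SPDE $$Y(t,x)=y+\int_0^t\int_0^x\big(a\,E[Y(\zeta_1,\zeta_2)]-Y(\zeta_1,\zeta_2)\big)\,d\zeta_1\,d\zeta_2+B(t,x).$$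
   Context: An $N$-dimensional Brownian sheet is a vector of $N$ independent real-valued Brownian sheets on $[0,T]^2$; the stochastic integral is the two-parameter Itô (Wiener) integral; $\overset{d}{\longrightarrow}$ denotes convergence in distribution. *)

(* Defs.v *)
From HB Require Import structures.
From mathcomp Require Import all_boot all_order all_algebra.
From mathcomp Require Import all_classical all_reals all_analysis.
From mathcomp Require Import measurable_realfun.

Set Implicit Arguments.
Unset Strict Implicit.
Unset Printing Implicit Defensive.
Import Order.TTheory GRing.Theory Num.Theory.
Import numFieldNormedType.Exports.
Local Open Scope classical_set_scope.
Local Open Scope ring_scope.

Definition rect (R : realType) (t x : R) : set (R * R) :=
  `[0, t]%classic `*` `[0, x]%classic.

Definition leb2 (R : realType) :
    {measure set (measurableTypeR R * measurableTypeR R) -> \bar R} :=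
  (@lebesgue_measure R \x @lebesgue_measure R)%E.

Definition fser (R : realType) (r : R) : R :=
  limn (series (fun n : nat => r ^+ n / (n`!%:R) ^+ 2)).

Section Fields.
Context {d : measure_display} {Om : measurableType d} {R : realType}.
Variable P : probability Om R.

(* The case of zero variance is separate because [normal_prob m 0] is not the
   Dirac mass at [m]. *)
Definition gaussian_law (X : Om -> R) : Prop :=
  (exists m : R, forall A : set R, measurable A ->
     pushforward P X A = (\d_m : {measure set R -> \bar R}) A) \/
  (exists m s : R, 0 < s /\ forall A : set R, measurable A ->
     pushforward P X A = normal_prob m s A).

Definition gaussian_field (T : R) (X : R -> R -> {RV P >-> R}) : Prop :=
  forall (n : nat) (c : 'I_n -> R) (p : 'I_n -> R * R),
    (forall k, p k \in rect T T) ->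
    gaussian_law (fun w => \sum_(k < n) c k * X (p k).1 (p k).2 w).

Definition continuous_path (T : R) (X : R -> R -> {RV P >-> R}) (w : Om) : Prop :=
  {within rect T T, continuous (fun z : R * R => X z.1 z.2 w)}.

Definition brownian_sheet (T : R) (B : R -> R -> {RV P >-> R}) : Prop :=
  [/\ gaussian_field T B,
      forall t x : R, 0 <= t <= T -> 0 <= x <= T -> ('E_P[B t x] = 0)%E,
      forall t x t' x' : R, 0 <= t <= T -> 0 <= x <= T ->
        0 <= t' <= T -> 0 <= x' <= T ->
        covariance P (B t x) (B t' x') =
          (Num.min t t' * Num.min x x')%:E &
      {ae P, forall w, continuous_path T B w}].

Definition field_sigma_algebra (T : R) (X : R -> R -> {RV P >-> R}) :
    set (set Om) :=
  <<s [set E | exists (t x : R) (A : set R), [/\ 0 <= t <= T, 0 <= x <= T,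
                 measurable A & E = X t x @^-1` A]] >>.

(* The events of a subfamily are covered by taking [E i = setT] off it. *)
Definition independent_fields (T : R) (N : nat)
    (X : nat -> R -> R -> {RV P >-> R}) : Prop :=
  forall E : nat -> set Om,
    (forall i, (1 <= i <= N)%N -> field_sigma_algebra T (X i) (E i)) ->
    P (\bigcap_(i in [set i | (1 <= i <= N)%N]) E i) =
    (\prod_(1 <= i < N.+1) P (E i))%E.

(* The components are indexed by 1, ..., N; [B i] is unconstrained otherwise. *)
Definition brownian_sheet_vector (T : R) (N : nat)
    (B : nat -> R -> R -> {RV P >-> R}) : Prop :=
  (forall i, (1 <= i <= N)%N -> brownian_sheet T (B i)) /\
  independent_fields T N B.

(* Y(t,x) = y + int_0^t int_0^x b + B(t,x) for all t, x in [0,T], almost surely.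
   Measurable paths are part of the integrability of [b]. *)
Definition hyperbolic_solution (T y : R) (b : R -> R -> Om -> R)
    (B Y : R -> R -> {RV P >-> R}) : Prop :=
  {ae P, forall w, continuous_path T Y w /\
    forall t x : R, 0 <= t <= T -> 0 <= x <= T ->
      (leb2 R).-integrable (rect t x) (fun z : R * R => (b z.1 z.2 w)%:E) /\
      Y t x w = y + \int[leb2 R]_(z in rect t x) b z.1 z.2 w + B t x w}.

Definition particle_system_solution (T y : R) (a : nat -> R) (N : nat)
    (B Y : nat -> R -> R -> {RV P >-> R}) : Prop :=
  forall i, (1 <= i <= N)%N ->
    hyperbolic_solution T y
      (fun s r w => N%:R^-1 * (\sum_(1 <= j < N.+1) a j * Y j s r w) - Y i s r w)
      (B i) (Y i).

Definition mean_field_solution (T y a : R) (B Y : R -> R -> {RV P >-> R}) : Prop :=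
  (forall t x : R, 0 <= t <= T -> 0 <= x <= T ->
     P.-integrable setT (EFin \o Y t x)) /\
  hyperbolic_solution T y (fun s r w => a * fine ('E_P[Y s r])%E - Y s r w) B Y.

(* ((c, (u1, u2)), (v1, v2)) stands for c times the indicator of
   ]u1, u2] x ]v1, v2], and a sequence of cells for the sum. *)
Definition cell : Type := (R * (R * R) * (R * R))%type.

Definition cell_in (t x : R) (k : cell) : bool :=
  let: ((_, (u1, u2)), (v1, v2)) := k in
  [&& 0 <= u1, u1 <= u2, u2 <= t, 0 <= v1, v1 <= v2 & v2 <= x].

Definition step_fun (s : seq cell) (z : R * R) : R :=
  \sum_(k <- s) (let: ((c, (u1, u2)), (v1, v2)) := k in
    c * \1_(`]u1, u2]%classic `*` `]v1, v2]%classic) z).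

Definition step_integral (B : R -> R -> {RV P >-> R}) (s : seq cell) (w : Om) : R :=
  \sum_(k <- s) (let: ((c, (u1, u2)), (v1, v2)) := k in
    c * (B u2 v2 w - B u1 v2 w - B u2 v1 w + B u1 v1 w)).

(* [I] is a version of int_0^t int_0^x g dB: the L^2(P)-limit of the integrals of
   step functions converging to [g] in L^2([0,t] x [0,x]). *)
Definition is_wiener_integral (B : R -> R -> {RV P >-> R}) (t x : R)
    (g : R * R -> R) (I : {RV P >-> R}) : Prop :=
  exists s : nat -> seq cell,
    [/\ forall n, all (cell_in t x) (s n),
        (\int[leb2 R]_(z in rect t x) ((g z - step_fun (s n) z) ^+ 2)%:E)%E
          @[n --> \oo] --> 0%E &
        ('E_P[fun w => ((I w - step_integral B (s n) w) ^+ 2)%R])%E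
          @[n --> \oo] --> 0%E].

(* The default value 0 is taken only when no integral exists. *)
Definition wiener_integral (B : R -> R -> {RV P >-> R}) (t x : R)
    (g : R * R -> R) : {RV P >-> R} :=
  xget (cst 0 : {RV P >-> R}) [set I | is_wiener_integral B t x g I].

Definition limit_field (y a : R) (B : R -> R -> {RV P >-> R}) (t x : R) (w : Om) : R :=
  fser (t * x * (a - 1)) * y +
  wiener_integral B t x (fun z => fser (- ((t - z.1) * (x - z.2)))) w.

Lemma measurable_limit_field (y a : R) (B : R -> R -> {RV P >-> R}) (t x : R) :
  measurable_fun [set: Om] (limit_field y a B t x).
Proof.
apply: measurable_funD; first exact: measurable_cst.
exact: measurable_funPT.
Qed.

HB.instance Definition _ (y a : R) (B : R -> R -> {RV P >-> R}) (t x : R) :=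
  isMeasurableFun.Build _ _ Om R (limit_field y a B t x)
    (measurable_limit_field y a B t x).

End Fields.

(* Weak convergence of the laws; the variables may live on different spaces. *)
Definition cvg_in_distribution (R : realType)
    (d : nat -> measure_display) (Om : forall n, measurableType (d n))
    (P : forall n, probability (Om n) R) (X : forall n, {RV (P n) >-> R})
    (d' : measure_display) (Om' : measurableType d') (P' : probability Om' R)
    (Y : {RV P' >-> R}) : Prop :=
  forall g : R -> R, continuous g -> bounded_fun g ->
    ('E_(P n)[g \o X n])%E @[n --> \oo] --> ('E_P'[g \o Y])%E.

Arguments cvg_in_distribution {R d Om} P X {d' Om'} P' Y.

(* Main.v *)
Require Import Defs.
From HB Require Import structures.
From mathcomp Require Import all_boot all_order all_algebra.
From mathcomp Require Import all_classical all_reals all_analysis.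
From mathcomp Require Import measurable_realfun ring lra.
Set Implicit Arguments.
Unset Strict Implicit.
Unset Printing Implicit Defensive.
Import Order.TTheory GRing.Theory Num.Theory.
Import numFieldNormedType.Exports.
Local Open Scope classical_set_scope.
Local Open Scope ring_scope.

(** The system is linear, and its solution is followed path by path. The average
    [M = N^-1 sum_j a_j Y^j] solves a closed Volterra equation in the plane,
    [M = abar y + (abar - 1) int int M + beta], with [abar = N^-1 sum_j a_j] and the
    averaged noise [beta = N^-1 sum_j a_j B^j]. As the sheets are independent, [beta]
    has second moments of order [1 / N] ([averaged_sheet_sq]). Gronwall's lemma in
    the plane ([gronwall]) therefore puts [M] close to [a e], where
    [e = y f((a - 1) t x)] solves [e = y + (a - 1) int int e], and [Y^i] close to
    [e + G^i], where [G^i] solves [G = B^i - int int G] ([particle_estimate]).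

    The equation [G = B - int int G] is related to the Wiener integral through step
    paths. When [B] is replaced by a step path on a grid, the solution is a sum of
    Riemann functions [riemann_fun] weighted by the increments of [B] over the cells
    ([step_sol_resolvent]). Its value at [(t, x)] is the integral of a step function that
    approximates the kernel [f(- (t - u) (x - v))] ([step_integral_wcells]). As the
    grid is refined, the step solutions converge path by path to the solution
    ([volterra_limit]), and by the isometry [step_isometry] they converge in mean
    square to the Wiener integral. Thus [G] is a continuous version of the Wiener
    integral ([noise_field_is_wiener], [wiener_unique]). It is centred, so that [e + G]
    has mean [e], and adding the equations of [e] and [G] gives the mean-field
    equation ([mean_field_solves]).

    For the convergence in distribution, the limit and, for large [N], the particle
    are both close in mean square to [e] plus a step integral over one fixed grid
    ([noise_field_step_sq], [particle_step_sq]). The two step integrals are centred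
    Gaussian with the same variance, hence have the same law ([gaussian_same_law]).
    For a bounded continuous [g], closeness in mean square makes the expectations of
    [g] close ([bounded_continuous_modulus], [Rintegral_close]). *)

(** * The series f and its divided powers *)

Section fser.
Context {R : realType}.
Implicit Types (r : R) (n : nat).

Lemma fser_term_le r n (c : R) : 0 <= c <= n`!%:R^-1 ->
  `|c * r ^+ n| <= exp_coeff `|r| n.
Proof.
move=> /andP[c0 cn]; rewrite normrM normrX ger0_norm//.
by rewrite /exp_coeff /= mulrC ler_wpM2l// exprn_ge0.
Qed.

(** The bound by [n!^-1] is all that convergence needs, because the exponential
    series dominates. The first two formal derivatives of the series of [fser]
    satisfy it as well, which gives the differentiability of [fser]. *)
Lemma pseries_fser_cvg (c : nat -> R) :
  (forall n, 0 <= c n <= n`!%:R^-1) -> forall r, cvgn (pseries c r).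
Proof.
move=> cn r; apply: normed_cvg.
apply: (@series_le_cvg R _ (exp_coeff `|r|)) => [n|n|n|].
- exact: normr_ge0.
- by rewrite /exp_coeff /= divr_ge0// exprn_ge0.
- exact: fser_term_le.
- exact: is_cvg_series_exp_coeff.
Qed.

Let c0 n : R := (n`!%:R ^+ 2)^-1.

Lemma fser_pseries : @fser R = fun r => limn (pseries c0 r).
Proof.
apply/funext => r; rewrite /fser /pseries; congr (limn (series _)).
by apply/funext => n; rewrite mulrC.
Qed.

Let fact_gt0R n : 0 < n`!%:R :> R.
Proof. by rewrite ltr0n fact_gt0. Qed.

Let fact_ge1R n : 1 <= n`!%:R :> R.
Proof. by rewrite ler1n fact_gt0. Qed.

Let c0_bound n : 0 <= c0 n <= n`!%:R^-1.
Proof.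
rewrite /c0 invr_ge0 exprn_ge0 ?(ltW (fact_gt0R n))//=.
by rewrite lef_pV2 ?posrE ?exprn_gt0// expr2 ler_peMl// ltW.
Qed.

Let diffs1 n : pseries_diffs c0 n = (n.+1`!%:R * n`!%:R)^-1.
Proof.
rewrite /pseries_diffs /c0 [n.+1`!]factS natrM.
have := fact_gt0R n; move: n`!%:R => f f0.
by field; rewrite gt_eqF//= nat1r pnatr_eq0.
Qed.

Let diffs2 n : pseries_diffs (pseries_diffs c0) n = (n.+2`!%:R * n`!%:R)^-1.
Proof.
rewrite {1}/pseries_diffs diffs1 [n.+1`!]factS natrM !invfM.
by rewrite mulrCA mulVKf// pnatr_eq0.
Qed.

Let bound1 n : 0 <= pseries_diffs c0 n <= n`!%:R^-1.
Proof.
rewrite diffs1 invr_ge0 mulr_ge0 ?(ltW (fact_gt0R _))//=.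
by rewrite lef_pV2 ?posrE ?mulr_gt0// ler_peMl// ltW.
Qed.

Let bound2 n : 0 <= pseries_diffs (pseries_diffs c0) n <= n`!%:R^-1.
Proof.
rewrite diffs2 invr_ge0 mulr_ge0 ?(ltW (fact_gt0R _))//=.
by rewrite lef_pV2 ?posrE ?mulr_gt0// ler_peMl// ltW.
Qed.

Lemma fser_cvg r : series (fun n => r ^+ n / n`!%:R ^+ 2) @ \oo --> fser r.
Proof.
have := @pseries_fser_cvg c0 c0_bound r; rewrite /fser => h.
suff -> : series (fun n => r ^+ n / n`!%:R ^+ 2) = pseries c0 r by [].
by rewrite /pseries; congr series; apply/funext => n; rewrite mulrC.
Qed.

Lemma continuous_fser : continuous (@fser R).
Proof.
move=> r; apply: differentiable_continuous; apply/derivable1_diffP.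
rewrite fser_pseries.
suff : is_derive r 1 (fun x => limn (pseries c0 x))
  (limn (pseries (pseries_diffs c0) r)) by move=> /@ex_derive.
apply: (@pseries_snd_diffs R c0 (`|r| + 1) r); try exact: pseries_fser_cvg.
by rewrite [ltRHS]ger0_norm ?addr_ge0// ltrDl.
Qed.

Lemma fser0 : fser 0 = 1 :> R.
Proof.
apply/cvg_lim => //; rewrite -cvg_shiftS; under eq_fun.
  move=> n; rewrite seriesEnat /= big_nat_recl// expr0 fact0 expr1n divr1.
  by under eq_bigr do rewrite expr0n /= mul0r; rewrite big1// addr0; over.
exact: cvg_cst.
Qed.

(** For a nonnegative argument the partial sums increase to the sum. *)
Lemma fser_partial_le r n : 0 <= r ->
  \sum_(0 <= k < n) r ^+ k / k`!%:R ^+ 2 <= fser r.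
Proof.
move=> r0; apply: (nondecreasing_cvgn_le _ _ n); last by apply/cvg_ex; exists (fser r); exact: fser_cvg.
by apply: nondecreasing_series => k _ _; rewrite divr_ge0 ?exprn_ge0// exprn_ge0 ?ltW.
Qed.

Lemma fser_ge1 r : 0 <= r -> 1 <= fser r.
Proof.
move=> /(fser_partial_le 1); rewrite big_nat1 expr0 fact0 expr1n divr1; exact.
Qed.

Lemma fser_homo : {in Num.nneg &, {homo @fser R : r s / r <= s}}.
Proof.
move=> r s; rewrite !nnegrE => r0 s0 rs.
apply: (ler_cvg_to (@fser_cvg r) (@fser_cvg s)).
apply: nearW => n; rewrite /series /=; apply: ler_sum => k _.
apply: ler_wpM2r; first by rewrite invr_ge0 exprn_ge0 ?(ltW (fact_gt0R _)).
by rewrite lerXn2r ?nnegrE.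
Qed.

End fser.

Section kernel.
Context {R : realType}.
Implicit Types (T t x u v s lam : R) (z : R * R) (n : nat).

(** The [n]-th divided power of [s - u], cut off below [u]: for [0 <= u],
    the iterated integrals from [0] of the indicator function of the half-line
    above [u]. *)
Definition half_monomial n u (s : R) : R := (u <= s)%R %:R * ((s - u) ^+ n / n`!%:R).

Lemma half_monomial_ge0 n u s : 0 <= half_monomial n u s.
Proof.
rewrite /half_monomial; case: (lerP u s) => us; last by rewrite mul0r.
by rewrite mul1r divr_ge0// exprn_ge0// subr_ge0.
Qed.

Lemma measurable_ind_ge u : measurable_fun setT (fun s : R => (u <= s)%R %:R : R).
Proof.
rewrite (_ : (fun _ => _) = \1_(`[u, +oo[%classic : set R)); first exact: measurable_indic.
by apply/funext => s; rewrite indicE mem_setE in_itv/= andbT.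
Qed.

Lemma measurable_half_monomial n u : measurable_fun setT (half_monomial n u).
Proof.
apply: measurable_funM; first exact: measurable_ind_ge.
apply: measurable_funM => //; apply: measurable_funX.
by apply: measurable_funB.
Qed.

Lemma is_derive_monomial n u s :
  is_derive s 1 (fun s : R => (s - u) ^+ n.+1 / n.+1`!%:R) ((s - u) ^+ n / n`!%:R).
Proof.
have h : is_derive s 1 (fun s : R => s - u) 1.
  apply: (@is_derive_eq _ _ _ _ _ _ _ _ (is_deriveB (is_derive_id s 1) (is_derive_cst u s 1))).
  by rewrite subr0.
have h2 := is_deriveX n.+1 h.
rewrite (_ : (fun _ => _) = ((fun s : R => s - u) ^+ n.+1) * cst n.+1`!%:R^-1); last first.
  by apply/funext => z; rewrite exprfctE.
have h3 := is_deriveM h2 (is_derive_cst (n.+1`!%:R^-1 : R) s 1).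
apply: (is_derive_eq h3).
rewrite /= scaler0 add0r /= /GRing.scale /= mulr1 factS natrM.
by rewrite invfM mulrACA mulVf ?pnatr_eq0// mul1r mulrC.
Qed.

Lemma integral_half_monomial n u t : 0 <= u ->
  (\int[lebesgue_measure]_(s in (`[0%R, t]%classic : set R)) (half_monomial n u s)%:E = (half_monomial n.+1 u t)%:E)%E.
Proof.
move=> u0; have [tu|ut] := ltP t u.
  rewrite integral0_eq => [|s /=]; last first.
    by rewrite in_itv/= => /andP[_ st]; rewrite /half_monomial leNgt (le_lt_trans st tu)/= mul0r.
  by rewrite /half_monomial leNgt tu/= mul0r.
transitivity (\int[lebesgue_measure]_(s in (`[u, t]%classic : set R)) ((s - u) ^+ n / n`!%:R)%:E)%E.
  rewrite (_ : `[u, t]%classic = `[0, t]%classic `&` `[u, +oo[%classic); last first.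
    apply/seteqP; split => s /=; rewrite !in_itv/= ?andbT.
      by move=> /andP[us ->]; rewrite us (le_trans u0 us).
    by move=> [/andP[_ ->] ->].
  rewrite integral_mkcondr; apply: eq_integral => s _.
  rewrite patchE mem_setE in_itv/= andbT /half_monomial.
  by case: ifP => _; rewrite ?mul1r ?mul0r.
move: ut; rewrite le_eqVlt => /predU1P[->|ut].
  by rewrite set_itv1 integral_set1 /half_monomial subrr expr0n/= mul0r mulr0.
rewrite (@continuous_FTC2 _ _ (fun s => (s - u) ^+ n.+1 / n.+1`!%:R))//.
- by rewrite subrr expr0n/= mul0r sube0 /half_monomial (ltW ut) mul1r.
- apply: continuous_subspaceT => s.
  apply: differentiable_continuous; apply/derivable1_diffP.
  case: n => [|n]; last exact: (@ex_derive _ _ _ _ _ _ _ (is_derive_monomial n u s)).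
  exact: (@derivable_cst _ _ _ (1 / 0`!%:R : R)).
- have cF : continuous (fun s : R => (s - u) ^+ n.+1 / n.+1`!%:R).
    move=> s; apply: differentiable_continuous; apply/derivable1_diffP.
    exact: (@ex_derive _ _ _ _ _ _ _ (is_derive_monomial n u s)).
  split.
  + by move=> s _; exact: (@ex_derive _ _ _ _ _ _ _ (is_derive_monomial n u s)).
  + exact/cvg_at_right_filter/cF.
  + exact/cvg_at_left_filter/cF.
- by move=> s _; rewrite derive1E (@derive_val _ _ _ _ _ _ _ (is_derive_monomial n u s)).
Qed.

(** Tonelli: the double integral raises both degrees by one. *)
Lemma integral2_half_monomial n u v t x : 0 <= u -> 0 <= v ->
  (\int[leb2 R]_(z in rect t x) (half_monomial n u z.1 * half_monomial n v z.2)%:E =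
   (half_monomial n.+1 u t * half_monomial n.+1 v x)%:E)%E.
Proof.
move=> u0 v0; pose A := `[0%R, t]%classic : set R; pose B := `[0%R, x]%classic : set R.
have mA : measurable A by exact: measurable_itv.
rewrite integral_mkcond /leb2 fubini_tonelli1; last 2 first.
- apply/(measurable_restrictT _ _).1; first exact: measurableX.
  apply/measurable_EFinP; apply: measurable_funTS; apply: measurable_funM.
    apply: (@measurableT_comp _ _ _ _ _ _ (half_monomial n u)) => //; exact: measurable_half_monomial.
  apply: (@measurableT_comp _ _ _ _ _ _ (half_monomial n v)) => //; exact: measurable_half_monomial.
- by move=> z; apply: erestrict_ge0 => {}z _; rewrite lee_fin mulr_ge0// half_monomial_ge0.
rewrite /fubini_F.
transitivity (\int[lebesgue_measure]_(s in A) (((half_monomial n u s)%:E * (half_monomial n.+1 v x)%:E)))%E.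
  rewrite [RHS]integral_mkcond; apply: eq_integral => s _.
  rewrite patchE; case: ifPn => sA; last first.
    by rewrite integral0_eq// => r _; rewrite patchE in_setX (negbTE sA).
  rewrite -(integral_half_monomial n x v0) -ge0_integralZl//=; last 3 first.
  - by apply/measurable_EFinP/measurable_funTS; exact: measurable_half_monomial.
  - by move=> r _; rewrite lee_fin half_monomial_ge0.
  - by rewrite lee_fin half_monomial_ge0.
  rewrite [RHS]integral_mkcond; apply: eq_integral => r _.
  by rewrite !patchE in_setX/= sA/=.
rewrite ge0_integralZr//=; last 3 first.
- by apply/measurable_EFinP/measurable_funTS; exact: measurable_half_monomial.
- by move=> r _; rewrite lee_fin half_monomial_ge0.
- by rewrite lee_fin half_monomial_ge0.
by rewrite integral_half_monomial.
Qed.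

End kernel.

(** * The Riemann function in the plane *)

(** The plane with the Borel sets as measurable structure, on which [leb2] is
    defined; [R * R] is kept for the topology. *)
Notation plane R := (measurableTypeR R * measurableTypeR R)%type.

Section riemann_fun.
Context {R : realType}.
Implicit Types (T t x u v s lam : R) (z : R * R) (n m : nat).

Lemma measurable_rect t x : measurable (rect t x : set (plane R)).
Proof. by apply: measurableX; exact: measurable_itv. Qed.

Lemma rectP t x z : rect t x z <-> (0 <= z.1 <= t) /\ (0 <= z.2 <= x).
Proof. by rewrite /rect /= !in_itv/=. Qed.

Lemma leb2X (A B : set R) : measurable A -> measurable B ->
  leb2 R (A `*` B) = (lebesgue_measure A * lebesgue_measure B)%E.
Proof. by move=> mA mB; exact: product_measure1E. Qed.

Lemma leb2_rect t x : 0 <= t -> 0 <= x -> leb2 R (rect t x) = (t * x)%:E.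
Proof.
move=> t0 x0; rewrite [LHS]leb2X; try exact: measurable_itv.
rewrite !lebesgue_measure_itv/= !lte_fin !sube0.
move: t0; rewrite le_eqVlt => /predU1P[<-|t0]; first by rewrite ltxx mul0e mul0r.
rewrite t0; move: x0; rewrite le_eqVlt => /predU1P[<-|x0].
  by rewrite ltxx mule0 mulr0.
by rewrite x0 EFinM.
Qed.

Lemma leb2_rect_lty t x : (leb2 R (rect t x) < +oo)%E.
Proof.
have [t0|t0] := leP 0 t; last first.
  rewrite (_ : rect t x = set0) ?measure0//.
  by apply/seteqP; split => z// /rectP[/andP[a b] _]; move: (le_lt_trans (le_trans a b) t0); rewrite ltxx.
have [x0|x0] := leP 0 x; first by rewrite leb2_rect ?ltry.
rewrite (_ : rect t x = set0) ?measure0//.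
by apply/seteqP; split => z// /rectP[_ /andP[a b]]; move: (le_lt_trans (le_trans a b) x0); rewrite ltxx.
Qed.

Lemma integrable_rect t x (h : plane R -> R) : measurable_fun (rect t x) h ->
  (exists M, forall z, rect t x z -> `|h z| <= M) ->
  (leb2 R).-integrable (rect t x) (EFin \o h).
Proof.
move=> mh [M hM]; apply: measurable_bounded_integrable => //.
- exact: measurable_rect.
- exact: leb2_rect_lty.
- exists M; split; first exact: num_real.
  by move=> r Mr z /hM /le_trans; apply; exact: ltW.
Qed.

(** The Riemann function of the hyperbolic operator [d_t d_x - lam] with pole
    [(u, v)], extended by [0] outside the quadrant above the pole. *)
Definition riemann_fun lam u v z : R :=
  ((u <= z.1)%R && (v <= z.2)%R)%:R * fser (lam * ((z.1 - u) * (z.2 - v))).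

(** Partial sums of the series of [riemann_fun], as products of one-variable functions
    whose integrals are known. *)
Definition riemann_partial m lam u v z : R :=
  \sum_(0 <= n < m) lam ^+ n * (half_monomial n u z.1 * half_monomial n v z.2).

Lemma riemann_partialE m lam u v z : riemann_partial m lam u v z =
  ((u <= z.1)%R && (v <= z.2)%R)%:R *
  series (fun n => (lam * ((z.1 - u) * (z.2 - v))) ^+ n / n`!%:R ^+ 2) m.
Proof.
rewrite /riemann_partial /series/= mulr_sumr; apply: eq_bigr => n _.
rewrite /half_monomial; case: (u <= z.1); rewrite ?(mul0r, mulr0)//.
case: (v <= z.2); rewrite ?(mul0r, mulr0)// !mul1r.
by rewrite !exprMn expr2 invfM; ring.
Qed.

Lemma riemann_partial_cvg lam u v z : (fun m => riemann_partial m lam u v z) @ \oo --> riemann_fun lam u v z.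
Proof.
under eq_fun do rewrite riemann_partialE.
by apply: cvgM; [exact: cvg_cst|exact: fser_cvg].
Qed.

Lemma normr_riemann_partial_le m lam u v T z : 0 <= u -> 0 <= v -> rect T T z ->
  `|riemann_partial m lam u v z| <= fser (`|lam| * (T * T)).
Proof.
move=> u0 v0 /rectP[/andP[z10 z1T] /andP[z20 z2T]].
have T0 : 0 <= T by exact: le_trans z1T.
have pos : 0 <= `|lam| * (T * T) by rewrite !mulr_ge0.
rewrite riemann_partialE; case: (lerP u z.1) => uz; last by rewrite mul0r normr0 (le_trans _ (fser_ge1 _)).
case: (lerP v z.2) => vz; last by rewrite mul0r normr0 (le_trans _ (fser_ge1 _)).
rewrite mul1r; apply: le_trans (ler_norm_sum _ _ _) _.
apply: le_trans (fser_partial_le m pos).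
apply: ler_sum => n _; rewrite normrM normrX normrV ?unitfE ?expf_neq0 ?pnatr_eq0 -?lt0n ?fact_gt0//.
rewrite normrX [`|n`!%:R|]ger0_norm// ler_wpM2r ?invr_ge0 ?exprn_ge0//.
rewrite lerXn2r ?nnegrE// normrM ler_wpM2l// normrM ler_pM// ger0_norm ?subr_ge0//; lra.
Qed.

Lemma measurable_riemann_partial m lam u v : measurable_fun (setT : set (plane R)) (riemann_partial m lam u v).
Proof.
apply: measurable_sum => n; apply: measurable_funM => //; apply: measurable_funM.
  apply: (@measurableT_comp _ _ _ _ _ _ (half_monomial n u)) => //; exact: measurable_half_monomial.
apply: (@measurableT_comp _ _ _ _ _ _ (half_monomial n v)) => //; exact: measurable_half_monomial.
Qed.

Lemma measurable_riemann_fun lam u v : measurable_fun (setT : set (plane R)) (riemann_fun lam u v).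
Proof.
apply: (@measurable_fun_cvg _ _ _ _ (fun m => riemann_partial m lam u v)).
  by move=> m; exact: measurable_riemann_partial.
by move=> z _; exact: riemann_partial_cvg.
Qed.

Lemma normr_riemann_fun_le lam u v T z : 0 <= u -> 0 <= v -> rect T T z ->
  `|riemann_fun lam u v z| <= fser (`|lam| * (T * T)).
Proof.
move=> u0 v0 Tz; apply: (cvgr_to_le (cvg_norm (@riemann_partial_cvg lam u v z))).
by apply: nearW => m; exact: normr_riemann_partial_le.
Qed.

Lemma integral_riemann_partial m lam u v t x : 0 <= u -> 0 <= v ->
  (\int[leb2 R]_(z in rect t x) (riemann_partial m lam u v z)%:E =
   (\sum_(0 <= n < m) lam ^+ n * (half_monomial n.+1 u t * half_monomial n.+1 v x))%:E)%E.
Proof.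
move=> u0 v0; pose h n (z : plane R) := (half_monomial n u z.1 * half_monomial n v z.2)%:E : \bar R.
have ih n : (leb2 R).-integrable (rect t x) (h n).
  have mh : measurable_fun (rect t x) (h n).
    apply/measurable_EFinP/measurable_funTS; apply: measurable_funM.
      apply: (@measurableT_comp _ _ _ _ _ _ (half_monomial n u)) => //; exact: measurable_half_monomial.
    apply: (@measurableT_comp _ _ _ _ _ _ (half_monomial n v)) => //; exact: measurable_half_monomial.
  apply/integrableP; split => //.
  rewrite (eq_integral (h n)) => [|z _]; first by rewrite integral2_half_monomial// ltry.
  by rewrite gee0_abs// lee_fin mulr_ge0// half_monomial_ge0.
under eq_integral do rewrite /riemann_partial -sumEFin.
rewrite (@integral_sum _ _ _ (leb2 R) _ (measurable_rect t x) nat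
  (fun n z => (lam ^+ n)%:E * h n z)%E _); last first.
  by move=> n; apply: (integrableZl (measurable_rect t x) (lam ^+ n) (ih n)).
rewrite -sumEFin; apply: eq_bigr => n _.
rewrite (integralZl (measurable_rect t x) (ih n)).
by rewrite integral2_half_monomial.
Qed.

(** [riemann_fun lam u v] is the solution of [h = 1_{[u,oo[ x [v,oo[} + lam * int int h]:
    integration shifts the series by one term, and the missing first term is the
    indicator function. *)
Lemma riemann_fun_resolvent lam u v t x : 0 <= u -> 0 <= v ->
  lam * \int[leb2 R]_(z in rect t x) riemann_fun lam u v z =
  riemann_fun lam u v (t, x) - ((u <= t)%R && (v <= x)%R)%:R.
Proof.
move=> u0 v0; set T := Num.max t x.
have sub : rect t x `<=` rect T T.
  move=> z /rectP[/andP[a b] /andP[c d]]; apply/rectP.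
  by rewrite a c !le_max b d orbT.
have [] := @dominated_convergence _ _ _ (leb2 R) _ (measurable_rect t x)
  (fun m z => (riemann_partial m lam u v z)%:E) (fun z => (riemann_fun lam u v z)%:E)
  (cst (fser (`|lam| * (T * T)))%:E).
- by move=> m; apply/measurable_EFinP/measurable_funTS; exact: measurable_riemann_partial.
- by apply/measurable_EFinP/measurable_funTS; exact: measurable_riemann_fun.
- by apply: aeW => z _; apply/cvg_EFin; [exact: nearW|exact: riemann_partial_cvg].
- apply: (@integrable_rect t x (cst _)); first exact: measurable_cst.
  by exists `|fser (`|lam| * (T * T))|.
- by apply: aeW => z m zr; rewrite lee_fin; exact: normr_riemann_partial_le (sub _ zr).
move=> iek _.
rewrite -(fineK (integrable_fin_num (measurable_rect t x) iek)).
have -> : (fun n => \int[leb2 R]_(z in rect t x) (riemann_partial n lam u v z)%:E)%E =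
  EFin \o (fun m => \sum_(0 <= n < m) lam ^+ n * (half_monomial n.+1 u t * half_monomial n.+1 v x)).
  by apply/funext => m; rewrite integral_riemann_partial.
move=> /fine_cvg cv.
have : (fun m => lam * (\sum_(0 <= n < m) lam ^+ n * (half_monomial n.+1 u t * half_monomial n.+1 v x)))
    @ \oo --> lam * \int[leb2 R]_(z in rect t x) riemann_fun lam u v z.
  by apply: cvgM => //; exact: cvg_cst.
have -> : (fun m => lam * (\sum_(0 <= n < m) lam ^+ n * (half_monomial n.+1 u t * half_monomial n.+1 v x))) =
  (fun m => riemann_partial m.+1 lam u v (t, x) - ((u <= t)%R && (v <= x)%R)%:R).
  apply/funext => m; rewrite /riemann_partial big_nat_recl//=.
  have -> : lam ^+ 0 * (half_monomial 0 u t * half_monomial 0 v x) = ((u <= t)%R && (v <= x)%R)%:R.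
    by rewrite /half_monomial !expr0 fact0 divr1 !mulr1 mul1r -natrM mulnb.
  rewrite addrAC subrr add0r mulr_sumr.
  by apply: eq_bigr => n _; rewrite exprS mulrA.
move=> cv1; apply: (cvg_unique _ cv1) => //.
apply: cvgB; last exact: cvg_cst.
by rewrite (cvg_shiftS (fun m => riemann_partial m lam u v (t, x))); exact: riemann_partial_cvg.
Qed.

End riemann_fun.

(** * Gronwall's lemma in the plane *)

Section volterra.
Context {R : realType}.
Implicit Types (T t x u v s lam C H : R) (z : plane R) (n : nat) (h g : plane R -> R).

(** A class of integrands stable under the operations used below, for which no
    integrability condition is left on any sub-rectangle. *)
Definition bmeas T h :=
  measurable_fun (rect T T : set (plane R)) h /\
  exists M, forall z, rect T T z -> `|h z| <= M.

Lemma rect_sub t x T : t <= T -> x <= T -> rect t x `<=` rect T T.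
Proof.
move=> tT xT z /rectP[/andP[a b] /andP[c d]]; apply/rectP.
by rewrite a c (le_trans b tT) (le_trans d xT).
Qed.

Lemma bmeas_integrable T t x h : t <= T -> x <= T -> bmeas T h ->
  (leb2 R).-integrable (rect t x) (EFin \o h).
Proof.
move=> tT xT [mh [M hM]]; apply: integrable_rect.
  by apply: measurable_funS mh; [exact: measurable_rect|exact: rect_sub].
by exists M => z /(rect_sub tT xT); exact: hM.
Qed.

Lemma bmeas_cst T c : bmeas T (cst c).
Proof. by split; [exact: measurable_cst|exists `|c|]. Qed.

Lemma bmeasD T h g : bmeas T h -> bmeas T g -> bmeas T (fun z => h z + g z).
Proof.
move=> [mh [M hM]] [mg [N gN]]; split; first exact: measurable_funD.
by exists (M + N) => z Tz; rewrite (le_trans (ler_normD _ _))// lerD ?hM ?gN.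
Qed.

Lemma bmeasM T h g : bmeas T h -> bmeas T g -> bmeas T (fun z => h z * g z).
Proof.
move=> [mh [M hM]] [mg [N gN]]; split; first exact: measurable_funM.
by exists (M * N) => z Tz; rewrite normrM ler_pM ?hM ?gN.
Qed.

Lemma bmeasZ T c h : bmeas T h -> bmeas T (fun z => c * h z).
Proof. by move=> bh; apply: bmeasM => //; exact: bmeas_cst. Qed.

Lemma bmeasB T h g : bmeas T h -> bmeas T g -> bmeas T (fun z => h z - g z).
Proof.
move=> bh bg; under eq_fun do rewrite -mulN1r.
by apply: bmeasD => //; exact: bmeasZ.
Qed.

Lemma bmeas_norm T h : bmeas T h -> bmeas T (fun z => `|h z|).
Proof.
move=> [mh [M hM]]; split; first exact: measurableT_comp.
by exists M => z Tz; rewrite normr_id hM.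
Qed.

Lemma bmeas_sum T (I : Type) (r : seq I) (h : I -> plane R -> R) :
  (forall i, bmeas T (h i)) -> bmeas T (fun z => \sum_(i <- r) h i z).
Proof.
move=> bh; elim: r => [|i r ih].
  by under eq_fun do rewrite big_nil; exact: bmeas_cst.
by under eq_fun do rewrite big_cons; exact: bmeasD.
Qed.

Lemma bmeas_riemann_fun T lam u v : 0 <= u -> 0 <= v -> bmeas T (riemann_fun lam u v).
Proof.
move=> u0 v0; split; first by apply: measurable_funTS; exact: measurable_riemann_fun.
by exists (fser (`|lam| * (T * T))) => z; exact: normr_riemann_fun_le.
Qed.

Lemma riemann_fun_origin lam z T : rect T T z -> riemann_fun lam 0 0 z = fser (lam * (z.1 * z.2)).
Proof. by move=> /rectP[/andP[a _] /andP[b _]]; rewrite /riemann_fun a b mul1r !subr0. Qed.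

(** A bounded function dominated by [H + C int int |h|] is at most [m w] with
    [w = fser (2 C t x)] as soon as it is for [2 (m - H)], because
    [2 C int int w = w - 1]; the least such [m] is thus at most [2 H]. *)
Lemma gronwall T C H h : 0 <= T -> 0 <= C -> 0 <= H -> bmeas T h ->
  (forall z, rect T T z ->
     `|h z| <= H + C * \int[leb2 R]_(q in rect z.1 z.2) `|h q|) ->
  forall z, rect T T z -> `|h z| <= 2 * H * fser (2 * C * (T * T)).
Proof.
move=> T0 C0 H0 bh hle.
pose w := riemann_fun (2 * C) 0 0.
have w1 z : rect T T z -> 1 <= w z.
  move=> Tz; rewrite /w (riemann_fun_origin _ Tz) fser_ge1// !mulr_ge0//;
  by case/rectP : Tz => /andP[? _] /andP[? _].
pose S := [set m : R | forall z, rect T T z -> `|h z| <= m * w z].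
(* One use of the inequality halves the excess of m over 2 H, as 2 C int int w = w - 1. *)
have step (m : R) : S m -> S (H + m / 2).
  move=> Sm z Tz; have [/andP[a b] /andP[c d]] := (rectP _ _ _).1 Tz.
  have ibh := bmeas_integrable b d (bmeas_norm bh).
  have bw : bmeas T (fun q => m * w q) by apply: bmeasZ; exact: bmeas_riemann_fun.
  have le1 : \int[leb2 R]_(q in rect z.1 z.2) `|h q| <=
             \int[leb2 R]_(q in rect z.1 z.2) (m * w q).
    apply: le_Rintegral => //; [exact: measurable_rect|exact: (bmeas_integrable b d)|].
    by move=> q /(rect_sub b d); exact: Sm.
  have le2 := ler_wpM2l C0 le1.
  have eqw : C * \int[leb2 R]_(q in rect z.1 z.2) (m * w q) = m / 2 * (w z - 1).
    rewrite RintegralZl; [|exact: measurable_rect|]; last first.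
      by apply: (bmeas_integrable b d); exact: bmeas_riemann_fun.
    have := riemann_fun_resolvent (2 * C) z.1 z.2 (lexx 0) (lexx 0).
    by rewrite -/w a c -[(z.1, z.2)]surjective_pairing => <-; field.
  have m0 : 0 <= m.
    have := Sm _ Tz; have := w1 _ Tz; have := normr_ge0 (h z); nra.
  have := hle _ Tz; have := w1 _ Tz; rewrite eqw in le2; nra.
have S0 : S !=set0.
  have [_ [M hM]] := bh; exists `|M| => z Tz.
  by rewrite (le_trans (hM _ Tz))// (le_trans (ler_norm _))// ler_peMr// w1.
have Slb : has_lbound S.
  exists 0 => m Sm; have T00 : rect T T (0, 0) by apply/rectP; rewrite /= lexx T0.
  have := Sm _ T00; have := w1 _ T00; have := normr_ge0 (h (0, 0)); nra.
have Sinf : S (inf S).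
  move=> z Tz; have wp : 0 < w z by rewrite (lt_le_trans ltr01)// w1.
  rewrite -ler_pdivrMr//; apply: lb_le_inf => // m Sm.
  by rewrite ler_pdivrMr// Sm.
have inf2H : inf S <= 2 * H.
  have := ge_inf Slb (step _ Sinf); lra.
move=> z Tz; have := Sinf _ Tz.
have wle : w z <= fser (2 * C * (T * T)).
  rewrite /w (riemann_fun_origin _ Tz); have [/andP[a b] /andP[c d]] := (rectP _ _ _).1 Tz.
  by apply: fser_homo; rewrite ?nnegrE ?mulr_ge0// ler_wpM2l ?mulr_ge0// ler_pM.
move=> /le_trans; apply; apply: (@le_trans _ _ (2 * H * w z)).
  by rewrite ler_wpM2r// (le_trans ler01)// w1.
by rewrite ler_wpM2l// mulr_ge0.
Qed.

End volterra.

(** * Step paths and step solutions *)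

Section step_paths.
Context {R : realType}.
Implicit Types (T t x u v s lam : R) (z : plane R) (n : nat) (h b : plane R -> R).

(** Stability of [h = r + lam int int h] in the sup norm. *)
Lemma volterra_le T lam H h : 0 <= T -> bmeas T h ->
  (forall z, rect T T z ->
    `|h z - lam * \int[leb2 R]_(q in rect z.1 z.2) h q| <= H) ->
  forall z, rect T T z -> `|h z| <= 2 * H * fser (2 * `|lam| * (T * T)).
Proof.
move=> T0 bh hle; apply: gronwall => //.
  have T00 : rect T T (0, 0) by apply/rectP; rewrite /= lexx T0.
  exact: le_trans (hle _ T00).
move=> z Tz; have [/andP[_ b1] /andP[_ b2]] := (rectP _ _ _).1 Tz.
have -> : h z = (h z - lam * \int[leb2 R]_(q in rect z.1 z.2) h q) +
    lam * \int[leb2 R]_(q in rect z.1 z.2) h q by rewrite subrK.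
apply: le_trans (ler_normD _ _) _; apply: lerD; first exact: hle.
rewrite normrM ler_wpM2l//; apply: le_normr_Rintegral.
  exact: measurable_rect.
exact: (bmeas_integrable b1 b2).
Qed.

Definition grid T n k : R := T * k%:R / n.+1%:R.

(** The boundary condition of a sheet, asked at grid points only: these are
    countably many, so that it passes to almost all paths at once. *)
Definition axes0 T b := forall n k, (k <= n.+1)%N ->
  b (grid T n k, 0) = 0 /\ b (0, grid T n k) = 0.

Lemma grid0 T n : grid T n 0 = 0. Proof. by rewrite /grid mulr0 mul0r. Qed.

Lemma grid_ge0 T n k : 0 <= T -> 0 <= grid T n k.
Proof. by move=> T0; rewrite /grid divr_ge0// mulr_ge0. Qed.

Lemma grid_homo T n : 0 <= T -> {homo grid T n : k l / (k <= l)%N >-> k <= l}.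
Proof.
by move=> T0 k l kl; rewrite /grid ler_wpM2r ?invr_ge0// ler_wpM2l// ler_nat.
Qed.

Lemma grid_last T n : grid T n n.+1 = T.
Proof. by rewrite /grid mulfK// pnatr_eq0. Qed.

Lemma grid_le T n k : 0 <= T -> (k <= n.+1)%N -> grid T n k <= T.
Proof. by move=> T0 kn; rewrite -[leRHS](grid_last T n); exact: grid_homo. Qed.

Lemma gridS T n k : grid T n k.+1 = grid T n k + T / n.+1%:R.
Proof. by rewrite /grid -natr1 mulrDr mulrDl mulr1. Qed.

Lemma grid_floor T n s : 0 < T -> 0 <= s <= T -> exists k,
  [/\ (k <= n.+1)%N, grid T n k <= s, s - grid T n k <= T / n.+1%:R &
      forall j, (k < j <= n.+1)%N -> s < grid T n j].
Proof.
move=> T0 /andP[s0 sT].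
have ex : exists k, (k <= n.+1)%N && (grid T n k <= s) by exists 0; rewrite grid0.
have ub k : (k <= n.+1)%N && (grid T n k <= s) -> (k <= n.+1)%N by move=> /andP[].
have [k /andP[kn ks] kmax] := ex_maxnP ex ub.
exists k; split => //.
- have [kE|kn1] := eqVneq k n.+1.
    have : 0 <= T / n.+1%:R by rewrite divr_ge0// ltW.
    by apply: le_trans; rewrite kE grid_last subr_le0.
  have kn2 : (k.+1 <= n.+1)%N by rewrite ltn_neqAle kn1.
  rewrite lerBlDl -gridS leNgt; apply/negP => /ltW h.
  by have := kmax k.+1; rewrite kn2 h ltnn => /(_ isT).
- move=> j /andP[kj jn]; rewrite ltNge; apply/negP => h.
  by have := kmax j; rewrite jn h leqNgt kj => /(_ isT).
Qed.

(** The indicators cut the telescoping sum at the last grid point below [s]. *)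
Lemma telescope_ind (F g : nat -> R) m k s : {homo g : i j / (i <= j)%N >-> i <= j} ->
  (k <= m)%N -> g k <= s -> (forall j, (k < j <= m)%N -> s < g j) ->
  \sum_(j < m) (F j.+1 - F j) * (g j.+1 <= s)%R%:R = F k - F 0.
Proof.
move=> gh km ks sg; rewrite -(big_mkord xpredT (fun j => (F j.+1 - F j) * (g j.+1 <= s)%R%:R)).
rewrite (big_cat_nat (leq0n k) km)/= [X in _ + X]big_nat_cond [X in _ + X]big1 ?addr0.
  rewrite -(telescope_sumr _ (leq0n k)) [LHS]big_nat_cond [RHS]big_nat_cond.
  apply: eq_bigr => j /andP[/andP[_ jk] _].
  by rewrite (le_trans (gh _ _ jk) ks) mulr1.
move=> j /andP[/andP[kj jm] _]; rewrite leNgt sg ?mulr0//.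
by rewrite ltnS kj.
Qed.

Definition rect_incr b u1 u2 v1 v2 : R :=
  b (u2, v2) - b (u1, v2) - b (u2, v1) + b (u1, v1).

(** The solution of [h = b_n + lam int int h], where [b_n] is the step path that
    jumps at each grid point by the increment of [b] over the cell below it: a
    superposition of Riemann functions with these increments as weights. *)
Definition step_sol T lam n b z : R := \sum_(k < n.+1) \sum_(l < n.+1)
  rect_incr b (grid T n k) (grid T n k.+1) (grid T n l) (grid T n l.+1) *
    riemann_fun lam (grid T n k.+1) (grid T n l.+1) z.

Lemma bmeas_step_sol T lam n b : 0 <= T -> bmeas T (step_sol T lam n b).
Proof.
move=> T0; rewrite /step_sol; apply: bmeas_sum => k; apply: bmeas_sum => l.
by apply: bmeasZ; apply: bmeas_riemann_fun; exact: grid_ge0.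
Qed.

Lemma riemann_fun0 u v z : riemann_fun 0 u v z = ((u <= z.1)%R && (v <= z.2)%R)%:R.
Proof. by rewrite /riemann_fun mul0r fser0 mulr1. Qed.

Lemma Rintegral_bmeas_sum T t x (I : Type) (r : seq I) (c : I -> R) (h : I -> plane R -> R) :
  t <= T -> x <= T -> (forall i, bmeas T (h i)) ->
  \int[leb2 R]_(q in rect t x) (\sum_(i <- r) c i * h i q) =
  \sum_(i <- r) c i * \int[leb2 R]_(q in rect t x) h i q.
Proof.
move=> tT xT bh; elim: r => [|i r ih].
  by rewrite big_nil; under eq_Rintegral do rewrite big_nil; rewrite Rintegral_cst ?mul0r//; exact: measurable_rect.
rewrite big_cons -ih; under eq_Rintegral do rewrite big_cons.
rewrite RintegralD//; last 3 first.
- exact: measurable_rect.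
- by apply: (bmeas_integrable tT xT); exact: bmeasZ.
- by apply: (bmeas_integrable tT xT); apply: bmeas_sum => j; exact: bmeasZ.
rewrite RintegralZl//; first exact: measurable_rect.
exact: (bmeas_integrable tT xT).
Qed.

(** The step path [step_sol T 0 n b] drives the equation solved by [step_sol T lam n b]. *)
Lemma step_sol_resolvent T lam n b z : 0 <= T -> rect T T z ->
  step_sol T lam n b z - lam * \int[leb2 R]_(q in rect z.1 z.2) step_sol T lam n b q =
  step_sol T 0 n b z.
Proof.
move=> T0 /rectP[/andP[a c] /andP[d e]].
rewrite /step_sol; pose ii k l := rect_incr b (grid T n k) (grid T n k.+1) (grid T n l) (grid T n l.+1).
pose hh := fun (p : 'I_n.+1 * 'I_n.+1) => riemann_fun lam (grid T n p.1.+1) (grid T n p.2.+1).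
have bh p : bmeas T (hh p) by apply: bmeas_riemann_fun; exact: grid_ge0.
rewrite !pair_bigA/=; under eq_Rintegral do rewrite pair_bigA/=.
rewrite (@Rintegral_bmeas_sum T z.1 z.2 _ _ (fun p : 'I_n.+1 * 'I_n.+1 => ii p.1 p.2) hh)//.
rewrite mulr_sumr -sumrB; apply: eq_bigr => p _.
rewrite [lam * _]mulrCA /hh riemann_fun_resolvent ?grid_ge0// -surjective_pairing riemann_fun0 -mulrBr.
by rewrite opprB addrCA subrr addr0.
Qed.

(** For [lam = 0] the superposition telescopes to the step path itself, which
    takes the value of [b] at the lower corner of the cell. *)
Lemma step_sol0E T n b z : 0 < T -> rect T T z ->
  axes0 T b ->
  exists k l : 'I_n.+2, [/\ step_sol T 0 n b z = b (grid T n k, grid T n l),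
    grid T n k <= z.1 <= grid T n k.+1 & grid T n l <= z.2 <= grid T n l.+1].
Proof.
move=> T0 /rectP[z1 z2] b0; have TT := ltW T0.
have [k [kn kz kd kj]] := grid_floor n T0 z1.
have [l [ln lz ld lj]] := grid_floor n T0 z2.
exists (Ordinal (kn : (k < n.+2)%N)), (Ordinal (ln : (l < n.+2)%N)); split => /=; last 2 first.
- by rewrite kz gridS -lerBlDl.
- by rewrite lz gridS -lerBlDl.
- rewrite /step_sol; pose G i := b (grid T n i, grid T n l).
  transitivity (\sum_(i < n.+1) (G i.+1 - G i) * (grid T n i.+1 <= z.1)%R%:R).
    apply: eq_bigr => i _; pose F j := b (grid T n i.+1, grid T n j) - b (grid T n i, grid T n j).
    under eq_bigr do rewrite riemann_fun0 -mulnb natrM mulrCA mulrA.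
    transitivity ((grid T n i.+1 <= z.1)%R%:R *
        \sum_(j < n.+1) (F j.+1 - F j) * (grid T n j.+1 <= z.2)%R%:R).
      rewrite mulr_sumr; apply: eq_bigr => j _; rewrite mulrA; congr (_ * _ * _).
      by rewrite /F /rect_incr; ring.
    rewrite (@telescope_ind F (grid T n) _ l)//; last exact: grid_homo.
    rewrite mulrC /F grid0 (proj1 (b0 n i (ltnW (ltn_ord i)))) (proj1 (b0 n i.+1 (ltn_ord i))) subrr subr0.
    by [].
  rewrite (@telescope_ind G (grid T n) _ k)//; last exact: grid_homo.
  by rewrite /G grid0 (proj2 (b0 n l ln)) subr0.
Qed.

(** Uniform continuity on the square, in the two coordinates separately. *)
Lemma heine T (b : R * R -> R) : {within rect T T, continuous b} ->
  forall eps, 0 < eps -> exists2 d, 0 < d & forall p q, rect T T p -> rect T T q ->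
    `|p.1 - q.1| < d -> `|p.2 - q.2| < d -> `|b p - b q| <= eps.
Proof.
move=> /subspace_continuousP cb eps e0.
have cpt : compact (rect T T) by apply: compact_setX; exact: segment_compact.
have e20 : 0 < eps / 2 by rewrite divr_gt0.
move/compact_near_coveringP : cpt => /(_ R (0^'+) (fun d p => rect T T p ->
  forall q, rect T T q -> `|p.1 - q.1| < d -> `|p.2 - q.2| < d -> `|b p - b q| <= eps)).
case.
  move=> p Tp; have := cb p Tp => /cvgr_dist_lt /(_ _ e20).
  rewrite near_withinE => /nbhs_ballP[r /= r0 br].
  have r20 : 0 < r / 2 by rewrite divr_gt0.
  exists (ball p (r / 2), [set d | d < r / 2]).
    split => /=; first exact: nbhsx_ballx.
    exact: nbhs_right_lt.
  move=> [p' d] /= [[p1 p2] dr] Tp' q Tq d1 d2.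
  have {}p1 : `|p.1 - p'.1| < r / 2 := p1.
  have {}p2 : `|p.2 - p'.2| < r / 2 := p2.
  have brE q' : rect T T q' -> `|p.1 - q'.1| < r -> `|p.2 - q'.2| < r ->
    `|b p - b q'| < eps / 2 by move=> Tq' q1 q2; exact: br.
  have h1 : `|b p - b p'| < eps / 2 by apply: brE => //; lra.
  have h2 : `|b p - b q| < eps / 2.
    apply: brE => //.
      have := ler_distD p'.1 p.1 q.1; lra.
    have := ler_distD p'.2 p.2 q.2; lra.
  have := ler_distD (b p) (b p') (b q); rewrite (distrC (b p') (b p)); lra.
move=> d /= d0 Kd; exists (d / 2); first by rewrite divr_gt0.
move=> p q Tp Tq; have d20 : 0 < d / 2 by rewrite divr_gt0.
apply: (Kd (d / 2)) => //=.
by rewrite /ball_/= sub0r normrN gtr0_norm//; lra.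
Qed.

Lemma cvg_step_sol0 T b : 0 < T -> {within rect T T, continuous (b : R * R -> R)} ->
  axes0 T b ->
  forall eps, 0 < eps -> \forall n \near \oo, forall z, rect T T z ->
    `|b z - step_sol T 0 n b z| <= eps.
Proof.
move=> T0 cb b0 eps e0; have [d d0 bd] := heine cb e0.
near=> n => z Tz.
have [k [l [-> /andP[k1 k2] /andP[l1 l2]]]] := step_sol0E n T0 Tz b0.
rewrite gridS in k2; rewrite gridS in l2.
have Tn : T / n.+1%:R < d.
  rewrite ltr_pdivrMr// mulrC -ltr_pdivrMr//.
  rewrite (@lt_le_trans _ _ n%:R)// ?ler_nat//.
  near: n; exact: nbhs_infty_gtr.
apply: bd => //=.
- have T1 := ltW T0; apply/rectP; rewrite /= !grid_ge0//.
  by rewrite !grid_le// -ltnS.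
- by rewrite ger0_norm ?subr_ge0//; apply: le_lt_trans Tn; rewrite lerBlDl.
- by rewrite ger0_norm ?subr_ge0//; apply: le_lt_trans Tn; rewrite lerBlDl.
Unshelve. all: by end_near. Qed.

Lemma bmeas_continuous T b : 0 < T -> {within rect T T, continuous (b : R * R -> R)} ->
  axes0 T b -> bmeas T b.
Proof.
move=> T0 cb b0; split.
  apply: (@measurable_fun_cvg _ _ _ _ (fun n => step_sol T 0 n b)).
    by move=> n; have [] := @bmeas_step_sol T 0 n b (ltW T0).
  move=> z Tz; apply/cvgrPdist_le => eps e0.
  by have := cvg_step_sol0 T0 cb b0 e0; apply: filterS => n; exact.
have [n _ /(_ n (leqnn n)) nb] := cvg_step_sol0 T0 cb b0 ltr01.
have [_ [M hM]] := @bmeas_step_sol T 0 n b (ltW T0).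
exists (1 + M) => z Tz; rewrite -[b z](subrK (step_sol T 0 n b z)).
by rewrite (le_trans (ler_normD _ _))// lerD// ?nb ?hM.
Qed.

End step_paths.

(** * Continuous solutions of the linear equation *)

Section solution.
Context {R : realType}.
Implicit Types (T t x u v s lam : R) (z : plane R) (n : nat) (h b : plane R -> R).

(** The jump of a Riemann function on the boundary of its quadrant is [1] for
    every [lam], hence cancels in a difference. *)
Lemma continuous_riemann_funB lam u v : continuous ((fun z => riemann_fun lam u v z - riemann_fun 0 u v z) : R * R -> R).
Proof.
have -> : (fun z => riemann_fun lam u v z - riemann_fun 0 u v z) = fun z : R * R =>
    fser (lam * (Num.max (z.1 - u) 0 * Num.max (z.2 - v) 0)) - 1.
  apply/funext => z; rewrite riemann_fun0 /riemann_fun.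
  case: (lerP u z.1) => uz; last first.
    by rewrite [Num.max (_ - u) _]max_r ?mul0r ?mulr0 ?fser0 ?subrr// subr_le0 ltW.
  case: (lerP v z.2) => vz; last first.
    by rewrite [Num.max (_ - v) _]max_r ?mulr0 ?fser0 ?mul0r ?subrr// subr_le0 ltW.
  by rewrite mul1r !max_l// subr_ge0.
have c1 : continuous (fun z : R * R => Num.max (z.1 - u) 0).
  move=> z; apply: (@continuous_max _ _ (fun z : R * R => z.1 - u) (cst 0)); last exact: cvg_cst.
  by apply: cvgB; [exact: cvg_fst|exact: cvg_cst].
have c2 : continuous (fun z : R * R => Num.max (z.2 - v) 0).
  move=> z; apply: (@continuous_max _ _ (fun z : R * R => z.2 - v) (cst 0)); last exact: cvg_cst.
  by apply: cvgB; [exact: cvg_snd|exact: cvg_cst].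
move=> z; apply: cvgB; last exact: cvg_cst.
apply: continuous_comp; last exact: continuous_fser.
apply: cvgM; first exact: cvg_cst.
by apply: cvgM; [exact: c1|exact: c2].
Qed.

Lemma step_sol_le_of_resolvent T lam n b (h r : plane R -> R) eps : 0 <= T -> bmeas T h ->
  (forall z, rect T T z ->
    h z - lam * \int[leb2 R]_(q in rect z.1 z.2) h q = r z) ->
  (forall z, rect T T z -> `|r z - step_sol T 0 n b z| <= eps) ->
  forall z, rect T T z ->
    `|h z - step_sol T lam n b z| <= 2 * eps * fser (2 * `|lam| * (T * T)).
Proof.
move=> T0 bh hr re; apply: (volterra_le T0 (lam := lam)).
  by apply: bmeasB => //; exact: bmeas_step_sol.
move=> z Tz; have /rectP[/andP[_ b1] /andP[_ b2]] := Tz.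
rewrite RintegralB; [|exact: measurable_rect|exact: (bmeas_integrable b1 b2)|]; last first.
  by apply: (bmeas_integrable b1 b2); exact: bmeas_step_sol.
rewrite [X in `|X| <= _](_ : _ = r z - step_sol T 0 n b z); first exact: re.
by rewrite -(hr z Tz) -(step_sol_resolvent lam n b T0 Tz); ring.
Qed.

(** The equation [h = b + lam int int h] is solved by the limit of the step
    solutions; the limit is continuous although they are not, because
    [step_sol T lam n b - step_sol T 0 n b] is. *)
Lemma volterra_limit T lam b : 0 < T -> {within rect T T, continuous (b : R * R -> R)} ->
  axes0 T b ->
  exists h, [/\ bmeas T h,
    forall z, rect T T z -> (fun n => step_sol T lam n b z) @ \oo --> h z,
    forall z, rect T T z ->
      h z - lam * \int[leb2 R]_(q in rect z.1 z.2) h q = b z &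
    {within rect T T, continuous (h : R * R -> R)}].
Proof.
move=> T0 cb b0; have TT := ltW T0.
pose C := fser (2 * `|lam| * (T * T)).
have C0 : 0 < C by rewrite (lt_le_trans ltr01)// fser_ge1// !mulr_ge0.
(* Step solutions are uniformly Cauchy: their driving step paths are. *)
have cau eps : 0 < eps -> \forall N \near \oo, forall m z, (N <= m)%N -> rect T T z ->
    `|step_sol T lam m b z - step_sol T lam N b z| <= eps.
  move=> e0; pose e := eps / (4 * C).
  have ep : 0 < e by rewrite divr_gt0// mulr_gt0.
  have [N _ hN] := cvg_step_sol0 T0 cb b0 ep.
  exists N => // n /= Nn m z nm Tz.
  have -> : eps = 2 * (e + e) * C by rewrite /e; field; rewrite gt_eqF.
  apply: (step_sol_le_of_resolvent TT (bmeas_step_sol _ _ _ TT)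
    (fun z => @step_sol_resolvent _ T lam m b z TT)) => // q Tq.
  rewrite -(subrK (b q) (step_sol T 0 m b q)) -addrA (le_trans (ler_normD _ _))//.
  rewrite lerD//; last exact: hN.
  by rewrite distrC hN//= (leq_trans Nn).
pose h z := limn (fun n => step_sol T lam n b z).
have cvh z : rect T T z -> (fun n => step_sol T lam n b z) @ \oo --> h z.
  move=> Tz; apply/cauchy_cvgP/cauchy_exP => eps e0.
  have [N _ hN] := cau _ (divr_gt0 e0 (ltr0n _ 2)).
  exists (step_sol T lam N b z); exists N => // m /= Nm.
  rewrite /ball/= /ball_/= distrC (le_lt_trans (hN N (leqnn N) m z Nm Tz))//.
  by rewrite ltr_pdivrMr// ltr_pMr// ltr1n.
have unih eps : 0 < eps -> \forall N \near \oo, forall z, rect T T z ->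
    `|h z - step_sol T lam N b z| <= eps.
  move=> e0; have := cau _ e0; apply: filterS => N hN z Tz.
  apply: (cvgr_to_le (cvg_norm (cvgB (cvh _ Tz) (cvg_cst _)))).
  by exists N => // m /= Nm; exact: hN.
have bh : bmeas T h.
  split.
    apply: (@measurable_fun_cvg _ _ _ _ (fun n => step_sol T lam n b)) => //.
    by move=> n; have [] := @bmeas_step_sol R T lam n b TT.
  have [n _ /(_ n (leqnn n)) nb] := unih _ ltr01.
  have [_ [M hM]] := @bmeas_step_sol R T lam n b TT.
  exists (1 + M) => z Tz; rewrite -[h z](subrK (step_sol T lam n b z)).
  by rewrite (le_trans (ler_normD _ _))// lerD// ?nb ?hM.
exists h; split => //.
  move=> z Tz; have /rectP[/andP[a1 b1] /andP[a2 b2]] := Tz.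
  apply/eqP; rewrite -subr_eq0 -normr_le0; apply/ler_addgt0Pl => eps e0; rewrite addr0.
  (* The three errors below are eps / K times 1, |lam| * T^2 and 1. *)
  pose K := 2 + `|lam| * (T * T).
  have K0 : 0 < K by rewrite ltr_wpDr// mulr_ge0// mulr_ge0.
  have eK : 0 < eps / K by rewrite divr_gt0.
  have [N _ hN] := filterI (unih _ eK) (cvg_step_sol0 T0 cb b0 eK).
  have [hN1 hN2] := hN N (leqnn N).
  have bS := bmeas_step_sol lam N b TT.
  have ihS : \int[leb2 R]_(q in rect z.1 z.2) h q -
      \int[leb2 R]_(q in rect z.1 z.2) step_sol T lam N b q =
      \int[leb2 R]_(q in rect z.1 z.2) (h q - step_sol T lam N b q).
    by rewrite RintegralB//; [exact: measurable_rect|exact: (bmeas_integrable b1 b2)..].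
  have ile : `|\int[leb2 R]_(q in rect z.1 z.2) (h q - step_sol T lam N b q)| <= eps / K * (T * T).
    have bhS := bmeasB bh bS.
    apply: le_trans (le_normr_Rintegral (measurable_rect _ _) (bmeas_integrable b1 b2 bhS)) _.
    apply: (@le_trans _ _ (\int[leb2 R]_(q in rect z.1 z.2) (eps / K))).
      apply: le_Rintegral; [exact: measurable_rect| | |].
      - exact: (bmeas_integrable b1 b2 (bmeas_norm bhS)).
      - exact: (bmeas_integrable b1 b2 (bmeas_cst _ _)).
      - by move=> q /(rect_sub b1 b2); exact: hN1.
    rewrite Rintegral_cst; last exact: measurable_rect.
    by rewrite leb2_rect//=; apply: ler_wpM2l; [exact: ltW|exact: ler_pM].
  have -> : h z - lam * \int[leb2 R]_(q in rect z.1 z.2) h q - b z =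
    (h z - step_sol T lam N b z) - lam * \int[leb2 R]_(q in rect z.1 z.2) (h q - step_sol T lam N b q)
    - (b z - step_sol T 0 N b z).
    by rewrite -ihS -(step_sol_resolvent lam N b TT Tz); ring.
  apply: le_trans (ler_normB _ _) _.
  apply: le_trans (lerD (ler_normB _ _) (hN2 z Tz)) _.
  rewrite normrM; apply: le_trans (lerD (lerD (hN1 z Tz) (ler_wpM2l (normr_ge0 lam) ile)) (lexx _)) _.
  rewrite [leLHS](_ : _ = eps)// -[RHS](divfK (lt0r_neq0 K0)).
  by rewrite /K; ring.
apply/subspace_continuousP => p Tp; apply/cvgrPdist_le => eps e0.
have e6 : 0 < eps / 6 by rewrite divr_gt0.
have [N _ hN] := filterI (unih _ e6) (cvg_step_sol0 T0 cb b0 e6).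
have [hN1 hN2] := hN N (leqnn N).
have cD : continuous ((fun z => step_sol T lam N b z - step_sol T 0 N b z) : R * R -> R).
  have -> : (fun z => step_sol T lam N b z - step_sol T 0 N b z) = fun z => \sum_(k < N.+1) \sum_(l < N.+1)
      rect_incr b (grid T N k) (grid T N k.+1) (grid T N l) (grid T N l.+1) *
      (riemann_fun lam (grid T N k.+1) (grid T N l.+1) z - riemann_fun 0 (grid T N k.+1) (grid T N l.+1) z).
    apply/funext => z; rewrite /step_sol -sumrB; apply: eq_bigr => k _.
    by rewrite -sumrB; apply: eq_bigr => l _; rewrite mulrBr.
  apply: continuous_big; first exact: add_continuous.
  move=> k _; apply: continuous_big; first exact: add_continuous.
  move=> l _ z.
  by apply: cvgM; [exact: cvg_cst|exact: continuous_riemann_funB].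
have := (subspace_continuousP _ _).1 cb p Tp; move/cvgrPdist_le => /(_ _ e6) cbp.
have := cD p; move/cvgrPdist_le => /(_ _ e6) cDp.
rewrite near_withinE in cbp; rewrite near_withinE; near=> q => Tq.
have q1 : `|b p - b q| <= eps / 6 by move: Tq; near: q.
have q2 : `|step_sol T lam N b p - step_sol T 0 N b p - (step_sol T lam N b q - step_sol T 0 N b q)| <= eps / 6.
  by near: q.
move: q1 q2 (hN1 p Tp) (hN1 q Tq) (hN2 p Tp) (hN2 q Tq).
rewrite /from_subspace /=.
move: (step_sol T lam N b p) (step_sol T lam N b q) (step_sol T 0 N b p) (step_sol T 0 N b q).
move: (h p) (h q) (b p) (b q) => hp hq bp bq sp sq op oq.
rewrite !ler_norml => /andP[? ?] /andP[? ?] /andP[? ?] /andP[? ?] /andP[? ?] /andP[? ?].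
by apply/andP; split; lra.
Unshelve. all: by end_near. Qed.

End solution.

Section particle.
Context {R : realType}.
Implicit Types (T t x u v s lam : R) (z : plane R) (n : nat) (h b : plane R -> R).

(** A Riemann sum of [|b|] with the last grid line counted as well, so that it
    dominates the integral of the step path and is a finite combination of values
    of [b], whose moments are computable. *)
Definition riemann_sum T n b : R := (T / n.+1%:R) ^+ 2 *
  \sum_(p : 'I_n.+2 * 'I_n.+2) `|b (grid T n p.1, grid T n p.2)|.

Lemma integral_norm_le_riemann_sum T b : 0 < T -> {within rect T T, continuous (b : R * R -> R)} ->
  axes0 T b ->
  forall eps, 0 < eps -> \forall n \near \oo,
    \int[leb2 R]_(q in rect T T) `|b q| <= riemann_sum T n b + eps.
Proof.
move=> T0 cb b0 eps e0; have TT := ltW T0.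
have bb := bmeas_continuous T0 cb b0.
have e1 : 0 < eps / (T * T) by rewrite divr_gt0// mulr_gt0.
have := cvg_step_sol0 T0 cb b0 e1; apply: filterS => n bn.
pose C (p : 'I_n.+2 * 'I_n.+2) : set (plane R) :=
  (`[grid T n p.1, grid T n p.1.+1]%classic : set R) `*` (`[grid T n p.2, grid T n p.2.+1]%classic : set R).
have mC p : measurable (C p) by apply: measurableX; exact: measurable_itv.
pose c (p : 'I_n.+2 * 'I_n.+2) : R := `|b (grid T n p.1, grid T n p.2)|.
have bC p : bmeas T (\1_(C p)).
  split; first exact: measurable_indic.
  by exists 1 => z _; rewrite indicE; case: (_ \in _); rewrite ?normr1 ?normr0.
have bs : bmeas T (fun q => \sum_p c p * \1_(C p) q).
  by apply: bmeas_sum => p; exact: bmeasZ.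
have be : bmeas T (fun q => \sum_p c p * \1_(C p) q + eps / (T * T)).
  by apply: bmeasD => //; exact: bmeas_cst.
apply: (@le_trans _ _ (\int[leb2 R]_(q in rect T T) (\sum_p c p * \1_(C p) q + eps / (T * T)))).
  apply: le_Rintegral; [exact: measurable_rect| | |].
  - exact: (bmeas_integrable (lexx T) (lexx T) (bmeas_norm bb)).
  - exact: (bmeas_integrable (lexx T) (lexx T)).
  move=> q Tq; have [k [l [Sb kz lz]]] := step_sol0E n T0 Tq b0.
  have := bn _ Tq; rewrite Sb => bd.
  rewrite -(subrK (b (grid T n k, grid T n l)) (b q)) (le_trans (ler_normD _ _))//.
  rewrite addrC lerD// (bigD1 (k, l))//= indicE mem_set; last first.
    by rewrite /C; split; rewrite /= in_itv.
  rewrite mulr1 lerDl sumr_ge0// => p _.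
  by apply: mulr_ge0; [exact: normr_ge0|exact: ler0n].
rewrite RintegralD; [|exact: measurable_rect|exact: (bmeas_integrable (lexx T) (lexx T))|
  exact: (bmeas_integrable (lexx T) (lexx T) (bmeas_cst _ _))].
rewrite Rintegral_cst; last exact: measurable_rect.
rewrite leb2_rect//= divfK ?mulf_neq0 ?gt_eqF// lerD2r.
rewrite (@Rintegral_bmeas_sum _ T T T _ _ c (fun p => \1_(C p)))//.
rewrite /riemann_sum mulr_sumr; apply: ler_sum => p _; rewrite mulrC; apply: ler_wpM2r.
  exact: (normr_ge0 (b _)).
have -> : \int[leb2 R]_(q in rect T T) \1_(C p) q = fine (leb2 R (C p `&` rect T T)).
  by rewrite /Rintegral integral_indic//; exact: measurable_rect.
rewrite -lee_fin fineK; last first.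
  rewrite ge0_fin_numE//; apply: le_lt_trans (leb2_rect_lty T T).
  by apply: le_measure; rewrite ?inE//; [apply: measurableI => //|]; exact: measurable_rect.
apply: (@le_trans _ _ (leb2 R (C p))).
  by apply: le_measure; rewrite ?inE//; apply: measurableI => //; exact: measurable_rect.
rewrite [leLHS]leb2X; try exact: measurable_itv.
rewrite !lebesgue_measure_itv/= !lte_fin !gridS !ltrDl divr_gt0// -!EFinD -EFinM lee_fin.
by rewrite expr2 [grid T n p.1 + _]addrC [grid T n p.2 + _]addrC !addrK.
Qed.

End particle.

(** * The pathwise estimate for one particle *)

Section particle.
Context {R : realType}.
Implicit Types (T t x u v s lam : R) (z : plane R) (n : nat) (h b : plane R -> R).

Lemma within_continuous_comb T (N : nat) (c : R) (aj : nat -> R) (b : nat -> plane R -> R) :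
  (forall j, {within rect T T, continuous (b j : R * R -> R)}) ->
  {within rect T T, continuous
    ((fun z => c * \sum_(1 <= j < N.+1) aj j * b j z) : R * R -> R)}.
Proof.
move=> cb; apply/subspace_continuousP => p Tp.
apply: cvgM; first exact: cvg_cst.
apply: cvg_big; first exact: add_continuous.
move=> j _; apply: cvgM; first exact: cvg_cst.
by have /subspace_continuousP := cb j; exact.
Qed.

(** The rate at which the distance of the empirical mean of the coefficients
    to its limit and the size of the averaged noise act on one particle. *)
Definition particle_rate (T y a A : R) : R :=
  let c1 := `|y| + `|a| * (`|y| * fser (`|a - 1| * (T * T)) * (T * T)) in
  2 * fser (2 * `|-1| * (T * T)) *
  (4 * fser (2 * (A + 1) * (T * T)) * (T * T) * (c1 + (A + 1)) + 1).

Lemma particle_rate_gt0 T y a A : 0 <= T -> 0 <= A -> 0 < particle_rate T y a A.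
Proof.
move=> T0 A0; rewrite /particle_rate.
have f1 : 1 <= fser (2 * `|-1| * (T * T)) by rewrite fser_ge1// !mulr_ge0.
have f2 : 1 <= fser (2 * (A + 1) * (T * T)) by rewrite fser_ge1// !mulr_ge0// addr_ge0.
have f3 : 1 <= fser (`|a - 1| * (T * T)) by rewrite fser_ge1// !mulr_ge0.
rewrite mulr_gt0//; first by rewrite mulr_gt0// (lt_le_trans ltr01).
rewrite ltr_wpDl//; apply: mulr_ge0.
  apply: mulr_ge0; last exact: mulr_ge0.
  by apply: mulr_ge0 => //; exact: le_trans f2.
apply: addr_ge0; last exact: addr_ge0.
apply: addr_ge0 => //; apply: mulr_ge0 => //; apply: mulr_ge0; last exact: mulr_ge0.
by apply: mulr_ge0 => //; exact: le_trans f3.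
Qed.

(** The average [M] of the particles solves a closed equation driven by the
    averaged noise [beta], so [M - a e - beta] is controlled, by Gronwall's lemma,
    by [|abar - a|] and the integral of [|beta|]; here [e] is the solution
    [y f((a - 1) t x)] of [e = y + (a - 1) int int e]. The difference of [Y i] and
    [e] plus a step solution then solves an equation with [lam = -1] and a small
    right-hand side. Only the integral of [beta] enters, not its supremum, hence
    second moments at fixed points suffice later. *)
Lemma particle_estimate T y a A (aj : nat -> R) N i (Y b : nat -> plane R -> R) :
  0 < T -> (forall j, (1 <= j)%N -> `|aj j| <= A) -> (1 <= i <= N)%N ->
  (forall j, bmeas T (Y j)) ->
  (forall j, {within rect T T, continuous (b j : R * R -> R)}) ->
  (forall j, axes0 T (b j)) ->
  (forall j, (1 <= j <= N)%N -> forall z, rect T T z -> Y j z = y +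
    \int[leb2 R]_(q in rect z.1 z.2)
      (N%:R^-1 * (\sum_(1 <= k < N.+1) aj k * Y k q) - Y j q) + b j z) ->
  forall z eps, rect T T z -> 0 < eps -> \forall n \near \oo,
    `|Y i z - y * riemann_fun (a - 1) 0 0 z - step_sol T (-1) n (b i) z| <=
    particle_rate T y a A * (`|N%:R^-1 * (\sum_(1 <= j < N.+1) aj j) - a| +
      riemann_sum T n (fun q => N%:R^-1 * \sum_(1 <= j < N.+1) aj j * b j q)) + eps.
Proof.
move=> T0 ajA iN bY cb b0 eqY z0 eps Tz0 e0; have TT := ltW T0.
have N1 : (1 <= N)%N by case/andP : iN => /leq_trans; exact.
have NR : N%:R != 0 :> R by rewrite pnatr_eq0 -lt0n.
have A0 : 0 <= A by apply: le_trans (ajA 1%N isT).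
set abar := N%:R^-1 * (\sum_(1 <= j < N.+1) aj j).
set beta := fun q : plane R => N%:R^-1 * \sum_(1 <= j < N.+1) aj j * b j q.
have abarA : `|abar| <= A.
  rewrite /abar normrM normfV normr_nat ler_pdivrMl ?ltr0n//.
  apply: le_trans (ler_norm_sum _ _ _) _.
  apply: (@le_trans _ _ (\sum_(1 <= j < N.+1) A)).
    by rewrite !big_nat; apply: ler_sum => j /andP[/ajA].
  by rewrite sumr_const_nat subn1 mulr_natl.
have cbeta := @within_continuous_comb T N N%:R^-1 aj b cb.
have beta0 : axes0 T beta.
  by move=> n k kn; split; rewrite /beta big1 ?mulr0// => j _;
    rewrite ?(proj1 (b0 j n k kn)) ?(proj2 (b0 j n k kn)) mulr0.
have bbeta := bmeas_continuous T0 cbeta beta0.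
pose M := fun q : plane R => N%:R^-1 * (\sum_(1 <= k < N.+1) aj k * Y k q).
have bM : bmeas T M by apply: bmeasZ; apply: bmeas_sum => j; exact: bmeasZ.
pose e := fun q : plane R => y * riemann_fun (a - 1) 0 0 q.
have be : bmeas T e by apply: bmeasZ; exact: bmeas_riemann_fun.
pose I h (z : plane R) := \int[leb2 R]_(q in rect z.1 z.2) h q.
have inte h z : bmeas T h -> rect T T z -> (leb2 R).-integrable (rect z.1 z.2) (EFin \o h).
  by move=> bh /rectP[/andP[_ ?] /andP[_ ?]]; exact: (bmeas_integrable _ _ bh).
have ID h g z : bmeas T h -> bmeas T g -> rect T T z ->
    I (fun q => h q + g q) z = I h z + I g z.
  by move=> bh bg Tz; rewrite /I RintegralD//; try exact: measurable_rect; exact: inte.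
have IB h g z : bmeas T h -> bmeas T g -> rect T T z ->
    I (fun q => h q - g q) z = I h z - I g z.
  by move=> bh bg Tz; rewrite /I RintegralB//; try exact: measurable_rect; exact: inte.
have IZ c h z : bmeas T h -> rect T T z -> I (fun q => c * h q) z = c * I h z.
  by move=> bh Tz; rewrite /I RintegralZl//; [exact: measurable_rect|exact: inte].
have Ile h g z : bmeas T h -> bmeas T g -> rect T T z ->
    (forall q, rect T T q -> h q <= g q) -> I h z <= I g z.
  move=> bh bg Tz hg; apply: le_Rintegral; [exact: measurable_rect|exact: inte..|].
  by move: Tz => /rectP[/andP[_ z1] /andP[_ z2]] q /(rect_sub z1 z2); exact: hg.
have Ic c z : 0 <= c -> rect T T z -> I (cst c) z <= c * (T * T).
  move=> c0 /rectP[/andP[p1 p2] /andP[p3 p4]]; rewrite /I Rintegral_cst; last exact: measurable_rect.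
  by rewrite leb2_rect//=; apply: ler_wpM2l => //; exact: ler_pM.
have IN h z : bmeas T h -> rect T T z -> `|I h z| <= I (fun q => `|h q|) z.
  by move=> bh Tz; apply: le_normr_Rintegral; [exact: measurable_rect|exact: inte].
pose TTT : plane R := (T, T).
have TTTr : rect T T TTT by apply/rectP; rewrite /= TT lexx.
have Imono h z : bmeas T h -> rect T T z -> I (fun q => `|h q|) z <= I (fun q => `|h q|) TTT.
  move=> bh Tz; rewrite /I /Rintegral fine_le//.
  - by apply: integrable_fin_num; [exact: measurable_rect|exact: inte (bmeas_norm bh) Tz].
  - by apply: integrable_fin_num; [exact: measurable_rect|exact: inte (bmeas_norm bh) TTTr].
  apply: ge0_subset_integral => //; [exact: measurable_rect|exact: measurable_rect| |].
    by have /integrableP[] := inte _ _ (bmeas_norm bh) TTTr.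
  by apply: rect_sub; move: Tz => /rectP[/andP[_ ?] /andP[_ ?]].
have eqe z : rect T T z -> e z = y + (a - 1) * I e z.
  move=> Tz; rewrite [I e z]IZ//; last exact: bmeas_riemann_fun.
  have := riemann_fun_resolvent (a - 1) z.1 z.2 (lexx 0) (lexx 0).
  move: (Tz) => /rectP[/andP[-> _] /andP[-> _]]; rewrite -surjective_pairing => h.
  by rewrite /e [(a - 1) * _]mulrCA /I h /=; ring.
(* Averaging the equations of the particles gives a closed one for M. *)
have eqM z : rect T T z -> M z = abar * y + (abar - 1) * I M z + beta z.
  move=> Tz; rewrite {1}/M.
  have -> : \sum_(1 <= k < N.+1) aj k * Y k z =
     \sum_(1 <= k < N.+1) (aj k * y + aj k * I (fun q => M q - Y k q) z + aj k * b k z).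
    rewrite !big_nat; apply: eq_bigr => k /andP[k1 k2]; rewrite eqY ?k1//.
    by rewrite !mulrDr.
  rewrite !big_split/= -mulr_suml !mulrDr mulrA -/abar -/(beta z); congr (_ + _ + _).
  transitivity (N%:R^-1 * \sum_(1 <= k < N.+1) (aj k * I M z - aj k * I (Y k) z)).
    by congr (_ * _); apply: eq_bigr => k _; rewrite IB// mulrBr.
  rewrite sumrB mulrBr -mulr_suml mulrA -/abar mulrBl mul1r; congr (_ - _).
  rewrite /M IZ//; last by apply: bmeas_sum => j; exact: bmeasZ.
  congr (_ * _); rewrite /I; move: (Tz) => /rectP[/andP[_ ?] /andP[_ ?]].
  by rewrite (@Rintegral_bmeas_sum _ T).
(* Subtracting beta leaves an equation whose right-hand side is an integral, so
   that Gronwall's lemma applies to U with the L^1 norm J of beta as datum. *)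
pose Q := fun q => M q - a * e q; pose U := fun q => Q q - beta q.
have bQ : bmeas T Q by apply: bmeasB => //; exact: bmeasZ.
have bU : bmeas T U by exact: bmeasB.
set d := `|abar - a|.
set F1 := fser (2 * (A + 1) * (T * T)); set F2 := fser (2 * `|-1| * (T * T)).
set c1 := `|y| + `|a| * (`|y| * fser (`|a - 1| * (T * T)) * (T * T)).
set J := I (fun q => `|beta q|) TTT.
have J0 : 0 <= J by apply: Rintegral_ge0 => q _.
have eqU z : rect T T z -> U z = (abar - a) * (y + a * I e z) +
    (abar - 1) * (I U z + I beta z).
  move=> Tz; rewrite [I U z]IB// [I Q z]IB//; last exact: bmeasZ.
  by rewrite [I (fun q => a * e q) z]IZ// /U /Q eqM// {1}eqe//; ring.
have IeB z : rect T T z -> `|I e z| <= `|y| * fser (`|a - 1| * (T * T)) * (T * T).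
  move=> Tz; apply: le_trans (IN _ _ be Tz) _.
  have ge0 : 0 <= `|y| * fser (`|a - 1| * (T * T)).
    by rewrite mulr_ge0// (le_trans ler01)// fser_ge1// mulr_ge0// mulr_ge0.
  apply: le_trans (Ic _ _ ge0 Tz); apply: Ile => //; [exact: bmeas_norm|exact: bmeas_cst|].
  by move=> q Tq; rewrite /e normrM ler_wpM2l// normr_riemann_fun_le.
have c10 : 0 <= c1.
  apply: addr_ge0 => //; apply: mulr_ge0 => //; apply: mulr_ge0; last exact: mulr_ge0.
  by apply: mulr_ge0 => //; rewrite (le_trans ler01)// fser_ge1// mulr_ge0// mulr_ge0.
have UB z : rect T T z -> `|U z| <= 2 * (c1 * d + (A + 1) * J) * F1.
  have A1 : 0 <= A + 1 by rewrite addr_ge0.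
  apply: gronwall => //.
    by apply: addr_ge0; [exact: (mulr_ge0 c10 (normr_ge0 _))|exact: (mulr_ge0 A1 J0)].
  move=> {}z Tz; rewrite eqU// (le_trans (ler_normD _ _))//.
  have h1 : `|(abar - a) * (y + a * I e z)| <= c1 * d.
    rewrite normrM -/d mulrC; apply: ler_wpM2r; first exact: normr_ge0.
    apply: le_trans (ler_normD _ _) _; rewrite /c1 lerD2l normrM.
    by apply: ler_wpM2l => //; exact: IeB.
  have h2 : `|abar - 1| <= A + 1.
    by rewrite (le_trans (ler_normB _ _))// normr1 lerD2r.
  have h3 : `|I U z + I beta z| <= I (fun q => `|U q|) z + J.
    apply: le_trans (ler_normD _ _) _; apply: lerD; first exact: IN.
    exact: le_trans (IN _ _ bbeta Tz) (Imono _ _ bbeta Tz).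
  rewrite [`|(abar - 1) * _|]normrM; apply: le_trans (lerD h1 (ler_pM (normr_ge0 _) (normr_ge0 _) h2 h3)) _.
  by rewrite mulrDr [X in _ + X]addrC addrA.
have pr0 := particle_rate_gt0 y a TT A0.
have F20 : 0 < F2 by rewrite (lt_le_trans ltr01)// fser_ge1// !mulr_ge0.
have F10 : 0 < F1 by rewrite (lt_le_trans ltr01)// fser_ge1// !mulr_ge0// addr_ge0.
have e1 : 0 < eps / (4 * F2) by rewrite divr_gt0// mulr_gt0.
have e2 : 0 < eps / (2 * particle_rate T y a A) by rewrite divr_gt0// mulr_gt0.
have nb := cvg_step_sol0 T0 (cb i) (b0 i) e1.
have nJ := integral_norm_le_riemann_sum T0 cbeta beta0 e2.
move: nb nJ; apply: filterS2 => n nb nJ.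
(* The error of the particle solves D = - int int D + int int Q + (b i - its step
   path), with both source terms small. *)
pose D := fun q => Y i q - e q - step_sol T (-1) n (b i) q.
have bS := bmeas_step_sol (-1) n (b i) TT.
have bD : bmeas T D by apply: bmeasB => //; exact: bmeasB.
have bYi := bY i.
have bYe : bmeas T (fun q => Y i q - e q) by exact: bmeasB.
have d0 : 0 <= d by exact: normr_ge0.
have QB z : rect T T z -> `|I Q z| <= 2 * (c1 * d + (A + 1) * J) * F1 * (T * T) + J.
  move=> Tz; have -> : I Q z = I U z + I beta z by rewrite -ID//; congr (I _ _); apply/funext => q; rewrite /U subrK.
  apply: le_trans (ler_normD _ _) _; apply: lerD; last first.
    exact: le_trans (IN _ _ bbeta Tz) (Imono _ _ bbeta Tz).
  have ub0 : 0 <= 2 * (c1 * d + (A + 1) * J) * F1 by apply: le_trans (UB _ Tz).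
  apply: le_trans (IN _ _ bU Tz) (le_trans _ (Ic _ _ ub0 Tz)).
  by apply: Ile => //; [exact: bmeas_norm|exact: bmeas_cst].
have DE z : rect T T z -> D z - (-1) * I D z = I Q z + (b i z - step_sol T 0 n (b i) z).
  move=> Tz; rewrite [I D z]IB// [I (fun q => Y i q - e q) z]IB//.
  rewrite -(step_sol_resolvent (-1) n (b i) TT Tz) -/(I _ z) [I Q z]IB//; last exact: bmeasZ.
  rewrite [I (fun q => a * e q) z]IZ// /D eqY// -/(I _ z) [I (fun q => _ - Y i q) z]IB// -/M.
  by rewrite eqe//; ring.
have := volterra_le TT bD (lam := -1) (H := 2 * (c1 * d + (A + 1) * J) * F1 * (T * T) + J + eps / (4 * F2)).
move=> /(_ _ z0 Tz0) h; apply: le_trans (h _) _ => [z Tz|].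
  rewrite -/(I D z) DE//; apply: le_trans (ler_normD _ _) _.
  by apply: lerD; [exact: QB|exact: nb].
have J1 : J <= riemann_sum T n beta + eps / (2 * particle_rate T y a A) by exact: nJ.
have -> : 2 * (2 * (c1 * d + (A + 1) * J) * F1 * (T * T) + J + eps / (4 * F2)) * fser (2 * `|-1| * (T * T))
  = F2 * (4 * F1 * (T * T) * (c1 * d + (A + 1) * J) + 2 * J) + eps / 2.
  by rewrite -/F2; field; rewrite gt_eqF.
apply: (@le_trans _ _ (particle_rate T y a A * (d + J) + eps / 2)).
  rewrite lerD2r /particle_rate -/c1 -/F1 -/F2.
  rewrite -subr_ge0 [X in 0 <= X](_ : _ = F2 * (4 * F1 * (T * T) * ((c1 + 2 * (A + 1)) * d + (2 * c1 + (A + 1)) * J) + 2 * d)); last by ring.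
    have T2 : 0 <= T * T by exact: mulr_ge0.
    have A1 : 0 <= A + 1 by exact: addr_ge0.
    have x1 : 0 <= (c1 + 2 * (A + 1)) * d by apply: mulr_ge0 => //; lra.
    have x2 : 0 <= (2 * c1 + (A + 1)) * J by apply: mulr_ge0 => //; lra.
    apply: mulr_ge0; first exact: ltW.
    apply: addr_ge0; last by lra.
    apply: mulr_ge0; last exact: addr_ge0.
    apply: mulr_ge0 => //; apply: mulr_ge0 => //; exact: ltW.
apply: (@le_trans _ _ (particle_rate T y a A * (d + (riemann_sum T n beta + eps / (2 * particle_rate T y a A))) + eps / 2)).
  by rewrite lerD2r; apply: ler_wpM2l; [exact: ltW|rewrite lerD2l].
rewrite [leLHS](_ : _ = particle_rate T y a A * (d + riemann_sum T n beta) + eps)//.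
by field; rewrite gt_eqF.
Qed.

End particle.

(** * Second moments of linear combinations and of the sheet *)

Section second_moment.
Context d (U : measurableType d) (R : realType) (mu : {measure set U -> \bar R}).
Variables (D : set U) (mD : measurable D).

(** [2 |f g| <= f^2 + g^2]. *)
Lemma integrable_EFinM (f g : U -> R) : measurable_fun D f -> measurable_fun D g ->
  mu.-integrable D (EFin \o (fun w => f w ^+ 2)) ->
  mu.-integrable D (EFin \o (fun w => g w ^+ 2)) ->
  mu.-integrable D (EFin \o (fun w => f w * g w)).
Proof.
move=> mf mg f2 g2; apply: le_integrable (integrableD mD f2 g2) => //.
  by apply/measurable_EFinP; exact: measurable_funM.
move=> w _ /=; rewrite !lee_fin [leRHS]ger0_norm ?addr_ge0 ?sqr_ge0// ler_norml.
have := sqr_ge0 (f w - g w); have := sqr_ge0 (f w + g w).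
have := sqr_ge0 (f w); have := sqr_ge0 (g w); nra.
Qed.

Variables (n : nat) (c : 'I_n -> R) (X : 'I_n -> U -> R).
Hypothesis iX : forall k l, mu.-integrable D (EFin \o (fun w => X k w * X l w)).

Lemma sq_combE w : (\sum_(k < n) c k * X k w) ^+ 2 =
  \sum_(p <- index_enum ('I_n * 'I_n)%type) (c p.1 * c p.2) * (X p.1 w * X p.2 w).
Proof.
rewrite expr2 mulr_suml -(pair_bigA _ (fun k l => (c k * c l) * (X k w * X l w)))/=.
by apply: eq_bigr => k _; rewrite mulr_sumr; apply: eq_bigr => l _; ring.
Qed.

Lemma integrable_combination (I : Type) (s : seq I) (a : I -> R) (Z : I -> U -> R) :
  (forall i, mu.-integrable D (EFin \o Z i)) ->
  mu.-integrable D (EFin \o (fun w => \sum_(i <- s) a i * Z i w)).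
Proof.
move=> iZ; have -> : EFin \o (fun w => \sum_(i <- s) a i * Z i w) =
    fun w => (\sum_(i <- s) (a i)%:E * (EFin \o Z i) w)%E.
  by apply/funext => w /=; rewrite -sumEFin.
apply: (integrable_sum mD) => i _.
exact: (integrableZl mD (a i) (iZ i)).
Qed.

Lemma Rintegral_combination (I : Type) (s : seq I) (a : I -> R) (Z : I -> U -> R) :
  (forall i, mu.-integrable D (EFin \o Z i)) ->
  \int[mu]_(w in D) (\sum_(i <- s) a i * Z i w) =
  \sum_(i <- s) a i * \int[mu]_(w in D) Z i w.
Proof.
move=> iZ; elim: s => [|i s ih].
  rewrite big_nil; under eq_Rintegral do rewrite big_nil.
  by rewrite /Rintegral integral0.
rewrite big_cons -ih; under eq_Rintegral do rewrite big_cons.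
have iaZ := integrableZl mD (a i) (iZ i).
rewrite RintegralD//; first by rewrite RintegralZl.
exact: integrable_combination.
Qed.

Lemma integrable_sq_comb :
  mu.-integrable D (EFin \o (fun w => (\sum_(k < n) c k * X k w) ^+ 2)).
Proof.
rewrite (_ : EFin \o _ = EFin \o (fun w => \sum_(p <- index_enum ('I_n * 'I_n)%type)
    (c p.1 * c p.2) * (X p.1 w * X p.2 w))); last first.
  by apply/funext => w /=; rewrite sq_combE.
by apply: integrable_combination => p; exact: iX.
Qed.

Lemma Rintegral_sq_comb : \int[mu]_(w in D) ((\sum_(k < n) c k * X k w) ^+ 2) =
  \sum_(p <- index_enum ('I_n * 'I_n)%type)
    (c p.1 * c p.2) * \int[mu]_(w in D) (X p.1 w * X p.2 w).
Proof.
under eq_Rintegral do rewrite sq_combE.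
by apply: Rintegral_combination => p; exact: iX.
Qed.

End second_moment.

Section sheet.
Context {d : measure_display} {Om : measurableType d} {R : realType}.
Variables (P : probability Om R) (T : R) (B : R -> R -> {RV P >-> R}).
Hypothesis hB : brownian_sheet T B.

(** The covariance of the definition is finite, which for the diagonal says
    square integrability. *)
Lemma sheet_integrableM (p q : R * R) : rect T T p -> rect T T q ->
  P.-integrable setT (EFin \o (fun w => B p.1 p.2 w * B q.1 q.2 w)).
Proof.
have sq (r : R * R) : rect T T r -> P.-integrable setT (EFin \o (fun w => B r.1 r.2 w ^+ 2)).
  move=> /rectP[r1 r2]; have [_ mB cB _] := hB.
  apply/integrableP; split.
    by apply/measurable_EFinP; apply: measurable_funX; exact: measurable_funPT.
  have := cB _ _ _ _ r1 r2 r1 r2; rewrite unlock mB//= unlock => e.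
  rewrite [ltLHS](_ : _ = (Num.min r.1 r.1 * Num.min r.2 r.2)%:E) ?ltry// -e.
  apply: eq_integral => w _; rewrite /= ger0_norm ?sqr_ge0//.
  by rewrite /GRing.mul/= subr0 expr2.
by move=> Tp Tq; apply: integrable_EFinM => //; try exact: sq; exact: measurable_funPT.
Qed.

Lemma sheet_covariance (p q : R * R) : rect T T p -> rect T T q ->
  \int[P]_w (B p.1 p.2 w * B q.1 q.2 w) = Num.min p.1 q.1 * Num.min p.2 q.2.
Proof.
move=> /rectP[p1 p2] /rectP[q1 q2]; have [_ mB cB _] := hB.
have := cB _ _ _ _ p1 p2 q1 q2; rewrite unlock !mB//= unlock => e.
rewrite /Rintegral -[RHS]/(fine (_)%:E) -e; congr fine; apply: eq_integral => w _.
by rewrite /GRing.mul/= !subr0.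
Qed.

Lemma sheet_integrable (p : R * R) : rect T T p ->
  P.-integrable setT (EFin \o (B p.1 p.2 : Om -> R)).
Proof.
move=> Tp; have := sheet_integrableM Tp Tp => i2.
have i1 : P.-integrable setT (EFin \o (cst 1 : Om -> R)).
  exact: finite_measure_integrable_cst.
apply: le_integrable (integrableD measurableT i1 i2) => //.
  by apply/measurable_EFinP; exact: measurable_funPT.
move=> w _ /=; rewrite !lee_fin -expr2 [leRHS]ger0_norm ?addr_ge0 ?sqr_ge0// ler_norml.
have := sqr_ge0 (B p.1 p.2 w + 1); have := sqr_ge0 (B p.1 p.2 w - 1); nra.
Qed.

Lemma sheet_mean (p : R * R) : rect T T p -> \int[P]_w B p.1 p.2 w = 0.
Proof.
move=> /rectP[p1 p2]; have [_ mB _ _] := hB.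
by have := mB _ _ p1 p2; rewrite unlock /Rintegral => ->.
Qed.

End sheet.

(** * Step integrals and the isometry *)

Section corners.
Context {R : realType}.
Implicit Types (t x : R) (s : seq (@cell R)) (k : @cell R).

(** A step integral is a combination of values of the sheet at corners of cells,
    and a step function the same combination of indicator functions of quadrants
    [quadrant p]; since [E (B p * B q)] is the area of the intersection of the
    quadrants, the two have equal norms. *)
Definition corners k : seq (R * (R * R)) :=
  let: ((c, (u1, u2)), (v1, v2)) := k in
  [:: (c, (u2, v2)); (- c, (u1, v2)); (- c, (u2, v1)); (c, (u1, v1))].

Definition all_corners s := flatten (map corners s).

Definition quadrant (p : R * R) : set (plane R) :=
  (`]0%R, p.1]%classic : set R) `*` (`]0%R, p.2]%classic : set R).

Lemma measurable_quadrant p : measurable (quadrant p).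
Proof. by apply: measurableX; exact: measurable_itv. Qed.

Lemma step_integral_corners d (Om : measurableType d) (P : probability Om R)
    (B : R -> R -> {RV P >-> R}) s w :
  step_integral B s w = \sum_(k <- all_corners s) k.1 * B k.2.1 k.2.2 w.
Proof.
rewrite /step_integral /all_corners big_flatten/= big_map; apply: eq_bigr.
by move=> [[c [u1 u2]] [v1 v2]] _; rewrite !big_cons big_nil/=; ring.
Qed.

Lemma step_fun_corners t x s z : all (cell_in t x) s ->
  step_fun s z = \sum_(k <- all_corners s) k.1 * \1_(quadrant k.2) z.
Proof.
move=> /allP sin; rewrite /step_fun /all_corners big_flatten/= big_map.
rewrite big_seq [RHS]big_seq; apply: eq_bigr.
move=> [[c [u1 u2]] [v1 v2]] /sin /and5P[u10 u12 _ v10 /andP[v12 _]].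
have boxE (a b e f : R) : \1_(`]a, b]%classic `*` `]e, f]%classic) z =
    (a < z.1 <= b)%R%:R * (e < z.2 <= f)%R%:R :> R.
  by rewrite indicE in_setX !mem_setE !in_itv/= -natrM mulnb.
rewrite !big_cons big_nil/= /quadrant !boxE/=.
have oneD (a b r : R) : 0 <= a -> a <= b ->
    ((a < r <= b)%R%:R : R) = (0 < r <= b)%R%:R - (0 < r <= a)%R%:R.
  move=> a0 ab; case: (ltP a r) => ar /=; case: (leP r b) => rb /=;
    case: (ltP 0 r) => r0 /=; rewrite ?subrr ?subr0//; try lra.
by rewrite (oneD u1)// (oneD v1)//; ring.
Qed.

Lemma all_corners_rect t x s e : all (cell_in t x) s -> e \in all_corners s ->
  rect t x e.2.
Proof.
move=> /allP sin /flattenP[l /mapP[[[c [u1 u2]] [v1 v2]] /sin ks ->]].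
move: ks => /and5P[u10 u12 u2t v10 /andP[v12 v2x]].
rewrite !inE => /or4P[] /eqP->; apply/rectP => /=; split; apply/andP; split; lra.
Qed.

(** The covariance function of the Brownian sheet. *)
Lemma integral_quadrant t x p q : rect t x p -> rect t x q ->
  \int[leb2 R]_(z in rect t x) (\1_(quadrant p) z * \1_(quadrant q) z) =
  Num.min p.1 q.1 * Num.min p.2 q.2.
Proof.
move=> /rectP[/andP[p1 p2] /andP[p3 p4]] /rectP[/andP[q1 q2] /andP[q3 q4]].
pose m := (Num.min p.1 q.1, Num.min p.2 q.2).
have mE (z : plane R) : \1_(quadrant p) z * \1_(quadrant q) z = \1_(quadrant m) z :> R.
  rewrite !indicE -natrM mulnb; congr (nat_of_bool _)%:R.
  rewrite /quadrant !in_setX !mem_setE !in_itv/= !le_min.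
  by case: (0 < z.1); case: (0 < z.2); case: (z.1 <= p.1); case: (z.1 <= q.1);
    case: (z.2 <= p.2); case: (z.2 <= q.2).
under eq_Rintegral do rewrite mE.
rewrite /Rintegral integral_indic; [|exact: measurable_rect|exact: measurable_quadrant].
rewrite setIidl; last first.
  move=> z; rewrite /quadrant /= !in_itv/= !le_min => -[/andP[z1 /andP[z2 _]] /andP[z3 /andP[z4 _]]].
  by apply/rectP; rewrite (ltW z1) (ltW z3) (le_trans z2 p2) (le_trans z4 p4).
rewrite [leb2 R _]leb2X; try exact: measurable_itv.
rewrite !lebesgue_measure_itv/= !lte_fin !sube0.
have m1 : 0 <= Num.min p.1 q.1 by rewrite le_min p1 q1.
have m2 : 0 <= Num.min p.2 q.2 by rewrite le_min p3 q3.
move: m1; rewrite le_eqVlt => /predU1P[<-|->]; first by rewrite ltxx mul0e mul0r.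
move: m2; rewrite le_eqVlt => /predU1P[<-|->]; first by rewrite ltxx mule0 mulr0.
by [].
Qed.

Lemma integrable_quadrant t x p q : (leb2 R).-integrable (rect t x)
  (EFin \o (fun z => \1_(quadrant p) z * \1_(quadrant q) z)).
Proof.
apply: integrable_rect.
  by apply: measurable_funTS; apply: measurable_funM;
    apply: measurable_indic; exact: measurable_quadrant.
by exists 1 => z _; rewrite -natrM normr_nat lern1; do 2 case: (_ \in _).
Qed.

End corners.

Section isometry.
Context {d : measure_display} {Om : measurableType d} {R : realType}.
Variables (P : probability Om R) (T : R) (B : R -> R -> {RV P >-> R}).
Hypothesis hB : brownian_sheet T B.
Variables (t x : R) (s : seq (@cell R)).
Hypotheses (tT : t <= T) (xT : x <= T) (sin : all (cell_in t x) s).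

Let L := all_corners s.
Let c (k : 'I_(size L)) := (tnth (in_tuple L) k).1.
Let p (k : 'I_(size L)) := (tnth (in_tuple L) k).2.

Let tx_p k : rect t x (p k).
Proof. by apply: (all_corners_rect sin); exact: mem_tnth. Qed.

Let T_p k : rect T T (p k).
Proof. exact: (rect_sub tT xT (tx_p k)). Qed.

Let siE w : step_integral B s w = \sum_(k < size L) c k * B (p k).1 (p k).2 w.
Proof. by rewrite step_integral_corners big_tnth. Qed.

Let sfE z : step_fun s z = \sum_(k < size L) c k * \1_(quadrant (p k)) z.
Proof. by rewrite (step_fun_corners _ sin) big_tnth. Qed.

Let iBB k l : P.-integrable setT
  (EFin \o (fun w => B (p k).1 (p k).2 w * B (p l).1 (p l).2 w)).
Proof. exact: (sheet_integrableM hB). Qed.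

Lemma step_integral_gaussian : gaussian_law P (step_integral B s).
Proof.
have [gB _ _ _] := hB; have -> : step_integral B s = fun w => \sum_(k < size L) c k * B (p k).1 (p k).2 w
  by apply/funext => w; exact: siE.
by apply: gB => k; rewrite inE.
Qed.

Lemma step_integral_integrable : P.-integrable setT (EFin \o step_integral B s).
Proof.
have -> : step_integral B s = fun w => \sum_(k < size L) c k * B (p k).1 (p k).2 w
  by apply/funext => w; exact: siE.
exact: (integrable_combination measurableT _ _ (fun k => sheet_integrable hB (T_p k))).
Qed.

Lemma step_integral_mean : \int[P]_w step_integral B s w = 0.
Proof.
under eq_Rintegral do rewrite siE.
rewrite (Rintegral_combination measurableT _ _ (fun k => sheet_integrable hB (T_p k))).
by rewrite big1// => k _; rewrite (sheet_mean hB (T_p k)) mulr0.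
Qed.

Lemma step_integral_sq_integrable :
  P.-integrable setT (EFin \o (fun w => step_integral B s w ^+ 2)).
Proof.
rewrite (_ : (fun w => _) = fun w => (\sum_(k < size L) c k * B (p k).1 (p k).2 w) ^+ 2).
  by apply: integrable_sq_comb => // k l; exact: iBB.
by apply/funext => w; rewrite siE.
Qed.

Lemma step_fun_sq_integrable :
  (leb2 R).-integrable (rect t x) (EFin \o (fun z => step_fun s z ^+ 2)).
Proof.
rewrite (_ : (fun z => _) = fun z => (\sum_(k < size L) c k * \1_(quadrant (p k)) z) ^+ 2).
  apply: integrable_sq_comb; first exact: measurable_rect.
  by move=> k l; exact: integrable_quadrant.
by apply/funext => z; rewrite sfE.
Qed.

Lemma step_isometry : \int[P]_w (step_integral B s w ^+ 2) =
  \int[leb2 R]_(z in rect t x) (step_fun s z ^+ 2).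
Proof.
under eq_Rintegral do rewrite siE; under [RHS]eq_Rintegral do rewrite sfE.
rewrite Rintegral_sq_comb// [RHS]Rintegral_sq_comb; [|exact: measurable_rect|]; last first.
  by move=> k l; exact: integrable_quadrant.
apply: eq_bigr => k _; congr (_ * _).
by rewrite integral_quadrant// (sheet_covariance hB).
Qed.

End isometry.

(** * Centred Gaussian laws *)

Section affine.
Context {R : realType}.
Local Notation mu := (@lebesgue_measure R).
Variables (m s : R) (s0 : 0 < s).

Definition affine (z : measurableTypeR R) : measurableTypeR R := s * z + m.

Lemma measurable_affine : measurable_fun setT affine.
Proof. by apply: measurable_funD => //; exact: measurable_funM. Qed.

Let s1 : {nonneg R} := NngNum (ltW s0).

Let nu : {measure set (measurableTypeR R) -> \bar R}.
Proof.
refine [the {measure set _ -> \bar R} of pushforward mu affine].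
exact: measurable_affine.
Defined.

Lemma lebesgue_measure_affine (A : set (measurableTypeR R)) : measurable A ->
  mu A = mscale s1 nu A.
Proof.
apply: (@lebesgue_measure_unique R (mscale s1 nu)) => _ [[a b]] _ <-.
rewrite -[RHS]/(s%:E * mu (affine @^-1` `]a, b]%classic))%E.
have -> : affine @^-1` `]a, b]%classic = `](a - m) / s, (b - m) / s]%classic.
  apply/seteqP; split => z /=; rewrite /affine !in_itv/=;
    by rewrite ltr_pdivrMr// ler_pdivlMr// ltrBlDr lerBrDr mulrC.
rewrite [LHS]lebesgue_measure_itv [X in (_ * X)%E]lebesgue_measure_itv/= !lte_fin.
rewrite ltr_pM2r ?invr_gt0// ltrD2r; case: ifPn => _; last by rewrite mule0.
rewrite -!EFinD -EFinM; congr EFin; field; exact: lt0r_neq0.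
Qed.

(** Change of variables, from the effect of affine maps on the Lebesgue measure. *)
Lemma normal_prob_affine (A : set (measurableTypeR R)) : measurable A ->
  normal_prob m s A = normal_prob 0 1 (affine @^-1` A).
Proof.
move=> mA; rewrite /normal_prob.
have mpdf : measurable_fun A (fun x : measurableTypeR R => (normal_pdf m s x)%:E).
  by apply/measurable_EFinP/measurable_funTS; exact: measurable_normal_pdf.
transitivity (\int[mscale s1 nu]_(x in A) (normal_pdf m s x)%:E)%E.
  by apply: eq_measure_integral => // C mC _; exact: lebesgue_measure_affine.
rewrite ge0_integral_mscale//; last by move=> x _; rewrite lee_fin normal_pdf_ge0.
have -> : (\int[nu]_(x in A) (normal_pdf m s x)%:E =
    \int[mu]_(z in affine @^-1` A) (normal_pdf m s (affine z))%:E)%E.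
  have pos : {in A, forall x, (0 <= (normal_pdf m s x)%:E)%E}.
    by move=> x _; rewrite lee_fin normal_pdf_ge0.
  have h := ge0_integral_pushforward measurable_affine mu mA mpdf pos.
  exact: h.
have mA' : measurable (affine @^-1` A : set (measurableTypeR R)) by rewrite -[X in measurable X]setTI; exact: measurable_affine.
have mpa : measurable_fun (affine @^-1` A : set (measurableTypeR R)) (fun z : measurableTypeR R => (normal_pdf m s (affine z))%:E).
  apply/measurable_EFinP.
  apply: measurable_funTS.
  apply: (@measurableT_comp _ _ _ (measurableTypeR R) (measurableTypeR R) _ (normal_pdf m s) _ affine).
  exact: measurable_normal_pdf.
  exact: measurable_affine.
rewrite -(@ge0_integralZl _ _ R mu _ mA' (fun z : measurableTypeR R => (normal_pdf m s (affine z))%:E)) //; last first.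
  by move=> x _; rewrite lee_fin normal_pdf_ge0.
apply: eq_integral => z _ /=; rewrite -EFinM; congr EFin.
have sn0 := lt0r_neq0 s0.
rewrite !normal_pdfE ?oner_eq0//.
rewrite /normal_peak /normal_fun /affine addrK subr0.
rewrite expr1n mul1r mulrA; congr (_ * expR _); last first.
  by field.
rewrite -mulrnAr sqrtrM ?sqr_ge0// sqrtr_sqr gtr0_norm// invfM mulrA divff// mul1r.
by [].
Qed.
End affine.

Section law.
Context {R : realType} d (Om : measurableType d) (P : probability Om R)
  d' (Om' : measurableType d') (P' : probability Om' R).

Definition same_law (X : Om -> R) (X' : Om' -> R) :=
  forall A : set R, measurable A -> pushforward P X A = pushforward P' X' A.

Lemma same_law_integral (X : Om -> R) (X' : Om' -> R) (f : R -> R) :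
  measurable_fun setT X -> measurable_fun setT X' -> same_law X X' ->
  measurable_fun setT f ->
  P.-integrable setT (EFin \o (f \o X)) -> P'.-integrable setT (EFin \o (f \o X')) ->
  \int[P]_w f (X w) = \int[P']_w f (X' w).
Proof.
move=> mX mX' XX' mf iX iX'; rewrite /Rintegral; congr fine.
pose Y : {RV P >-> R} := HB.pack X (isMeasurableFun.Build _ _ _ _ _ mX).
pose Y' : {RV P' >-> R} := HB.pack X' (isMeasurableFun.Build _ _ _ _ _ mX').
have mEf : measurable_fun setT (EFin \o f) by apply/measurable_EFinP.
rewrite -(integral_distribution (X := Y) mEf iX) -(integral_distribution (X := Y') mEf iX').
by apply: eq_measure_integral => // A mA _; exact: XX'.
Qed.

End law.

Section gaussian.
Context {R : realType}.

Section standardize.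
Context d (Om : measurableType d) (P : probability Om R) (X : Om -> R) (m s : R).
Hypotheses (s0 : 0 < s).
Hypothesis lX : forall A : set R, measurable A -> pushforward P X A = normal_prob m s A.

Lemma standardized_law (A : set R) : measurable A ->
  pushforward P (fun w => (X w - m) / s) A = normal_prob 0 1 A.
Proof.
move=> mA; pose psi (x : R) := (x - m) / s.
have mpsi : measurable_fun setT psi by apply: measurable_funM => //; exact: measurable_funB.
have mB : measurable (psi @^-1` A : set R) by rewrite -[X in measurable X]setTI; exact: mpsi.
transitivity (normal_prob m s (psi @^-1` A)); first exact: (lX mB).
rewrite (normal_prob_affine m s0 mB); congr (normal_prob 0 1 _).
apply/seteqP; split => z /=; rewrite /psi /affine addrK mulrAC divff ?mul1r//;
  exact: lt0r_neq0.
Qed.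

(** A normal law does not charge points, so the variable is not almost surely
    zero. *)
Lemma normal_sq_neq0 : measurable_fun setT X -> P.-integrable setT (EFin \o (fun w => X w ^+ 2)) ->
  \int[P]_w (X w ^+ 2) != 0.
Proof.
move=> mX iX; apply/eqP => X0.
have e0 : (\int[P]_w `|(X w ^+ 2)%:E| = 0)%E.
  rewrite -[RHS]/(0%:E) -X0 /Rintegral fineK; last exact: integrable_fin_num.
  by apply: eq_integral => w _; rewrite gee0_abs// lee_fin sqr_ge0.
have mX2 : measurable_fun setT (fun w => (X w ^+ 2)%:E).
  by apply/measurable_EFinP; exact: measurable_funX.
have ae0 := (ae_eq_integral_abs P measurableT mX2).1 e0.
have p0 : P (~` (X @^-1` [set 0])) = 0%E.
  have [N [mN N0 sN]] := ae0.
  apply: (subset_measure0 _ mN _ N0).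
    by apply: measurableC; rewrite -[Y in measurable Y]setTI; exact: mX.
  move=> w /= Xw; apply: sN => /= /(_ I) [] /eqP; rewrite sqrf_eq0 => /eqP; exact: Xw.
have mS : measurable (X @^-1` [set 0]) by rewrite -[Y in measurable Y]setTI; exact: mX.
have : P (~` (X @^-1` [set 0])) = 1%E.
  rewrite probability_setC//.
  rewrite -/(pushforward P X [set 0]) lX; last exact: measurable_set1.
  rewrite (_ : normal_prob m s [set 0] = 0%E) ?sube0//.
  by rewrite /normal_prob integral_set1.
by rewrite p0 => /eqP; rewrite eq_sym onee_eq0.
Qed.

End standardize.

Lemma Rintegral_probability_cst d (Om : measurableType d) (P : probability Om R) (c : R) :
  \int[P]_w c = c.
Proof.
rewrite Rintegral_cst// -[RHS]mulr1; congr (_ * _).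
by rewrite -[RHS]/(fine 1%E); congr fine; exact: probability_setT.
Qed.

Lemma dirac_law_mean d (Om : measurableType d) (P : probability Om R) (X : Om -> R) (m : R) :
  measurable_fun setT X ->
  (forall A : set R, measurable A ->
     pushforward P X A = (\d_m : {measure set R -> \bar R}) A) ->
  forall f : R -> R, measurable_fun setT f -> P.-integrable setT (EFin \o (f \o X)) ->
  \int[P]_w f (X w) = f m.
Proof.
move=> mX lX f mf ifX.
rewrite (@same_law_integral _ _ _ P _ _ P X (cst m) f)//.
- exact: (Rintegral_probability_cst P (f m)).
- move=> A mA; rewrite lX// [LHS]diracE /pushforward preimage_cst.
  by case: ifPn => _; rewrite ?probability_setT ?measure0.
- rewrite (_ : EFin \o _ = EFin \o cst (f m))//; exact: finite_measure_integrable_cst.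
Qed.

Lemma standardized_integrals d (Om : measurableType d) (P : probability Om R) (X : Om -> R) (m s : R) :
  0 < s -> P.-integrable setT (EFin \o X) ->
  P.-integrable setT (EFin \o (fun w => X w ^+ 2)) -> \int[P]_w X w = 0 ->
  [/\ P.-integrable setT (EFin \o (fun w => (X w - m) / s)),
      \int[P]_w ((X w - m) / s) = - m / s,
      P.-integrable setT (EFin \o (fun w => ((X w - m) / s - (- m / s)) ^+ 2)) &
      \int[P]_w (((X w - m) / s - (- m / s)) ^+ 2) = \int[P]_w (X w ^+ 2) / s ^+ 2].
Proof.
move=> s0 iX iX2 EX.
have ic c : P.-integrable setT (EFin \o (cst c : Om -> R)).
  exact: finite_measure_integrable_cst.
have iXm : P.-integrable setT (EFin \o (fun w => X w - m)).
  exact: (integrableB measurableT iX (ic m)).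
have sqE w : ((X w - m) / s - (- m / s)) ^+ 2 = s ^- 2 * X w ^+ 2.
  by field; exact: lt0r_neq0.
have i2 : P.-integrable setT (EFin \o (fun w => s ^- 2 * X w ^+ 2)).
  exact: (integrableZl measurableT (s ^- 2) iX2).
split.
- have -> : EFin \o (fun w => (X w - m) / s) = fun w => ((s^-1)%:E * ((X w - m)%R)%:E)%E.
    by apply/funext => w /=; rewrite mulrC EFinM.
  exact: (integrableZl measurableT).
- rewrite RintegralZr// RintegralB// ?EX; last exact: (ic m).
  by rewrite sub0r Rintegral_probability_cst.
- by have -> : (fun w => ((X w - m) / s - (- m / s)) ^+ 2) = (fun w => s ^- 2 * X w ^+ 2)
    by apply/funext.
- under eq_Rintegral do rewrite sqE.
  by rewrite RintegralZl// mulrC.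
Qed.

Section unique.
Context d (Om : measurableType d) (P : probability Om R)
  d' (Om' : measurableType d') (P' : probability Om' R).
Variables (X : Om -> R) (X' : Om' -> R).
Hypotheses (mX : measurable_fun setT X) (mX' : measurable_fun setT X').
Hypotheses (iX : P.-integrable setT (EFin \o X)) (iX' : P'.-integrable setT (EFin \o X')).
Hypotheses (iX2 : P.-integrable setT (EFin \o (fun w => X w ^+ 2)))
  (iX2' : P'.-integrable setT (EFin \o (fun w => X' w ^+ 2))).
Hypotheses (EX : \int[P]_w X w = 0) (EX' : \int[P']_w X' w = 0).
Hypothesis VX : \int[P]_w (X w ^+ 2) = \int[P']_w (X' w ^+ 2).

(** A centred Gaussian law is determined by its variance. The parameters of the
    two normal laws are compared without computing the moments of a normal law:
    after standardization both variables have the law [normal_prob 0 1], so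
    [- m / s] and [sigma ^ 2 / s ^ 2], which are moments of that one law, agree. *)
Lemma gaussian_same_law : gaussian_law P X -> gaussian_law P' X' -> same_law P P' X X'.
Proof.
have msq : measurable_fun setT (fun x : R => x ^+ 2) by exact: measurable_funX.
have dm d1 (Om1 : measurableType d1) (P1 : probability Om1 R) (X1 : Om1 -> R) m1 :
   measurable_fun setT X1 -> P1.-integrable setT (EFin \o X1) ->
   P1.-integrable setT (EFin \o (fun w => X1 w ^+ 2)) -> \int[P1]_w X1 w = 0 ->
   (forall A : set R, measurable A ->
     pushforward P1 X1 A = (\d_m1 : {measure set R -> \bar R}) A) ->
   m1 = 0 /\ \int[P1]_w (X1 w ^+ 2) = 0.
  move=> mX1 iX1 iX12 EX1 lX1.
  have m10 : m1 = 0 by rewrite -EX1 (dirac_law_mean mX1 lX1 (f := id)).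
  by split => //; rewrite (dirac_law_mean mX1 lX1 msq)// m10 expr0n.
move=> [[m lX]|[m [s [s0 lX]]]] [[m' lX']|[m' [s' [s0' lX']]]].
- have [m0 _] := dm _ _ _ _ _ mX iX iX2 EX lX.
  have [m0' _] := dm _ _ _ _ _ mX' iX' iX2' EX' lX'.
  by move=> A mA; rewrite lX// lX'// m0 m0'.
- have [_ v0] := dm _ _ _ _ _ mX iX iX2 EX lX.
  by have := normal_sq_neq0 lX' mX' iX2'; rewrite -VX v0 eqxx.
- have [_ v0] := dm _ _ _ _ _ mX' iX' iX2' EX' lX'.
  by have := normal_sq_neq0 lX mX iX2; rewrite VX v0 eqxx.
- have [iZ EZ iZ2 VZ] := standardized_integrals m s0 iX iX2 EX.
  have [iZ' EZ' iZ2' VZ'] := standardized_integrals m' s0' iX' iX2' EX'.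
  have lZ : same_law P P' (fun w => (X w - m) / s) (fun w => (X' w - m') / s').
    by move=> A mA; rewrite (standardized_law s0 lX mA) (standardized_law s0' lX' mA).
  have mZ : measurable_fun setT (fun w => (X w - m) / s).
    by apply: measurable_funM => //; exact: measurable_funB.
  have mZ' : measurable_fun setT (fun w => (X' w - m') / s').
    by apply: measurable_funM => //; exact: measurable_funB.
  have mu_eq : - m / s = - m' / s'.
    by rewrite -EZ -EZ' (same_law_integral mZ mZ' lZ (f := id)).
  have mf : measurable_fun setT (fun z : R => (z - (- m / s)) ^+ 2).
    by apply: measurable_funX; exact: measurable_funB.
  have V_eq : \int[P]_w (X w ^+ 2) / s ^+ 2 = \int[P']_w (X' w ^+ 2) / s' ^+ 2.
    rewrite -VZ -VZ' -mu_eq (same_law_integral mZ mZ' lZ mf)//.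
    by rewrite mu_eq.
  have v0 := normal_sq_neq0 lX' mX' iX2'.
  have ss : s = s'.
    move: V_eq; rewrite VX => /(mulfI v0)/invr_inj/eqP.
    by rewrite eqrXn2 ?ltW// => /eqP.
  have mm : m = m'.
    move: mu_eq; rewrite ss => /(mulIf _); rewrite invr_eq0 lt0r_neq0// => /(_ isT).
    by move/oppr_inj.
  by move=> A mA; rewrite lX// lX'// ss mm.
Qed.

End unique.

End gaussian.

(** * The averaged noise *)

Section independent_product.
Context d (Om : measurableType d) (R : realType) (P : probability Om R).
Variables (X Y : {RV P >-> R}).
Hypothesis XY : forall A B : set R, measurable A -> measurable B ->
  P (X @^-1` A `&` Y @^-1` B) = (P (X @^-1` A) * P (Y @^-1` B))%E.

(** By independence the law of the pair is the product law, and Fubini's theorem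
    integrates the centred factor first. *)
Lemma independent_mean_mul :
  P.-integrable setT (EFin \o (fun w => X w * Y w)) ->
  P.-integrable setT (EFin \o Y) ->
  \int[P]_w Y w = 0 -> \int[P]_w (X w * Y w) = 0.
Proof.
move=> iXY iY EY; rewrite /Rintegral.
pose mu : probability R R := distribution P X.
pose nu : probability R R := distribution P Y.
pose phi w : (R * R)%type := (X w, Y w).
have mphi : measurable_fun setT phi.
  by apply: measurable_fun_pair; exact: measurable_funPT.
pose f (z : R * R) : \bar R := (z.1 * z.2)%:E.
have mf : measurable_fun setT f.
  by apply/measurable_EFinP; apply: measurable_funM.
pose Q : {RV P >-> (R * R)%type} := HB.pack phi (isMeasurableFun.Build _ _ _ _ _ mphi).
have QE (A : set (R * R)) : measurable A -> (mu \x nu)%E A = distribution P Q A.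
  apply: product_measure_unique => C D mC mD.
  rewrite /distribution /pushforward -XY//; congr (P _).
have iQ : P.-integrable setT (f \o Q) by exact: iXY.
have iprod : (mu \x nu)%E.-integrable setT f.
  apply/integrableP; split => //.
  rewrite (eq_measure_integral (distribution P Q)); last by move=> A mA _; exact: QE.
  have -> : (\int[distribution P Q]_x `|f x| = \int[P]_x ((fun z => `|f z|) \o Q) x)%E.
    by apply: ge0_integral_distribution => //; exact: measurableT_comp.
  by have /integrableP[] := iQ.
have -> : (\int[P]_w (X w * Y w)%:E = \int[mu \x nu]_z f z)%E.
  rewrite (eq_measure_integral (distribution P Q)); last by move=> A mA _; exact: QE.
  by rewrite (integral_distribution mf iQ).
rewrite -integral12_prod_meas1//.
rewrite (eq_integral (cst 0%E)); first by rewrite integral_cst// mul0e.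
have mE : measurable_fun setT (EFin : R -> \bar R) by exact: EFin_measurable.
have inu : nu.-integrable setT (EFin : R -> \bar R).
  by apply: (@integrable_pushforward _ _ _ _ _ Y) => //; exact: measurable_funPT.
move=> x _; rewrite /fubini_F /f/=.
under eq_integral do rewrite EFinM.
rewrite integralZl//.
have -> : (\int[nu]_y y%:E = \int[P]_w (Y w)%:E)%E.
  by rewrite (integral_distribution (X := Y) mE iY).
rewrite -(fineK (integrable_fin_num measurableT iY)).
have -> : fine (\int[P]_w (EFin \o Y) w)%E = 0 by exact: EY.
by rewrite mule0.
Qed.

End independent_product.

Section averaged_sheet.
Context d (Om : measurableType d) (R : realType) (P : probability Om R).
Variables (T : R) (N : nat) (B : nat -> R -> R -> {RV P >-> R}).
Hypothesis hB : brownian_sheet_vector T N B.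

Lemma field_sigma_algebra_preimage (X : R -> R -> {RV P >-> R}) (p : R * R) (A : set R) :
  rect T T p -> measurable A -> field_sigma_algebra T X (X p.1 p.2 @^-1` A).
Proof.
move=> /rectP[p1 p2] mA; apply: sub_sigma_algebra.
by exists p.1, p.2, A.
Qed.

(** The events of the two sheets are completed by the sure event for the other
    components. *)
Lemma sheet_uncorrelated i j (p q : R * R) : (1 <= i <= N)%N -> (1 <= j <= N)%N ->
  i != j -> rect T T p -> rect T T q ->
  P.-integrable setT (EFin \o (fun w => B i p.1 p.2 w * B j q.1 q.2 w)) /\
  \int[P]_w (B i p.1 p.2 w * B j q.1 q.2 w) = 0.
Proof.
move=> iN jN ij Tp Tq; have [shB ind] := hB.
have iM : P.-integrable setT (EFin \o (fun w => B i p.1 p.2 w * B j q.1 q.2 w)).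
  apply: integrable_EFinM => //; try exact: measurable_funPT.
    by have := sheet_integrableM (shB _ iN) Tp Tp.
  by have := sheet_integrableM (shB _ jN) Tq Tq.
split => //; apply: independent_mean_mul => //.
- move=> C D mC mD.
  pose E k : set Om := if k == i then B i p.1 p.2 @^-1` C else
    if k == j then B j q.1 q.2 @^-1` D else setT.
  have hE k : (1 <= k <= N)%N -> field_sigma_algebra T (B k) (E k).
    move=> kN; rewrite /E; case: eqP => [->|_]; first exact: field_sigma_algebra_preimage.
    case: eqP => [->|_]; first exact: field_sigma_algebra_preimage.
    by rewrite -(preimage_setT (B k p.1 p.2)); exact: field_sigma_algebra_preimage.
  have := ind E hE.
  have -> : \bigcap_(k in [set k | (1 <= k <= N)%N]) E k =
      B i p.1 p.2 @^-1` C `&` B j q.1 q.2 @^-1` D.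
    apply/seteqP; split => [w h|w [hC hD] k kN].
      split; first by have := h i iN; rewrite /E eqxx.
      by have := h j jN; rewrite /E eq_sym (negbTE ij) eqxx.
    by rewrite /E; case: ifP => // _; case: ifP.
  move=> ->; rewrite (bigD1_seq i) ?iota_uniq ?mem_index_iota//=.
  rewrite big_mkcond/= (bigD1_seq j) ?iota_uniq ?mem_index_iota//= eq_sym ij.
  rewrite big1 ?mule1; first by rewrite /E !eqxx eq_sym (negbTE ij).
  move=> k kj; case: ifP => // ki.
  by rewrite /E (negbTE ki) (negbTE kj) probability_setT.
- exact: (sheet_integrable (shB _ jN) Tq).
- exact: (sheet_mean (shB _ jN) Tq).
Qed.

(** Independence makes the variance of an average of [N] sheets with bounded
    weights of order [1 / N]. *)
Lemma averaged_sheet_sq A (aj : nat -> R) (p : R * R) : (1 <= N)%N ->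
  (forall j, (1 <= j)%N -> `|aj j| <= A) -> rect T T p ->
  P.-integrable setT (EFin \o (fun w => (N%:R^-1 * \sum_(1 <= j < N.+1) aj j * B j p.1 p.2 w) ^+ 2)) /\
  \int[P]_w ((N%:R^-1 * \sum_(1 <= j < N.+1) aj j * B j p.1 p.2 w) ^+ 2) <= (A * T) ^+ 2 / N%:R.
Proof.
move=> N1 ajA Tp.
have NR : N%:R != 0 :> R by rewrite pnatr_eq0 -lt0n.
pose c (k : 'I_N) := N%:R^-1 * aj k.+1; pose X (k : 'I_N) w := B k.+1 p.1 p.2 w.
have kN (k : 'I_N) : (1 <= k.+1 <= N)%N by rewrite ltn_ord.
have sE w : N%:R^-1 * \sum_(1 <= j < N.+1) aj j * B j p.1 p.2 w = \sum_(k < N) c k * X k w.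
  by rewrite big_add1/= big_mkord mulr_sumr; apply: eq_bigr => k _; rewrite mulrA.
have shB := hB.1.
have iX k l : P.-integrable setT (EFin \o (fun w => X k w * X l w)).
  have [->|kl] := eqVneq k l; first by have := sheet_integrableM (shB _ (kN l)) Tp Tp.
  by have [] := sheet_uncorrelated (kN k) (kN l) kl Tp Tp.
split.
  rewrite (_ : (fun w => _) = fun w => (\sum_(k < N) c k * X k w) ^+ 2); first exact: integrable_sq_comb.
  by apply/funext => w; rewrite sE.
under eq_Rintegral do rewrite sE.
rewrite Rintegral_sq_comb//.
have XX k l : \int[P]_w (X k w * X l w) = (k == l)%:R * (p.1 * p.2).
  have [->|kl] := eqVneq k l; last by rewrite (sheet_uncorrelated (kN k) (kN l) kl Tp Tp).2 mul0r.
  by have := sheet_covariance (shB _ (kN l)) Tp Tp; rewrite /X => ->; rewrite !minxx mul1r.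
under eq_bigr do rewrite XX.
rewrite -(pair_bigA _ (fun k l => c k * c l * ((k == l)%:R * (p.1 * p.2))))/=.
apply: (@le_trans _ _ (\sum_(k < N) (N%:R^-1 ^+ 2 * A ^+ 2 * T ^+ 2))); last first.
  rewrite sumr_const card_ord -mulr_natl -subr_ge0 le_eqVlt; apply/orP; left.
  by apply/eqP; field.
apply: ler_sum => k _; rewrite (bigD1 k)//= big1 ?addr0; last first.
  by move=> l lk; rewrite eq_sym (negbTE lk) mul0r mulr0.
rewrite eqxx mul1r -expr2 /c exprMn.
have /rectP[/andP[p1 p2] /andP[p3 p4]] := Tp.
apply: ler_pM; [by rewrite mulr_ge0 ?sqr_ge0|by rewrite mulr_ge0| |].
  apply: ler_wpM2l; first exact: sqr_ge0.
  rewrite -real_normK ?num_real// lerXn2r ?nnegrE//; last exact: ajA.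
  exact: le_trans (ajA k.+1 isT).
by rewrite expr2 ler_pM.
Qed.

End averaged_sheet.

(** * Limits in mean square and expectations of bounded functions *)

Section square_limits.
Context d (Om : measurableType d) (R : realType) (P : probability Om R).

(** Fatou's lemma for second moments, with a domination in place of a limit:
    [X] may be below the lower limit of [|Z n|]. *)
Lemma fatou_sq (X : Om -> R) (Z : nat -> Om -> R) (c : R) :
  measurable_fun setT X -> (forall n, measurable_fun setT (Z n)) ->
  {ae P, forall w, forall eps, 0 < eps ->
    \forall n \near \oo, `|X w| <= `|Z n w| + eps} ->
  (\forall n \near \oo, (\int[P]_w ((Z n w) ^+ 2)%:E <= c%:E)%E) ->
  (\int[P]_w ((X w) ^+ 2)%:E <= c%:E)%E.
Proof.
move=> mX mZ XZ Zc.
(* A lower bound of q^2 that tends to p^2 with r. *)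
have key (p q r : R) : 0 <= p -> 0 <= q -> p <= q + r -> 0 < r ->
    p ^+ 2 - r * (2 * p + 1) <= q ^+ 2.
  by move=> p0 q0 pqr r0; have [pr|rp] := leP p r; nra.
pose u n w := ((Z n w) ^+ 2)%:E : \bar R.
have mu n : measurable_fun setT (u n) by apply/measurable_EFinP; exact: measurable_funX.
have u0 n w : (0 <= u n w)%E by rewrite lee_fin sqr_ge0.
have fat := fatou P measurableT mu (fun n w _ => u0 n w).
have le1 : (\int[P]_w ((X w) ^+ 2)%:E <= \int[P]_w limn_einf (u ^~ w))%E.
  apply: ae_ge0_le_integral => //.
  - by move=> w _; rewrite lee_fin sqr_ge0.
  - by apply/measurable_EFinP; exact: measurable_funX.
  - move=> w _; rewrite limn_einf_lim; apply: lime_ge; first exact: is_cvg_einfs.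
    by apply: nearW => n; apply: le_ereal_inf_tmp => _ [k _ <-]; exact: u0.
  - under eq_fun do rewrite limn_einf_lim.
    apply: (emeasurable_fun_cvg (fun n w => einfs (u ^~ w) n)).
      by move=> n; apply: measurable_fun_einfs.
    by move=> w _; exact: is_cvg_einfs.
  apply: filterS XZ => w Xw _; rewrite limn_einf_lim.
  apply/lee_subgt0Pr => del del0.
  apply: lime_ge; first exact: is_cvg_einfs.
  pose e := del / (2 * `|X w| + 1).
  have den : 0 < 2 * `|X w| + 1 by rewrite ltr_wpDl// mulr_ge0.
  have e0 : 0 < e by rewrite divr_gt0.
  have [N _ hN] := Xw e e0.
  exists N => // n /= Nn; apply: le_ereal_inf_tmp => _ [k /= nk <-].
  have := hN k (leq_trans Nn nk); rewrite /u -EFinB lee_fin => h.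
  have ed : del = e * (2 * `|X w| + 1) by rewrite /e divfK// gt_eqF.
  rewrite -(real_normK (num_real (X w))) -(real_normK (num_real (Z k w))) ed.
  by apply: key.
apply: le_trans le1 (le_trans fat _); rewrite limn_einf_lim.
apply: lime_le; first exact: is_cvg_einfs.
apply: filterS Zc => n; apply: le_trans.
by apply: ereal_inf_lbound; exists n => /=.
Qed.

Lemma integrable_sq_of_le (X : Om -> R) (c : R) : measurable_fun setT X ->
  (\int[P]_w ((X w) ^+ 2)%:E <= c%:E)%E ->
  P.-integrable setT (EFin \o (fun w => X w ^+ 2)) /\ \int[P]_w (X w ^+ 2) <= c.
Proof.
move=> mX Xc; have iX : P.-integrable setT (EFin \o (fun w => X w ^+ 2)).
  apply/integrableP; split; first by apply/measurable_EFinP; exact: measurable_funX.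
  apply: le_lt_trans (ltry c); apply: le_trans Xc.
  under eq_integral do rewrite /= ger0_norm ?sqr_ge0//.
  by [].
split => //; rewrite -lee_fin /Rintegral fineK//.
exact: (integrable_fin_num measurableT iX).
Qed.

End square_limits.

Section modulus.
Context {R : realType}.

(** Away from a compact the variation of [g] is paid for by [z ^+ 2]; on the
    compact, uniform continuity leaves only the large increments [r]. *)
Lemma bounded_continuous_modulus (g : R -> R) : continuous g -> bounded_fun g ->
  forall eps, 0 < eps -> exists2 C, 0 <= C &
    forall z r, `|g (z + r) - g z| <= eps * (1 + z ^+ 2) + C * r ^+ 2.
Proof.
move=> cg bg eps e0.
have [M M1 gM] : exists2 M, 1 <= M & forall z, `|g z| <= M.
  have [M [_ hM]] := bg; exists (`|M| + 1); first by rewrite lerDr.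
  by move=> z; apply: hM => //; rewrite ltr_pwDr// ler_norm.
(* Beyond K the term eps * z^2 exceeds twice the bound M of g. *)
pose K := 1 + 2 * M / eps.
have K0 : 0 < K by rewrite ltr_pwDl// divr_ge0 ?ltW// mulr_gt0// (lt_le_trans ltr01).
(* The interval [- K - 1, K + 1] is moved to [0, T], where uniform continuity is
   available. *)
pose T := 2 * (K + 1).
have cb : {within rect T T, continuous (fun z : R * R => g (z.1 - (K + 1)))}.
  apply: continuous_subspaceT => z; apply: continuous_comp; last exact: cg.
  by apply: cvgB; [exact: cvg_fst|exact: cvg_cst].
have [del d0 hd] := heine cb e0.
pose d1 := Num.min del 1.
have d10 : 0 < d1 by rewrite lt_min d0 ltr01.
exists (2 * M / d1 ^+ 2); first by rewrite divr_ge0 ?sqr_ge0// mulr_ge0// (le_trans ler01).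
move=> z r; have M0 : 0 <= M by exact: le_trans M1.
have g2M : `|g (z + r) - g z| <= 2 * M.
  by apply: le_trans (ler_normB _ _) _; rewrite mulr2n mulrDl !mul1r lerD.
have r2 : 0 <= 2 * M / d1 ^+ 2 * r ^+ 2.
  by rewrite mulr_ge0 ?sqr_ge0// divr_ge0 ?sqr_ge0// mulr_ge0.
have z2 : 0 <= z ^+ 2 by exact: sqr_ge0.
have [Kz|zK] := leP K `|z|.
  have K2 : 2 * M <= eps * z ^+ 2.
    have Me : 2 * M / eps <= K by rewrite /K; lra.
    have K1 : 1 <= K by rewrite /K lerDl divr_ge0 ?ltW// mulr_gt0// (lt_le_trans ltr01).
    have : K <= z ^+ 2 by rewrite -(real_normK (num_real z)); nra.
    by move=> /(le_trans Me); rewrite ler_pdivrMr// [_ * eps]mulrC.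
  by apply: le_trans g2M _; nra.
have [rd|dr] := ltP `|r| d1; last first.
  have : 2 * M <= 2 * M / d1 ^+ 2 * r ^+ 2.
    have h1 : d1 ^+ 2 <= r ^+ 2.
      by rewrite -(real_normK (num_real r)) lerXn2r ?nnegrE// ltW.
    rewrite -mulrA [_^-1 * _]mulrC; apply: ler_peMr; first exact: mulr_ge0.
    by rewrite ler_pdivlMr ?exprn_gt0// mul1r.
  by move=> h; apply: le_trans g2M _; nra.
have rdel : `|r| < del by rewrite (lt_le_trans rd)// ge_min lexx.
have r1 : `|r| < 1 by rewrite (lt_le_trans rd)// ge_min lexx orbT.
have T0 : 0 <= T by rewrite /T mulr_ge0// addr_ge0// ltW.
have h : `|g (z + r) - g z| <= eps.
  have := hd (z + r + (K + 1), 0) (z + (K + 1), 0).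
  rewrite /= !addrK subrr normr0 => /(_ _ _ _ d0); apply.
  - apply/rectP; rewrite /= lexx T0; split => //.
    move: zK r1; rewrite !ltr_norml /T => /andP[? ?] /andP[? ?]; apply/andP; split; lra.
  - apply/rectP; rewrite /= lexx T0; split => //.
    move: zK; rewrite !ltr_norml /T => /andP[? ?]; apply/andP; split; lra.
  - by rewrite (_ : _ - _ = r)//; ring.
by apply: le_trans h _; nra.
Qed.

Lemma bounded_comp_integrable d (Om : measurableType d) (P : probability Om R)
    (g : R -> R) (X : Om -> R) : continuous g -> bounded_fun g ->
  measurable_fun setT X -> P.-integrable setT (EFin \o (g \o X)).
Proof.
move=> cg [M [rM gM]] mX; apply: measurable_bounded_integrable => //.
- by apply: (le_lt_trans (probability_le1 P measurableT)); exact: ltry.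
- by apply: measurableT_comp => //; exact: continuous_measurable_fun.
- by exists M; split => // r Mr w _; exact: gM.
Qed.

(** Mean-square closeness of [X] and [Z] makes the expectations of [g] close,
    without any reference to laws; [V] and [c] are the moments of [Z] and [X - Z]. *)
Lemma Rintegral_close d (Om : measurableType d) (P : probability Om R)
    (X Z : Om -> R) (g : R -> R) (eps C V c : R) :
  measurable_fun setT X -> measurable_fun setT Z -> continuous g -> bounded_fun g ->
  0 <= eps -> 0 <= C ->
  (forall z r, `|g (z + r) - g z| <= eps * (1 + z ^+ 2) + C * r ^+ 2) ->
  (\int[P]_w ((Z w) ^+ 2)%:E <= V%:E)%E ->
  (\int[P]_w ((X w - Z w) ^+ 2)%:E <= c%:E)%E ->
  `|\int[P]_w g (X w) - \int[P]_w g (Z w)| <= eps * (1 + V) + C * c.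
Proof.
move=> mX mZ cg bg e0 C0 gH ZV Rc.
have ig (W : Om -> R) : measurable_fun setT W -> P.-integrable setT (EFin \o (fun w => g (W w))).
  exact: bounded_comp_integrable.
have [iZ ZV'] := integrable_sq_of_le mZ ZV.
have [iR Rc'] := integrable_sq_of_le (measurable_funB mX mZ) Rc.
have igB : P.-integrable setT (EFin \o (fun w => g (X w) - g (Z w))).
  exact: (integrableB measurableT (ig _ mX) (ig _ mZ)).
have i1 : P.-integrable setT (EFin \o (cst 1 : Om -> R)) by exact: finite_measure_integrable_cst.
have i1Z' : P.-integrable setT (EFin \o (fun w => 1 + Z w ^+ 2)).
  exact: (integrableD measurableT i1 iZ).
have i1Z : P.-integrable setT (EFin \o (fun w => eps * (1 + Z w ^+ 2))).
  exact: (integrableZl measurableT eps i1Z').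
have iCR : P.-integrable setT (EFin \o (fun w => C * (X w - Z w) ^+ 2)).
  exact: (integrableZl measurableT C iR).
rewrite -RintegralB//; [|exact: ig|exact: ig].
apply: le_trans (le_normr_Rintegral measurableT igB) _.
apply: (@le_trans _ _ (\int[P]_w (eps * (1 + Z w ^+ 2) + C * (X w - Z w) ^+ 2))).
  apply: le_Rintegral => //.
  - exact: integrable_norm igB.
  - exact: (integrableD measurableT i1Z iCR).
  - by move=> w _; have := gH (Z w) (X w - Z w); rewrite [Z w + _]addrC subrK.
rewrite RintegralD// RintegralZl// RintegralZl// RintegralD// Rintegral_probability_cst.
by apply: lerD; apply: ler_wpM2l => //; rewrite lerD2l.
Qed.

End modulus.

(** * Step approximation of the kernel *)

Section wiener_cells.
Context {R : realType}.
Variables (T : R) (T0 : 0 < T) (t x : R).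
Hypotheses (t0 : 0 <= t) (tT : t <= T) (x0 : 0 <= x) (xT : x <= T).
Implicit Types (n : nat) (z : plane R).

(** The cells of the grid with the value of the kernel at their upper corner as
    weight. Those not below [(t, x)] are replaced by a null cell, to stay in
    [rect t x]; their weight would be [0]. *)
Definition wcell n (p : 'I_n.+1 * 'I_n.+1) : @cell R :=
  if (grid T n p.1.+1 <= t)%R && (grid T n p.2.+1 <= x)%R then
    ((riemann_fun (-1) (grid T n p.1.+1) (grid T n p.2.+1) (t, x), (grid T n p.1, grid T n p.1.+1)),
     (grid T n p.2, grid T n p.2.+1))
  else ((0, (0, 0)), (0, 0)).

Definition wcells n : seq (@cell R) :=
  [seq wcell p | p <- index_enum ('I_n.+1 * 'I_n.+1)%type].

Lemma wcells_in n : all (cell_in t x) (wcells n).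
Proof.
apply/allP => _ /mapP[[k l] _ ->]; rewrite /wcell /=; case: ifP => [/andP[kt lx]|_] /=.
  by rewrite kt lx !grid_ge0 ?(ltW T0)//= !grid_homo ?(ltW T0).
by rewrite lexx t0 x0.
Qed.

(** The approximation of the Wiener integral at [(t, x)] is, path by path, the
    step solution: the same increments with the same weights. *)
Lemma step_integral_wcells d (Om : measurableType d) (P : probability Om R)
    (B : R -> R -> {RV P >-> R}) n w :
  step_integral B (wcells n) w = step_sol T (-1) n (fun z => B z.1 z.2 w) (t, x).
Proof.
rewrite /step_integral /wcells big_map /step_sol pair_bigA/=; apply: eq_bigr => p _.
rewrite /wcell; case: ifPn => [kl|kl]; first by rewrite mulrC.
by rewrite mul0r /riemann_fun /= (negbTE kl) mul0r mulr0.
Qed.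

Lemma grid_ceil n s : 0 < s <= T -> exists k : 'I_n.+1,
  grid T n k < s <= grid T n k.+1 /\
  forall j : 'I_n.+1, j != k -> (grid T n j < s <= grid T n j.+1) = false.
Proof.
move=> /andP[s0 sT].
have ex : exists k, (k <= n)%N && (grid T n k < s)%R by exists 0; rewrite grid0.
have ub k : (k <= n)%N && (grid T n k < s)%R -> (k <= n)%N by move=> /andP[].
have [k /andP[kn ks] kmax] := ex_maxnP ex ub.
have sk : s <= grid T n k.+1.
  move: (kn); rewrite leq_eqVlt => /predU1P[->|kn1]; first by rewrite grid_last.
  rewrite leNgt; apply/negP => h.
  by have := kmax k.+1; rewrite kn1 h ltnn => /(_ isT).
have kn1 : (k < n.+1)%N by rewrite ltnS.
exists (Ordinal kn1); split => /=; first by rewrite ks sk.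
move=> j jk; apply/negP => /andP[js sj].
have : (j <= k)%N by apply: kmax; rewrite -ltnS ltn_ord js.
rewrite leq_eqVlt => /orP[/eqP jk1|jk1]; first by move/eqP: jk; apply; apply/val_inj.
have := grid_homo n (ltW T0) jk1; rewrite leNgt => /negP; apply.
exact: lt_le_trans ks sj.
Qed.

Lemma step_fun_wcells n z : 0 < z.1 <= T -> 0 < z.2 <= T -> exists k l : 'I_n.+1,
  [/\ grid T n k < z.1 <= grid T n k.+1, grid T n l < z.2 <= grid T n l.+1 &
      step_fun (wcells n) z = riemann_fun (-1) (grid T n k.+1) (grid T n l.+1) (t, x)].
Proof.
move=> z1 z2; have [k [kz ku]] := grid_ceil n z1; have [l [lz lu]] := grid_ceil n z2.
exists k, l; split => //; rewrite /step_fun /wcells big_map (bigD1 (k, l))//= big1 => [|[i j] /= ij].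
  rewrite addr0 /wcell /=; case: ifPn => [kl|kl].
    by rewrite indicE in_setX !mem_setE !in_itv/= kz lz mulr1.
  by rewrite mul0r /riemann_fun /= (negbTE kl) mul0r.
rewrite /wcell /=; case: ifPn => [_|_]; last by rewrite mul0r.
rewrite indicE in_setX !mem_setE !in_itv/=.
have [ik|ik] := eqVneq i k; last by rewrite ku// mulr0.
have [jl|jl] := eqVneq j l; last by rewrite (lu j jl) andbF mulr0.
by move: ij; rewrite ik jl eqxx.
Qed.

Lemma step_fun_wcells0 n z : z.1 <= 0 \/ z.2 <= 0 -> step_fun (wcells n) z = 0.
Proof.
move=> z0; rewrite /step_fun /wcells big_map big1// => [[i j] _].
rewrite /wcell /=; case: ifPn => [_|_]; last by rewrite mul0r.
rewrite indicE in_setX !mem_setE !in_itv/=.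
have h k (s : R) : s <= 0 -> (grid T n k < s) = false.
  by move=> s0; apply/negbTE; rewrite -leNgt (le_trans s0)// grid_ge0// ltW.
by case: z0 => /h ->; rewrite ?andbF mulr0.
Qed.

Let M : R := fser (`|-1| * (T * T)).

Let M0 : 0 <= M.
Proof. by rewrite /M (le_trans ler01)// fser_ge1// mulr_ge0// mulr_ge0// ltW. Qed.

Let txT : rect T T (t, x).
Proof. by apply/rectP; rewrite /= t0 tT x0 xT. Qed.

Lemma normr_step_fun_wcells n z : rect t x z -> `|step_fun (wcells n) z| <= M.
Proof.
move=> /rectP[/andP[z1 z1t] /andP[z2 z2x]].
have [z10|z10] := leP z.1 0; first by rewrite step_fun_wcells0 ?normr0//; left.
have [z20|z20] := leP z.2 0; first by rewrite step_fun_wcells0 ?normr0//; right.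
have z1T : 0 < z.1 <= T by rewrite z10 (le_trans z1t).
have z2T : 0 < z.2 <= T by rewrite z20 (le_trans z2x).
have [k [l [_ _ ->]]] := step_fun_wcells n z1T z2T.
by apply: normr_riemann_fun_le => //; apply: grid_ge0; exact: ltW.
Qed.

Definition wkernel z : R := fser (- ((t - z.1) * (x - z.2))).

Lemma wkernelE z : rect t x z -> wkernel z = riemann_fun (-1) z.1 z.2 (t, x).
Proof.
by move=> /rectP[/andP[_ z1] /andP[_ z2]]; rewrite /riemann_fun /= z1 z2 mul1r mulN1r.
Qed.

Lemma normr_wkernel z : rect t x z -> `|wkernel z| <= M.
Proof.
move=> tz; rewrite wkernelE//; case/rectP : tz => /andP[z1 _] /andP[z2 _].
exact: normr_riemann_fun_le.
Qed.

Lemma continuous_wkernel : continuous (wkernel : R * R -> R).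
Proof.
move=> z; apply: continuous_comp; last exact: continuous_fser.
by apply: cvgN; apply: cvgM; apply: cvgB; (try exact: cvg_cst); [exact: cvg_fst|exact: cvg_snd].
Qed.

(** In the interior the corners of the cells around [z] eventually are below
    [(t, x)], where the Riemann function is the continuous kernel. *)
Lemma cvg_step_fun_wcells z : 0 < z.1 < t -> 0 < z.2 < x ->
  (fun n => step_fun (wcells n) z) @ \oo --> wkernel z.
Proof.
move=> /andP[z1 z1t] /andP[z2 z2x]; apply/cvgrPdist_le => eps e0.
have := @continuous_wkernel z; move/cvgrPdist_le => /(_ _ e0) /nbhs_ballP[del /= del0 hd].
have z1T : 0 < z.1 <= T by rewrite z1 ltW// (lt_le_trans z1t).
have z2T : 0 < z.2 <= T by rewrite z2 ltW// (lt_le_trans z2x).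
near=> n; have [k [l [/andP[k1 k2] /andP[l1 l2] ->]]] := step_fun_wcells n z1T z2T.
pose m := Num.min del (Num.min (t - z.1) (x - z.2)).
have m0 : 0 < m by rewrite !lt_min del0 !subr_gt0 z1t z2x.
have Tn : T / n.+1%:R < m.
  rewrite ltr_pdivrMr// mulrC -ltr_pdivrMr//.
  rewrite (@lt_le_trans _ _ n%:R)// ?ler_nat//.
  near: n; exact: nbhs_infty_gtr.
move: Tn; rewrite !lt_min => /andP[Tdel /andP[Tt Tx]].
rewrite !gridS in k2 l2 *.
move: (T / n.+1%:R) (grid T n k) (grid T n l) k1 k2 l1 l2 Tdel Tt Tx => h gk gl k1 k2 l1 l2 hdel ht hx.
have kt : gk + h <= t by lra.
have lx : gl + h <= x by lra.
rewrite /riemann_fun /= kt lx mul1r mulN1r; apply: (hd (gk + h, gl + h)).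
by split; rewrite /ball /= distrC ger0_norm ?subr_ge0//; lra.
Unshelve. all: by end_near. Qed.

Lemma measurable_wkernel : measurable_fun (setT : set (plane R)) wkernel.
Proof.
apply: (@measurableT_comp _ _ _ _ _ _ (@fser R)).
  by apply: continuous_measurable_fun; exact: continuous_fser.
apply: measurable_funN; apply: measurable_funM; apply: measurable_funB => //.
Qed.

Lemma ae_rect_interior : {ae leb2 R, forall z, rect t x z -> 0 < z.1 < t /\ 0 < z.2 < x}.
Proof.
have col (a : R) : (leb2 R).-negligible ([set a] `*` setT).
  exists ([set a] `*` setT); split => //.
    by apply: measurableX => //; exact: measurable_set1.
  by rewrite [LHS]leb2X// lebesgue_measure_set1 mul0e.
have row (a : R) : (leb2 R).-negligible (setT `*` [set a]).
  exists (setT `*` [set a]); split => //.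
    by apply: measurableX => //; exact: measurable_set1.
  by rewrite [LHS]leb2X// lebesgue_measure_set1 mule0.
have neg := negligibleU (negligibleU (col 0) (col t)) (negligibleU (row 0) (row x)).
apply: negligibleS neg => z /= /not_implyP[/rectP[/andP[a1 a2] /andP[b1 b2]] nz].
have [z10|z10] := eqVneq z.1 0; first by left; left.
have [z1t|z1t] := eqVneq z.1 t; first by left; right.
have [z20|z20] := eqVneq z.2 0; first by right; left.
have [z2x|z2x] := eqVneq z.2 x; first by right; right.
by exfalso; apply: nz; rewrite !lt_neqAle a1 a2 b1 b2 z1t z2x eq_sym z10 eq_sym z20.
Qed.

(** The squared distance, in the plane, of the kernel to its step
    approximation; the isometry turns it into a distance in mean square. *)
Definition wdist n : R := \int[leb2 R]_(z in rect t x) ((wkernel z - step_fun (wcells n) z) ^+ 2).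

Lemma measurable_step_fun (s : seq (@cell R)) : measurable_fun (setT : set (plane R)) (step_fun s).
Proof.
apply: measurable_sum => [[[c [u1 u2]] [v1 v2]]]; apply: measurable_funM => //.
by apply: measurable_indic; apply: measurableX; exact: measurable_itv.
Qed.

Lemma wdist_integrable n : (leb2 R).-integrable (rect t x)
  (EFin \o (fun z => (wkernel z - step_fun (wcells n) z) ^+ 2)).
Proof.
apply: integrable_rect.
  apply: measurable_funTS; apply: measurable_funX; apply: measurable_funB.
    exact: measurable_wkernel.
  exact: measurable_step_fun.
exists ((2 * M) ^+ 2) => z tz; rewrite normrX lerXn2r ?nnegrE ?mulr_ge0//.
rewrite (le_trans (ler_normB _ _))// mulr_natl mulr2n lerD//; [exact: normr_wkernel|exact: normr_step_fun_wcells].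
Qed.

Lemma wdist_cvg0 :
  (\int[leb2 R]_(z in rect t x) ((wkernel z - step_fun (wcells n) z) ^+ 2)%:E)%E
    @[n --> \oo] --> 0%E.
Proof.
have [] := @dominated_convergence _ _ _ (leb2 R) _ (measurable_rect t x)
  (fun n z => ((wkernel z - step_fun (wcells n) z) ^+ 2)%:E) (cst 0%E)
  (cst (((2 * M) ^+ 2)%:E)).
- move=> n; exact: measurable_int (wdist_integrable n).
- exact: measurable_cst.
- apply: filterS ae_rect_interior => z h /h [z1 z2].
  apply/cvg_EFin; first exact: nearW.
  have := cvg_step_fun_wcells z1 z2 => cv.
  have c1 : (fun n => wkernel z - step_fun (wcells n) z) @ \oo --> wkernel z - wkernel z.
    by apply: cvgB => //; exact: cvg_cst.
  suff h2 : (fun n => (wkernel z - step_fun (wcells n) z) ^+ 2) @ \oo --> (0 : R) by exact: h2.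
  rewrite (_ : (fun n => _) = fun n => (wkernel z - step_fun (wcells n) z) *
    (wkernel z - step_fun (wcells n) z)); last by apply/funext => n; rewrite expr2.
  by have := cvgM c1 c1; rewrite subrr mulr0; exact.
- apply: (@integrable_rect _ t x (cst _)); first exact: measurable_cst.
  by exists `|(2 * M) ^+ 2|.
- apply: aeW => z n tz; rewrite /= lee_fin normrX lerXn2r ?nnegrE ?mulr_ge0//.
  rewrite (le_trans (ler_normB _ _))// mulr_natl mulr2n lerD//; [exact: normr_wkernel|exact: normr_step_fun_wcells].
by move=> _ _; rewrite integral0.
Qed.

End wiener_cells.

(** * The noise of the limit *)

Section opp.
Context {R : realType}.

(** Step functions with cells as summands are subtracted by reversing the weights. *)
Definition cell_opp (k : @cell R) : @cell R :=
  let: ((c, (u1, u2)), (v1, v2)) := k in ((- c, (u1, u2)), (v1, v2)).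

Lemma cell_in_opp t x s : all (cell_in t x) s -> all (cell_in t x) (map cell_opp s).
Proof.
move=> /allP sin; apply/allP => k /mapP[k' /sin].
by case: k' => [[c [u1 u2]] [v1 v2]] h ->.
Qed.

Lemma step_fun_subr s s' z :
  step_fun (s ++ map cell_opp s') z = step_fun s z - step_fun s' z :> R.
Proof.
rewrite /step_fun big_cat big_map/= -sumrN; congr (_ + _).
by apply: eq_bigr => [[[c [u1 u2]] [v1 v2]]] _ /=; rewrite mulNr.
Qed.

Lemma step_integral_subr d (Om : measurableType d) (P : probability Om R)
    (B : R -> R -> {RV P >-> R}) s s' w :
  step_integral B (s ++ map cell_opp s') w = step_integral B s w - step_integral B s' w.
Proof.
rewrite /step_integral big_cat big_map/= -sumrN; congr (_ + _).
by apply: eq_bigr => [[[c [u1 u2]] [v1 v2]]] _ /=; rewrite mulNr.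
Qed.

End opp.

Section wiener.
Context {d : measure_display} {Om : measurableType d} {R : realType}.
Variables (P : probability Om R) (T : R) (B : R -> R -> {RV P >-> R}).
Hypotheses (T0 : 0 < T) (hB : brownian_sheet T B).

Lemma measurable_step_integral s : measurable_fun setT (step_integral B s).
Proof.
have -> : step_integral B s = fun w => \sum_(k <- all_corners s) k.1 * B k.2.1 k.2.2 w.
  by apply/funext => w; rewrite step_integral_corners.
by apply: measurable_sum => k; apply: measurable_funM => //; exact: measurable_funPT.
Qed.

Definition sheet_path (w : Om) (z : plane R) : R := B z.1 z.2 w.

(** On the axes the sheet has variance [0]. *)
Lemma ae_sheet_path : {ae P, forall w, {within rect T T, continuous (sheet_path w : R * R -> R)} /\
  axes0 T (sheet_path w)}.
Proof.
have [_ _ _ cB] := hB; apply: filterI; first exact: cB.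
have zero (p : R * R) : rect T T p -> Num.min p.1 p.1 * Num.min p.2 p.2 = 0 ->
    {ae P, forall w, B p.1 p.2 w = 0}.
  move=> Tp p0; have := sheet_covariance hB Tp Tp; rewrite p0 => e.
  have i2 := sheet_integrableM hB Tp Tp.
  have m2 : measurable_fun setT (fun w => (B p.1 p.2 w * B p.1 p.2 w)%:E).
    by have /integrableP[] := i2.
  have e0 : (\int[P]_w `|(B p.1 p.2 w * B p.1 p.2 w)%:E| = 0)%E.
    rewrite -[RHS]/(0%:E) -e /Rintegral fineK; last exact: integrable_fin_num.
    by apply: eq_integral => w _; rewrite gee0_abs// lee_fin -expr2 sqr_ge0.
  have := (ae_eq_integral_abs P measurableT m2).1 e0.
  apply: filterS => w /(_ I) [] /eqP; by rewrite mulf_eq0 orbb => /eqP.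
have T1 := ltW T0.
have ae1 n k : {ae P, forall w, (k <= n.+1)%N -> sheet_path w (grid T n k, 0) = 0 /\ sheet_path w (0, grid T n k) = 0}.
  have [kn|kn] := leqP k n.+1; last by apply: aeW.
  have g0 := grid_ge0 n k T1; have gT := grid_le T1 kn.
  have r1 : rect T T (grid T n k, 0) by apply/rectP; rewrite /= g0 gT lexx T1.
  have r2 : rect T T (0, grid T n k) by apply/rectP; rewrite /= g0 gT lexx T1.
  have z1 := zero _ r1; have z2 := zero _ r2; move: z1 z2; rewrite /= !minxx mulr0 mul0r.
  by move=> /(_ erefl) z1 /(_ erefl) z2; apply: filterS2 z1 z2 => w w1 w2 _.
apply: filterS (ae_foralln (fun n => ae_foralln (ae1 n))) => w h n k; exact: h.
Qed.

(** The solution of [G = B - int int G], as the pathwise limit of step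
    solutions; the upper limit makes it measurable on the whole space. *)
Definition noise_field t x w : R :=
  fine (limn_esup (fun n => (step_sol T (-1) n (sheet_path w) (t, x))%:E)).

Lemma measurable_step_sol_path lam n z : measurable_fun setT (fun w => step_sol T lam n (sheet_path w) z).
Proof.
apply: measurable_sum => k; apply: measurable_sum => l; apply: measurable_funM => //.
rewrite /rect_incr /sheet_path /=; apply: measurable_funD; last exact: measurable_funPT.
by apply: measurable_funB; [apply: measurable_funB|]; exact: measurable_funPT.
Qed.

Lemma measurable_noise_field t x : measurable_fun setT (noise_field t x).
Proof.
apply: (@measurableT_comp _ _ _ _ _ _ (@fine R)); first exact: fine_measurable.
by apply: measurable_fun_limn_esup => n; apply/measurable_EFinP; exact: measurable_step_sol_path.
Qed.

Lemma ae_noise_field : {ae P, forall w,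
  [/\ {within rect T T, continuous ((fun z => noise_field z.1 z.2 w) : R * R -> R)},
      bmeas T (fun z => noise_field z.1 z.2 w),
      forall z, rect T T z -> (fun n => step_sol T (-1) n (sheet_path w) z) @ \oo --> noise_field z.1 z.2 w &
      forall z, rect T T z -> noise_field z.1 z.2 w +
        \int[leb2 R]_(q in rect z.1 z.2) noise_field q.1 q.2 w = sheet_path w z]}.
Proof.
apply: filterS ae_sheet_path => w [cw w0].
have [h [bh hlim heq hc]] := volterra_limit (-1) T0 cw w0.
have gh z : rect T T z -> noise_field z.1 z.2 w = h z.
  move=> Tz; rewrite /noise_field -surjective_pairing.
  have cv : (fun n => (step_sol T (-1) n (sheet_path w) z)%:E) @ \oo --> (h z)%:E.
    by apply/cvg_EFin; [exact: nearW|exact: hlim].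
  by have [_ ->] := cvg_limn_einf_sup cv.
split.
- apply: subspace_eq_continuous hc => z /set_mem Tz; exact/esym/gh.
- have [mh [M hM]] := bh; split; last by exists M => z Tz; rewrite gh// hM.
  by apply: eq_measurable_fun mh => z /set_mem Tz; exact/esym/gh.
- by move=> z Tz; rewrite gh//; exact: hlim.
move=> z Tz; rewrite gh// -heq// mulN1r opprK; congr (_ + _).
have /rectP[/andP[_ z1] /andP[_ z2]] := Tz.
by apply: eq_Rintegral => q /set_mem/(rect_sub z1 z2); exact: gh.
Qed.

Section point.
Variables (t x : R).
Hypotheses (t0 : 0 <= t) (tT : t <= T) (x0 : 0 <= x) (xT : x <= T).

Let S n w := step_integral B (wcells T t x n) w.
Let sin := wcells_in T0 t0 x0.

Lemma step_diff_sq (s s' : seq (@cell R)) : all (cell_in t x) s -> all (cell_in t x) s' ->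
  P.-integrable setT (EFin \o (fun w => (step_integral B s w - step_integral B s' w) ^+ 2)) /\
  (\int[P]_w ((step_integral B s w - step_integral B s' w) ^+ 2)%:E =
   \int[leb2 R]_(z in rect t x) ((step_fun s z - step_fun s' z) ^+ 2)%:E)%E.
Proof.
move=> sn sn'; have ss : all (cell_in t x) (s ++ map cell_opp s').
  by rewrite all_cat sn; exact: cell_in_opp.
have i1 := step_integral_sq_integrable hB tT xT ss.
have i2 := step_fun_sq_integrable ss.
have := step_isometry hB tT xT ss; rewrite /Rintegral => iso.
have e1 : (fun w => (step_integral B s w - step_integral B s' w) ^+ 2) =
    (fun w => step_integral B (s ++ map cell_opp s') w ^+ 2).
  by apply/funext => w; rewrite step_integral_subr.
split; first by rewrite e1.
transitivity (\int[P]_w (step_integral B (s ++ map cell_opp s') w ^+ 2)%:E)%E.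
  by apply: eq_integral => w _; rewrite step_integral_subr.
rewrite -[LHS]fineK; last exact: (integrable_fin_num measurableT i1).
rewrite iso fineK; last exact: (integrable_fin_num (measurable_rect t x) i2).
by apply: eq_integral => z _; rewrite step_fun_subr.
Qed.

Lemma wcells_cauchy n m :
  (\int[P]_w ((S m w - S n w) ^+ 2)%:E <= (2 * wdist T t x n + 2 * wdist T t x m)%:E)%E.
Proof.
rewrite (step_diff_sq (sin m) (sin n)).2.
have i1 := wdist_integrable T0 t0 tT x0 xT n; have i2 := wdist_integrable T0 t0 tT x0 xT m.
have i12 := integrableD (measurable_rect t x) (integrableZl (measurable_rect t x) 2 i1)
  (integrableZl (measurable_rect t x) 2 i2).
have -> : ((2 * wdist T t x n + 2 * wdist T t x m)%:E =
  \int[leb2 R]_(z in rect t x) (2 * (wkernel t x z - step_fun (wcells T t x n) z) ^+ 2 +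
    2 * (wkernel t x z - step_fun (wcells T t x m) z) ^+ 2)%:E)%E.
  rewrite /wdist -RintegralZl//; last exact: measurable_rect.
  rewrite -RintegralZl//; last exact: measurable_rect.
  rewrite -RintegralD; [|exact: measurable_rect|exact: (integrableZl (measurable_rect t x) 2 i1)|
    exact: (integrableZl (measurable_rect t x) 2 i2)].
  by rewrite /Rintegral fineK//; exact: (integrable_fin_num (measurable_rect t x) i12).
apply: ge0_le_integral; [exact: measurable_rect| | | |].
- by move=> z _; rewrite lee_fin sqr_ge0.
- apply/measurable_EFinP/measurable_funTS; apply: measurable_funX.
  by apply: measurable_funB; exact: measurable_step_fun.
- apply/measurable_EFinP/measurable_funTS; apply: measurable_funD; apply: measurable_funM => //;
    apply: measurable_funX; apply: measurable_funB; (try exact: measurable_wkernel);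
    exact: measurable_step_fun.
- move=> z _; rewrite lee_fin.
  move: (wkernel t x z) (step_fun _ z) (step_fun _ z) => a b c.
  have := sqr_ge0 ((a - b) + (a - c)); nra.
Qed.

Lemma wdist_ge0 n : 0 <= wdist T t x n.
Proof. by apply: Rintegral_ge0 => z _; exact: sqr_ge0. Qed.

Lemma wdist_small eps : 0 < eps -> \forall n \near \oo, wdist T t x n <= eps.
Proof.
move=> e0; have := wdist_cvg0 T0 t0 tT x0 xT.
have -> : (fun n => \int[leb2 R]_(z in rect t x) ((wkernel t x z - step_fun (wcells T t x n) z) ^+ 2)%:E)%E
   = EFin \o wdist T t x.
  apply/funext => n; rewrite /wdist /Rintegral /= fineK//.
  exact: (integrable_fin_num (measurable_rect t x) (wdist_integrable T0 t0 tT x0 xT n)).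
move=> /fine_cvg /cvgrPdist_le /(_ _ e0); apply: filterS => n.
by rewrite sub0r normrN /= ger0_norm// wdist_ge0.
Qed.

(** The pathwise limit is also the limit in mean square, by Fatou's lemma. *)
Lemma noise_field_step_sq n :
  (\int[P]_w ((noise_field t x w - S n w) ^+ 2)%:E <= (2 * wdist T t x n)%:E)%E.
Proof.
have txT : rect T T (t, x) by apply/rectP; rewrite /= t0 tT x0 xT.
apply/lee_addgt0Pr => del del0; rewrite -EFinD.
apply: (@fatou_sq _ _ _ _ _ (fun m w => S m w - S n w)).
- by apply: measurable_funB; [exact: measurable_noise_field|exact: measurable_step_integral].
- by move=> m; apply: measurable_funB; exact: measurable_step_integral.
- apply: filterS ae_noise_field => w [_ _ cv _] eps e0.
  have := cv _ txT; move/cvgrPdist_le => /(_ _ e0); apply: filterS => m.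
  rewrite -(step_integral_wcells T t x B m w) -/(S m w) /= => h.
  have -> : noise_field t x w - S n w = (S m w - S n w) + (noise_field t x w - S m w) by ring.
  by apply: le_trans (ler_normD _ _) _; rewrite lerD2l.
have d2 : 0 < del / 2 by rewrite divr_gt0.
have := wdist_small d2; apply: filterS => m mdel.
apply: le_trans (wcells_cauchy n m) _; rewrite lee_fin lerD2l; lra.
Qed.

End point.

End wiener.

(** * The Wiener integral and the mean-field equation *)

Section sq_triangle.
Context d (U : measurableType d) (R : realType) (mu : {measure set U -> \bar R}).
Variables (D : set U) (mD : measurable D).

(** [(f - h)^2 <= 2 (g - f)^2 + 2 (g - h)^2]. *)
Lemma sq_triangle_le (f g h : U -> R) (a b : R) :
  measurable_fun D f -> measurable_fun D g -> measurable_fun D h ->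
  (\int[mu]_(w in D) ((g w - f w) ^+ 2)%:E <= a%:E)%E ->
  (\int[mu]_(w in D) ((g w - h w) ^+ 2)%:E <= b%:E)%E ->
  (\int[mu]_(w in D) ((f w - h w) ^+ 2)%:E <= (2 * a + 2 * b)%:E)%E.
Proof.
move=> mf mg mh fa hb.
have m2 (p q : U -> R) : measurable_fun D p -> measurable_fun D q ->
    measurable_fun D (fun w => (2 * (p w - q w) ^+ 2)%:E).
  move=> mp mq; apply/measurable_EFinP; apply: measurable_funM => //.
  by apply: measurable_funX; exact: measurable_funB.
have e2 (p q : U -> R) (c : R) : measurable_fun D p -> measurable_fun D q ->
    (\int[mu]_(w in D) ((p w - q w) ^+ 2)%:E <= c%:E)%E ->
    (\int[mu]_(w in D) (2 * (p w - q w) ^+ 2)%:E <= (2 * c)%:E)%E.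
  move=> mp mq le; under eq_integral do rewrite EFinM.
  rewrite ge0_integralZl//; last 2 first.
  - by apply/measurable_EFinP; apply: measurable_funX; exact: measurable_funB.
  - by move=> w _; rewrite lee_fin sqr_ge0.
  by rewrite EFinM; apply: lee_wpmul2l.
apply: (@le_trans _ _ (\int[mu]_(w in D) ((2 * (g w - f w) ^+ 2)%:E + (2 * (g w - h w) ^+ 2)%:E))%E).
  apply: ge0_le_integral => //.
  - by move=> w _; rewrite lee_fin sqr_ge0.
  - by apply/measurable_EFinP; apply: measurable_funX; exact: measurable_funB.
  - by apply: emeasurable_funD; exact: m2.
  - move=> w _; rewrite -EFinD lee_fin.
    have := sqr_ge0 ((g w - f w) + (g w - h w)); nra.
rewrite ge0_integralD//; [|by move=> w _; rewrite lee_fin mulr_ge0 ?sqr_ge0//|exact: m2|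
  by move=> w _; rewrite lee_fin mulr_ge0 ?sqr_ge0//|exact: m2].
by rewrite EFinD; apply: leeD; exact: e2.
Qed.

Lemma sq_sym (f g : U -> R) :
  (\int[mu]_(w in D) ((f w - g w) ^+ 2)%:E = \int[mu]_(w in D) ((g w - f w) ^+ 2)%:E)%E.
Proof. by apply: eq_integral => w _; rewrite -sqrrN opprB. Qed.

End sq_triangle.

Lemma ecvg0_le (R : realType) (u : nat -> \bar R) (e : R) : 0 < e ->
  u @ \oo --> 0%E -> \forall n \near \oo, (u n <= e%:E)%E.
Proof.
move=> e0 u0; suff : \forall n \near \oo, (u n < e%:E)%E by apply: filterS => n /ltW.
by apply: (u0 [set r | (r < e%:E)%E]); apply: open_ereal_lt'; rewrite lte_fin.
Qed.

Section wiener.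
Context {d : measure_display} {Om : measurableType d} {R : realType}.
Variables (P : probability Om R) (T : R) (B : R -> R -> {RV P >-> R}).
Hypotheses (T0 : 0 < T) (hB : brownian_sheet T B).

HB.instance Definition _ (t x : R) :=
  isMeasurableFun.Build _ _ Om R (noise_field T B t x) (measurable_noise_field T B t x).

Section point.
Variables (t x : R).
Hypotheses (t0 : 0 <= t) (tT : t <= T) (x0 : 0 <= x) (xT : x <= T).

Lemma noise_field_is_wiener : is_wiener_integral B t x (wkernel t x) (noise_field T B t x : {RV P >-> R}).
Proof.
exists (wcells T t x); split; first exact: wcells_in.
- exact: wdist_cvg0.
have l0 : (fun n => (2 * wdist T t x n)%:E) @ \oo --> 0%E.
  rewrite -[0%E]/(0%:E) -(mulr0 2); apply/cvg_EFin; first exact: nearW.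
  apply: cvgM; first exact: cvg_cst.
  apply/cvgrPdist_le => e e0; have := wdist_small T0 t0 tT x0 xT e0.
  by apply: filterS => n; rewrite sub0r normrN ger0_norm// wdist_ge0.
apply: squeeze_cvge (cvg_cst 0%E) l0; apply: nearW => n; rewrite unlock.
apply/andP; split; last exact: noise_field_step_sq.
by apply: integral_ge0 => w _; rewrite lee_fin sqr_ge0.
Qed.

(** Two approximating sequences approximate each other in the plane, hence, by
    the isometry, in mean square. *)
Lemma wiener_unique (I1 I2 : {RV P >-> R}) :
  is_wiener_integral B t x (wkernel t x) I1 -> is_wiener_integral B t x (wkernel t x) I2 ->
  {ae P, forall w, I1 w = I2 w}.
Proof.
move=> [s1 [s1in s1g s1I]] [s2 [s2in s2g s2I]].
have mI (I : {RV P >-> R}) : measurable_fun setT I by exact: measurable_funPT.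
have mS s : measurable_fun setT (step_integral B s) by exact: measurable_step_integral.
have mk : measurable_fun (rect t x : set (plane R)) (wkernel t x).
  by apply: measurable_funTS; exact: measurable_wkernel.
have ms s : measurable_fun (rect t x : set (plane R)) (step_fun s : plane R -> R).
  by apply: measurable_funTS; exact: measurable_step_fun.
(* 22 = 2 + 2 * (2 * 4 + 2): three uses of the triangle inequality. *)
have small e : 0 < e -> (\int[P]_w ((I1 w - I2 w) ^+ 2)%:E <= (22 * e)%:E)%E.
  move=> e0; rewrite unlock in s1I; rewrite unlock in s2I.
  have [n _ /(_ n (leqnn n)) [[h1 h2] [h3 h4]]] := filterI
    (filterI (ecvg0_le e0 s1g) (ecvg0_le e0 s1I)) (filterI (ecvg0_le e0 s2g) (ecvg0_le e0 s2I)).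
  have SS := sq_triangle_le (measurable_rect t x) (ms (s1 n)) mk (ms (s2 n)) h1 h3.
  rewrite -(step_diff_sq hB tT xT (s1in n) (s2in n)).2 sq_sym in SS.
  rewrite sq_sym in h2; rewrite sq_sym in h4; rewrite sq_sym in SS.
  have h5 := sq_triangle_le measurableT (mS (s1 n)) (mS (s2 n)) (mI I2).
  rewrite sq_sym in SS; have {}h5 := h5 P _ _ SS h4.
  have h6 := sq_triangle_le measurableT (mI I1) (mS (s1 n)) (mI I2) h2 h5.
  apply: le_trans h6 _; rewrite lee_fin; lra.
have e0 : (\int[P]_w ((I1 w - I2 w) ^+ 2)%:E = 0)%E.
  apply/eqP; rewrite eq_le; apply/andP; split; last first.
    by apply: integral_ge0 => w _; rewrite lee_fin sqr_ge0.
  apply/lee_addgt0Pr => e e0; rewrite add0e.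
  apply: le_trans (small (e / 22) _) _; first by rewrite divr_gt0.
  by rewrite lee_fin mulrC divfK.
have m2 : measurable_fun setT (fun w => ((I1 w - I2 w) ^+ 2)%:E).
  by apply/measurable_EFinP; apply: measurable_funX; exact: measurable_funB.
have e1 : (\int[P]_w `|((I1 w - I2 w) ^+ 2)%:E| = 0)%E.
  by rewrite -e0; apply: eq_integral => w _; rewrite gee0_abs// lee_fin sqr_ge0.
have := (ae_eq_integral_abs P measurableT m2).1 e1.
by apply: filterS => w /(_ I) [] /eqP; rewrite sqrf_eq0 subr_eq0 => /eqP.
Qed.

Lemma noise_field_integrable : P.-integrable setT (EFin \o noise_field T B t x).
Proof.
have mG := measurable_noise_field T B t x.
have [n _ _] := wdist_small T0 t0 tT x0 xT ltr01.
have := noise_field_step_sq T0 hB t0 tT x0 xT n => GS.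
have mS := measurable_step_integral B (wcells T t x n).
have [i2 _] := integrable_sq_of_le (measurable_funB mG mS) GS.
have iS := step_integral_integrable hB tT xT (wcells_in T0 t0 x0 n).
have i1 : P.-integrable setT (EFin \o (cst 1 : Om -> R)) by exact: finite_measure_integrable_cst.
have iD : P.-integrable setT (EFin \o (fun w => noise_field T B t x w - step_integral B (wcells T t x n) w)).
  apply: le_integrable (integrableD measurableT i1 i2) => //.
    by apply/measurable_EFinP; exact: measurable_funB.
  move=> w _ /=; rewrite !lee_fin [leRHS]ger0_norm ?addr_ge0 ?sqr_ge0//.
  move: (_ - _) => r; rewrite ler_norml.
  have := sqr_ge0 (r + 1); have := sqr_ge0 (r - 1); nra.
have := integrableD measurableT iD iS; congr (is_true (_.-integrable _ _)).
by apply/funext => w /=; rewrite -EFinD subrK.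
Qed.

(** The step integrals are centred and converge in mean square, hence in mean;
    [|r| <= e / 2 + r ^ 2 / (2 e)] replaces the Cauchy-Schwarz inequality. *)
Lemma noise_field_mean : \int[P]_w noise_field T B t x w = 0.
Proof.
have mG := measurable_noise_field T B t x.
apply/eqP; rewrite -normr_le0; apply/ler_addgt0Pl => e e0; rewrite addr0.
have e2 : 0 < e ^+ 2 / 2 by rewrite divr_gt0// exprn_gt0.
have [n _ /(_ n (leqnn n)) we] := wdist_small T0 t0 tT x0 xT e2.
have := noise_field_step_sq T0 hB t0 tT x0 xT n => GS.
have mS := measurable_step_integral B (wcells T t x n).
have [i2 v2] := integrable_sq_of_le (measurable_funB mG mS) GS.
have iS := step_integral_integrable hB tT xT (wcells_in T0 t0 x0 n).
have i1 : P.-integrable setT (EFin \o (cst (e / 2) : Om -> R)) by exact: finite_measure_integrable_cst.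
have i3 := integrableZl measurableT (2 * e)^-1 i2.
have iG := noise_field_integrable.
have -> : \int[P]_w noise_field T B t x w = \int[P]_w (noise_field T B t x w - step_integral B (wcells T t x n) w).
  by rewrite RintegralB// (step_integral_mean hB tT xT (wcells_in T0 t0 x0 n)) subr0.
have iD := integrableB measurableT iG iS.
apply: le_trans (le_normr_Rintegral measurableT iD) _.
apply: (@le_trans _ _ (\int[P]_w (e / 2 + (2 * e)^-1 * (noise_field T B t x w - step_integral B (wcells T t x n) w) ^+ 2))).
  apply: le_Rintegral => //; [exact: integrable_norm iD|exact: (integrableD measurableT i1 i3)|].
  move=> w _; move: (_ - _) => r.
  have E : e / 2 + (2 * e)^-1 * r ^+ 2 - `|r| = (2 * e)^-1 * (e - `|r|) ^+ 2.
    by rewrite -(real_normK (num_real r)); field; exact: lt0r_neq0.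
  by rewrite -subr_ge0 E mulr_ge0 ?sqr_ge0// invr_ge0 mulr_ge0// ltW.
rewrite RintegralD// Rintegral_probability_cst RintegralZl//.
have e2' : 0 < 2 * e by rewrite mulr_gt0.
have : (2 * e)^-1 * \int[P]_w ((noise_field T B t x w - step_integral B (wcells T t x n) w) ^+ 2) <= (2 * e)^-1 * e ^+ 2.
  by apply: ler_wpM2l; [rewrite invr_ge0 ltW|apply: le_trans v2 _; lra].
have -> : (2 * e)^-1 * e ^+ 2 = e / 2 by field; exact: lt0r_neq0.
by rewrite [X in _ -> _ <= X]splitr lerD2l.
Qed.

End point.

Section mean_field.
Variables (y a : R).

(** The mean of the limit, [y f((a - 1) t x)]. *)
Definition drift (z : plane R) : R := y * riemann_fun (a - 1) 0 0 z.

Definition mean_field (t x : R) (w : Om) : R := drift (t, x) + noise_field T B t x w.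

Lemma measurable_mean_field t x : measurable_fun setT (mean_field t x).
Proof. by apply: measurable_funD => //; exact: measurable_noise_field. Qed.

HB.instance Definition _ (t x : R) :=
  isMeasurableFun.Build _ _ Om R (mean_field t x) (measurable_mean_field t x).

Lemma mean_field_limit t x : 0 <= t <= T -> 0 <= x <= T ->
  {ae P, forall w, mean_field t x w = limit_field y a B t x w}.
Proof.
move=> /andP[t0 tT] /andP[x0 xT].
have hI : is_wiener_integral B t x (wkernel t x) (wiener_integral B t x (wkernel t x)).
  by apply: xgetPex; exists (noise_field T B t x : {RV P >-> R}); exact: noise_field_is_wiener.
have := wiener_unique tT xT (noise_field_is_wiener t0 tT x0 xT) hI.
apply: filterS => w e.
rewrite /mean_field /limit_field -/(wkernel t x) -e; congr (_ + _).
by rewrite /drift /riemann_fun /= t0 x0 mul1r !subr0 [RHS]mulrC [_ * (a - 1)]mulrC.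
Qed.

Lemma mean_field_integrable t x : 0 <= t <= T -> 0 <= x <= T ->
  P.-integrable setT (EFin \o mean_field t x).
Proof.
move=> /andP[t0 tT] /andP[x0 xT].
have i1 : P.-integrable setT (EFin \o (cst (drift (t, x)) : Om -> R)) by exact: finite_measure_integrable_cst.
exact: (integrableD measurableT i1 (noise_field_integrable t0 tT x0 xT)).
Qed.

Lemma mean_field_mean t x : 0 <= t <= T -> 0 <= x <= T ->
  fine ('E_P[mean_field t x])%E = drift (t, x).
Proof.
move=> /andP[t0 tT] /andP[x0 xT]; rewrite unlock -/(Rintegral P setT (mean_field t x)).
rewrite RintegralD//; [|exact: finite_measure_integrable_cst|exact: noise_field_integrable].
by rewrite Rintegral_probability_cst noise_field_mean// addr0.
Qed.

(** With [e] for the drift and [G] for the noise, [e = y + (a - 1) int int e] and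
    [G = B - int int G] add up to the equation, because [e] is the mean of [e + G]. *)
Lemma mean_field_solves : mean_field_solution T y a B mean_field.
Proof.
split; first exact: mean_field_integrable.
have T1 := ltW T0.
have bd : bmeas T drift by apply: bmeasZ; exact: bmeas_riemann_fun.
apply: filterS (ae_noise_field T0 hB) => w [cG bG _ eqG].
have cd : {within rect T T, continuous (drift : R * R -> R)}.
  have cf : continuous (fun z : R * R => y * fser ((a - 1) * (z.1 * z.2))).
    move=> z; apply: cvgM; first exact: cvg_cst.
    apply: continuous_comp; last exact: continuous_fser.
    by apply: cvgM; [exact: cvg_cst|apply: cvgM; [exact: cvg_fst|exact: cvg_snd]].
  apply: subspace_eq_continuous (continuous_subspaceT cf) => z /set_mem Tz.
  by rewrite /from_subspace /drift (riemann_fun_origin _ Tz).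
split.
  apply/subspace_continuousP => p Tp.
  apply: cvgD; first by have /subspace_continuousP := cd; exact.
  by have /subspace_continuousP := cG; exact.
move=> t x /[dup] t01 /andP[t0 tT] /[dup] x01 /andP[x0 xT].
have txT : rect T T (t, x) by apply/rectP.
pose b (z : plane R) := (a - 1) * drift z - noise_field T B z.1 z.2 w.
have bb : bmeas T b by apply: bmeasB => //; exact: bmeasZ.
have bE z : rect t x z -> a * fine ('E_P[mean_field z.1 z.2])%E - mean_field z.1 z.2 w = b z.
  move=> /(rect_sub tT xT)/rectP[z1 z2]; rewrite mean_field_mean// /mean_field /b -surjective_pairing.
  by ring.
split.
  apply: (eq_integrable (measurable_rect t x) _ _ _ (bmeas_integrable tT xT bb)) => z /set_mem tz.
  by rewrite /= bE.
have -> : \int[leb2 R]_(z in rect t x) (a * fine ('E_P[mean_field z.1 z.2])%E - mean_field z.1 z.2 w) =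
    \int[leb2 R]_(z in rect t x) b z.
  by apply: eq_Rintegral => z /set_mem; exact: bE.
rewrite RintegralB; [|exact: measurable_rect| |]; last 2 first.
- by apply: (bmeas_integrable tT xT); exact: bmeasZ.
- exact: (bmeas_integrable tT xT).
rewrite RintegralZl; [|exact: measurable_rect|exact: (bmeas_integrable tT xT)].
rewrite RintegralZl; [|exact: measurable_rect|apply: (bmeas_integrable tT xT); exact: bmeas_riemann_fun].
rewrite mulrCA riemann_fun_resolvent// t0 x0 -[B t x w]/(sheet_path B w (t, x)) -eqG//.
pose J := \int[leb2 R]_(q in rect t x) noise_field T B q.1 q.2 w; pose g := noise_field T B t x w.
change (y * riemann_fun (a - 1) 0 0 (t, x) + g = y + (y * (riemann_fun (a - 1) 0 0 (t, x) - 1) - J) + (g + J)).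
by ring.
Qed.

End mean_field.

End wiener.

(** * The particle system in mean square *)

Lemma sqr_sum_le (R : realType) (I : Type) (s : seq I) (u : I -> R) :
  (\sum_(i <- s) u i) ^+ 2 <= (size s)%:R * \sum_(i <- s) u i ^+ 2.
Proof.
elim: s => [|i s ih]; first by rewrite !big_nil expr0n mulr0.
rewrite !big_cons /= -nat1r; move: ih.
set S := \sum_(j <- s) u j; set Q := \sum_(j <- s) u j ^+ 2.
have Q0 : 0 <= Q by apply: sumr_ge0 => j _; exact: sqr_ge0.
case: (size s) => [|n] ih.
  have S0 : S = 0 by apply/eqP; rewrite -sqrf_eq0 eq_le sqr_ge0 andbT (le_trans ih)// mul0r.
  by rewrite S0 addr0 addr0 mul1r lerDl.
have n0 : 0 < n.+1%:R :> R by rewrite ltr0n.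
move: (n.+1%:R) n0 ih => r r0 ih.
have h : 0 <= r * ((1 + r) * (u i ^+ 2 + Q) - (u i + S) ^+ 2).
  have := sqr_ge0 (r * u i - S).
  have := mulr_ge0 (ltW r0) (eqbRL (subr_ge0 _ _) ih); nra.
by rewrite -subr_ge0 -(pmulr_rge0 _ r0).
Qed.

(** On the axes the equation of a particle reduces to [Y = y + B]. *)
Lemma Rintegral_null_rect (R : realType) (t x : R) (h : plane R -> R) :
  0 <= t -> 0 <= x -> t * x = 0 ->
  (leb2 R).-integrable (rect t x) (fun z => (h z)%:E) -> \int[leb2 R]_(z in rect t x) h z = 0.
Proof.
move=> t0 x0 tx ih; rewrite /Rintegral null_set_integral//; first exact: measurable_rect.
- exact: measurable_int ih.
- by rewrite leb2_rect// tx.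
Qed.

Section particles.
Context d (Om : measurableType d) (R : realType) (P : probability Om R).
Variables (T y a A : R) (aj : nat -> R) (N i : nat) (B Y : nat -> R -> R -> {RV P >-> R}).
Hypotheses (T0 : 0 < T) (ajA : forall j, (1 <= j)%N -> `|aj j| <= A) (iN : (1 <= i <= N)%N).
Hypotheses (hB : brownian_sheet_vector T N B) (hY : particle_system_solution T y aj N B Y).

Definition averaged_sheet (w : Om) (q : plane R) : R :=
  N%:R^-1 * \sum_(1 <= j < N.+1) aj j * B j q.1 q.2 w.

Let delta := `|N%:R^-1 * (\sum_(1 <= j < N.+1) aj j) - a|.

Let N1 : (1 <= N)%N. Proof. by case/andP : iN => /leq_trans; exact. Qed.

(** The pathwise estimate needs, for all indices, bounded measurable paths of the
    particles, and continuous paths of the sheets that vanish on the axes. Off the indices [1], ..., [N] the sheets and the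
    particles are unconstrained, and are replaced by [0]. *)
Lemma ae_particle_estimate : {ae P, forall w z eps, rect T T z -> 0 < eps ->
  \forall n \near \oo,
    `|Y i z.1 z.2 w - y * riemann_fun (a - 1) 0 0 z - step_sol T (-1) n (sheet_path (B i) w) z| <=
    particle_rate T y a A * (delta + riemann_sum T n (averaged_sheet w)) + eps}.
Proof.
have T1 := ltW T0.
have aeB : {ae P, forall w j, (1 <= j <= N)%N ->
    {within rect T T, continuous (sheet_path (B j) w : R * R -> R)} /\ axes0 T (sheet_path (B j) w)}.
  apply: ae_foralln => j; have [jN|jN] := boolP (1 <= j <= N)%N; last by apply: aeW.
  by apply: filterS (ae_sheet_path T0 (hB.1 j jN)) => w hw _.
have aeY : {ae P, forall w j, (1 <= j <= N)%N -> continuous_path T (Y j) w /\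
    forall t x : R, 0 <= t <= T -> 0 <= x <= T ->
      (leb2 R).-integrable (rect t x) (fun z : R * R =>
        (N%:R^-1 * (\sum_(1 <= k < N.+1) aj k * Y k z.1 z.2 w) - Y j z.1 z.2 w)%:E) /\
      Y j t x w = y + \int[leb2 R]_(z in rect t x)
        (N%:R^-1 * (\sum_(1 <= k < N.+1) aj k * Y k z.1 z.2 w) - Y j z.1 z.2 w) + B j t x w}.
  apply: ae_foralln => j; have [jN|jN] := boolP (1 <= j <= N)%N; last by apply: aeW.
  by apply: filterS (hY jN) => w hw _.
apply: filterS2 aeB aeY => w hBw hYw.
pose b' j : plane R -> R := if (1 <= j <= N)%N then sheet_path (B j) w else fun=> 0.
pose Y' j : plane R -> R := if (1 <= j <= N)%N then fun z => Y j z.1 z.2 w else fun=> 0.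
have cst_cont : {within rect T T, continuous ((fun=> 0) : R * R -> R)}.
  by apply: continuous_subspaceT => z; exact: cvg_cst.
have cb j : {within rect T T, continuous (b' j : R * R -> R)}.
  by rewrite /b'; case: ifPn => [jN|_] //; exact: (hBw j jN).1.
have b0 j : axes0 T (b' j).
  by rewrite /b'; case: ifPn => [jN|_] //; exact: (hBw j jN).2.
have bY j : bmeas T (Y' j).
  rewrite /Y'; case: ifPn => [jN|_]; last exact: bmeas_cst.
  have [cY eqY] := hYw j jN.
  have -> : (fun z : plane R => Y j z.1 z.2 w) = (fun z : plane R => (Y j z.1 z.2 w - y) + y).
    by apply/funext => z; rewrite subrK.
  apply: bmeasD; last exact: bmeas_cst.
  apply: bmeas_continuous => //.
    apply/subspace_continuousP => p Tp; apply: cvgB; last exact: cvg_cst.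
    by have /subspace_continuousP := cY; exact.
  move=> n k kn; have [B1 B2] := (hBw j jN).2 n k kn.
  have g1 : 0 <= grid T n k <= T by rewrite grid_ge0// grid_le.
  have g0 : (0 : R) <= 0 <= T by rewrite lexx T1.
  split => /=.
    have [int ->] := eqY _ _ g1 g0; have /andP[g2 _] := g1.  rewrite (Rintegral_null_rect g2 (lexx 0) (mulr0 _) int).
    by move: B1; rewrite /sheet_path /= => ->; ring.
  have [int ->] := eqY _ _ g0 g1; have /andP[g2 _] := g1.  rewrite (Rintegral_null_rect (lexx 0) g2 (mul0r _) int).
  by move: B2; rewrite /sheet_path /= => ->; ring.
have sumY (z : plane R) : \sum_(1 <= k < N.+1) aj k * Y' k z = \sum_(1 <= k < N.+1) aj k * Y k z.1 z.2 w.
  by rewrite !big_nat; apply: eq_bigr => k; rewrite ltnS /Y' => ->.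
have eqY' j : (1 <= j <= N)%N -> forall z, rect T T z -> Y' j z = y +
    \int[leb2 R]_(q in rect z.1 z.2)
      (N%:R^-1 * (\sum_(1 <= k < N.+1) aj k * Y' k q) - Y' j q) + b' j z.
  move=> jN z /rectP[z1 z2]; have [_ eqY] := hYw j jN.
  rewrite {1}/Y' /b' jN (eqY _ _ z1 z2).2; congr (_ + _ + _).
  by apply: eq_Rintegral => q _; rewrite sumY /Y' jN.
move=> z eps Tz e0.
have := particle_estimate a T0 ajA iN bY cb b0 eqY' Tz e0.
apply: filterS => n; rewrite /Y' /b' iN -/delta => h; apply: le_trans h _.
rewrite le_eqVlt; apply/orP; left; apply/eqP; congr (_ * (_ + riemann_sum T n _) + _).
apply/funext => q; rewrite /averaged_sheet; congr (_ * _).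
by rewrite !big_nat; apply: eq_bigr => k; rewrite ltnS => ->.
Qed.

Lemma measurable_averaged_sheet q : measurable_fun setT (fun w => averaged_sheet w q).
Proof.
apply: measurable_funM => //; apply: measurable_sum => j.
by apply: measurable_funM => //; exact: measurable_funPT.
Qed.

Lemma measurable_riemann_sum n : measurable_fun setT (fun w => riemann_sum T n (averaged_sheet w)).
Proof.
apply: measurable_funM => //; apply: measurable_sum => p.
by apply: measurableT_comp => //; exact: measurable_averaged_sheet.
Qed.

(** The grid of [n.+2 ^ 2] points has mesh [T / n.+1]; the factor [16] bounds
    [(n.+2 / n.+1) ^ 4]. *)
Lemma riemann_sum_sq n (c : R) :
  (\int[P]_w ((c * riemann_sum T n (averaged_sheet w)) ^+ 2)%:E <=
   (c ^+ 2 * (16 * T ^+ 4 * ((A * T) ^+ 2 / N%:R)))%:E)%E.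
Proof.
have T1 := ltW T0.
pose I := ('I_n.+2 * 'I_n.+2)%type; pose pt (p : I) : plane R := (grid T n p.1, grid T n p.2).
have Tp p : rect T T (pt p).
  by apply/rectP; rewrite /= !grid_ge0// !grid_le// -ltnS.
pose v := (A * T) ^+ 2 / N%:R.
have iv p := averaged_sheet_sq hB N1 ajA (Tp p).
pose K := c ^+ 2 * (T / n.+1%:R) ^+ 4 * (size (index_enum I))%:R.
have h4 : 0 <= (T / n.+1%:R) ^+ 4 by rewrite exprn_ge0// divr_ge0.
have ch4 : 0 <= c ^+ 2 * (T / n.+1%:R) ^+ 4 by apply: mulr_ge0 => //; exact: sqr_ge0.
have K0 : 0 <= K by exact: mulr_ge0.
have ptw w : (c * riemann_sum T n (averaged_sheet w)) ^+ 2 <=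
    \sum_(p <- index_enum I) K * averaged_sheet w (pt p) ^+ 2.
  rewrite /riemann_sum -mulr_sumr mulrA exprMn exprMn -exprM /K -[leRHS]mulrA; apply: ler_wpM2l => //.
  apply: le_trans (sqr_sum_le _ _) _; apply: ler_wpM2l => //.
  by apply: ler_sum => p _; rewrite real_normK ?num_real.
have iS : P.-integrable setT (EFin \o (fun w => \sum_(p <- index_enum I) K * averaged_sheet w (pt p) ^+ 2)).
  by apply: integrable_combination => // p; exact: (iv p).1.
apply: (@le_trans _ _ (\int[P]_w (\sum_(p <- index_enum I) K * averaged_sheet w (pt p) ^+ 2)%R%:E)%E).
  apply: ge0_le_integral => //.
  - by move=> w _; rewrite lee_fin sqr_ge0.
  - by apply/measurable_EFinP; apply: measurable_funX; apply: measurable_funM => //; exact: measurable_riemann_sum.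
  - by have /integrableP[] := iS.
  - by move=> w _; rewrite lee_fin.
rewrite -[leLHS](fineK (integrable_fin_num measurableT iS)) lee_fin.
have -> : fine (\int[P]_w (\sum_(p <- index_enum I) K * averaged_sheet w (pt p) ^+ 2)%R%:E)%E =
  \sum_(p <- index_enum I) K * \int[P]_w (averaged_sheet w (pt p) ^+ 2).
  exact: (Rintegral_combination measurableT _ (fun=> K) (fun p => (iv p).1)).
have v0 : 0 <= v by rewrite divr_ge0// sqr_ge0.
apply: (@le_trans _ _ (\sum_(p <- index_enum I) K * v)).
  by apply: ler_sum => p _; apply: ler_wpM2l => //; exact: (iv p).2.
rewrite big_const_seq count_predT iter_addr_0 -[leLHS]mulr_natl /K.
have -> : size (index_enum I) = (n.+2 * n.+2)%N.
  by rewrite -sum1_size sum1_card card_prod card_ord.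
rewrite natrM -/v.
have n0 : 0 < n.+1%:R :> R by rewrite ltr0n.
have -> : n.+2%:R = n.+1%:R + 1 :> R by rewrite natr1.
have n1 : 1 <= n.+1%:R :> R by rewrite ler1n.
move: (n.+1%:R) n0 n1 => r r0 r1.
have q2 : (r + 1) / r <= 2 by rewrite ler_pdivrMr//; lra.
have q0 : 0 <= (r + 1) / r by rewrite divr_ge0//; lra.
have q4 : ((r + 1) / r) ^+ 4 <= 16.
  apply: (@le_trans _ _ (2 ^+ 4)); first by rewrite lerXn2r ?nnegrE.
  by rewrite !exprS expr0; lra.
have -> : (r + 1) * (r + 1) * (c ^+ 2 * (T / r) ^+ 4 * ((r + 1) * (r + 1)) * v) =
  ((r + 1) / r) ^+ 4 * (c ^+ 2 * T ^+ 4 * v) by field; rewrite gt_eqF.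
have -> : c ^+ 2 * (16 * T ^+ 4 * v) = 16 * (c ^+ 2 * T ^+ 4 * v) by ring.
apply: ler_wpM2r => //; apply: mulr_ge0 => //; apply: mulr_ge0; first exact: sqr_ge0.
by rewrite exprn_ge0.
Qed.

Definition mean_square_rate : R :=
  4 * particle_rate T y a A ^+ 2 * (delta ^+ 2 + 16 * T ^+ 4 * ((A * T) ^+ 2 / N%:R)).

(** A particle is close in mean square to the drift plus a step integral on a
    fixed grid [n]. The pathwise estimate compares it with finer and finer grids
    [m], and Fatou's lemma removes [m]; the error that remains depends on [n] and
    on [N] separately. *)
Lemma particle_step_sq t x n del : 0 <= t -> t <= T -> 0 <= x -> x <= T -> 0 < del ->
  (\int[P]_w ((Y i t x w - (drift y a (t, x) + step_integral (B i) (wcells T t x n) w)) ^+ 2)%:E <=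
   (4 * wdist T t x n + del + mean_square_rate)%:E)%E.
Proof.
move=> t0 tT x0 xT del0; have shB := hB.1 i iN.
have txT : rect T T (t, x) by apply/rectP; rewrite /= t0 tT x0 xT.
have mS m := measurable_step_integral (B i) (wcells T t x m).
pose rate := particle_rate T y a A.
have mR m : measurable_fun setT (fun w => rate * riemann_sum T m (averaged_sheet w)).
  by apply: measurable_funM => //; exact: measurable_riemann_sum.
pose f m w := `|step_integral (B i) (wcells T t x m) w - step_integral (B i) (wcells T t x n) w|.
have mf m : measurable_fun setT (f m).
  by apply: measurableT_comp => //; exact: measurable_funB.
apply: (@fatou_sq _ _ _ _ _ (fun m w => f m w - (0 - rate * (delta + riemann_sum T m (averaged_sheet w))))).
- apply: measurable_funB; first exact: measurable_funPT.
  by apply: measurable_funD.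
- move=> m; apply: measurable_funB => //; apply: measurable_funB => //.
  apply: measurable_funM => //; apply: measurable_funD => //; exact: measurable_riemann_sum.
- apply: filterS ae_particle_estimate => w h eps e0.
  have := h (t, x) eps txT e0; apply: filterS => m /=.
  rewrite -(step_integral_wcells T t x (B i) m w) -/rate /f /drift => hm.
  rewrite sub0r opprK; apply: (@le_trans _ _ (`|step_integral (B i) (wcells T t x m) w - step_integral (B i) (wcells T t x n) w| +
    rate * (delta + riemann_sum T m (averaged_sheet w)) + eps)); last by rewrite lerD2r ler_norm.
  rewrite -addrA -lerBlDl; apply: le_trans hm.
  move: (Y i t x w) (y * _) (step_integral _ _ w) (step_integral _ _ w) => p q r s.
  have := ler_normD (r - s) (p - q - r); rewrite lerBlDl.
  by have -> : r - s + (p - q - r) = p - (q + s) by ring.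
have d8 : 0 < del / 4 by rewrite divr_gt0.
have := wdist_small T0 t0 tT x0 xT d8; apply: filterS => m wm.
have c1 := wcells_cauchy T0 shB t0 tT x0 xT n m.
have c2 : (\int[P]_w ((0 - f m w) ^+ 2)%:E <= (2 * wdist T t x n + 2 * wdist T t x m)%:E)%E.
  apply: le_trans c1; rewrite le_eqVlt; apply/orP; left; apply/eqP; apply: eq_integral => w _.
  by rewrite sub0r sqrrN /f real_normK ?num_real.
have c3 : (\int[P]_w ((0 - rate * delta) ^+ 2)%:E <= (rate ^+ 2 * delta ^+ 2)%:E)%E.
  rewrite integral_cst//; have p1 := @probability_setT _ _ _ P; rewrite /= in p1 *; rewrite p1 mule1.
  by rewrite sub0r sqrrN exprMn.
have c4 : (\int[P]_w ((0 - (- (rate * riemann_sum T m (averaged_sheet w)))) ^+ 2)%:E <=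
    (rate ^+ 2 * (16 * T ^+ 4 * ((A * T) ^+ 2 / N%:R)))%:E)%E.
  under eq_integral do rewrite sub0r opprK.
  exact: riemann_sum_sq.
have m0 (r : R) : measurable_fun (setT : set Om) (fun=> r) by exact: measurable_cst.
have c5 := sq_triangle_le measurableT (m0 _) (m0 0) (measurable_funN (mR m)) c3 c4.
have c6 : (\int[P]_w ((0 - (0 - rate * (delta + riemann_sum T m (averaged_sheet w)))) ^+ 2)%:E <=
    (2 * (rate ^+ 2 * delta ^+ 2) + 2 * (rate ^+ 2 * (16 * T ^+ 4 * ((A * T) ^+ 2 / N%:R))))%:E)%E.
  apply: le_trans c5; rewrite le_eqVlt; apply/orP; left; apply/eqP; apply: eq_integral => w _.
  by rewrite /=; congr (_ ^+ 2)%:E; ring.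
have mh : measurable_fun setT (fun w => 0 - rate * (delta + riemann_sum T m (averaged_sheet w))).
  apply: measurable_funB => //; apply: measurable_funM => //; apply: measurable_funD => //.
  exact: measurable_riemann_sum.
apply: le_trans (sq_triangle_le measurableT (mf m) (m0 0) mh c2 c6) _.
rewrite lee_fin /mean_square_rate -/rate; move: wm; move: (rate ^+ 2) (delta ^+ 2) (16 * _) => p q r.
lra.
Qed.

End particles.

(** * Convergence in distribution *)

Section moments.
Context d (Om : measurableType d) (R : realType) (P : probability Om R).
Variables (T t x : R) (B : R -> R -> {RV P >-> R}).
Hypotheses (T0 : 0 < T) (t0 : 0 <= t) (tT : t <= T) (x0 : 0 <= x) (xT : x <= T).
Hypothesis hB : brownian_sheet T B.

(** A bound of the second moment of [m] plus a step integral, uniform in the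
    grid. *)
Definition shifted_moment (m : R) : R := 2 * (fser (`|-1| * (T * T)) ^+ 2 * (T * T)) + 2 * m ^+ 2.

Lemma shifted_moment_ge0 m : 0 <= shifted_moment m.
Proof.
by rewrite addr_ge0// mulr_ge0 ?sqr_ge0// mulr_ge0 ?sqr_ge0// mulr_ge0// ltW.
Qed.

Lemma step_integral_sq_le n :
  (\int[P]_w ((step_integral B (wcells T t x n) w) ^+ 2)%:E <=
   (fser (`|-1| * (T * T)) ^+ 2 * (T * T))%:E)%E.
Proof.
have sin := wcells_in T0 t0 x0 n.
have iS := step_integral_sq_integrable hB tT xT sin.
have iF := step_fun_sq_integrable sin.
rewrite -[leLHS](fineK (integrable_fin_num measurableT iS)) lee_fin.
rewrite -/(Rintegral P setT (fun w => step_integral B (wcells T t x n) w ^+ 2)).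
rewrite (step_isometry hB tT xT sin).
set M := fser _.
have M0 : 0 <= M by apply: le_trans (fser_ge1 _); rewrite ?ler01// !mulr_ge0// ltW.
have iM : (leb2 R).-integrable (rect t x) (EFin \o (fun=> M ^+ 2)).
  apply: integrable_rect; first exact: measurable_cst.
  by exists `|M ^+ 2|; rewrite /=.
apply: (@le_trans _ _ (\int[leb2 R]_(z in rect t x) (M ^+ 2))).
  apply: le_Rintegral => //; first exact: measurable_rect.
  move=> z tz; rewrite -(real_normK (num_real (step_fun _ _))).
  by rewrite lerXn2r ?nnegrE//; exact: normr_step_fun_wcells.
rewrite Rintegral_cst; last exact: measurable_rect.
rewrite leb2_rect//= ; apply: ler_wpM2l; first exact: sqr_ge0.
by apply: ler_pM.
Qed.

Lemma shifted_moment_le m n :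
  (\int[P]_w ((m + step_integral B (wcells T t x n) w) ^+ 2)%:E <= (shifted_moment m)%:E)%E.
Proof.
have m0 (r : R) : measurable_fun (setT : set Om) (fun=> r) by exact: measurable_cst.
have mS := measurable_step_integral B (wcells T t x n).
have h1 : (\int[P]_w ((0 - step_integral B (wcells T t x n) w) ^+ 2)%:E <=
    (fser (`|-1| * (T * T)) ^+ 2 * (T * T))%:E)%E.
  by under eq_integral do rewrite sub0r sqrrN; exact: step_integral_sq_le.
have h2 : (\int[P]_w ((0 - (- m)) ^+ 2)%:E <= (m ^+ 2)%:E)%E.
  rewrite integral_cst//; have p1 := @probability_setT _ _ _ P; rewrite /= in p1 *.
  by rewrite p1 mule1 sub0r opprK.
have := sq_triangle_le measurableT mS (m0 0) (m0 (- m)) h1 h2.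
by apply: le_trans; under [leRHS]eq_integral do rewrite opprK addrC.
Qed.

End moments.

(** The two sheets may live on different spaces: both integrals are centred
    Gaussian, and the isometry gives them the same variance. *)
Lemma step_integral_law d (Om : measurableType d) d' (Om' : measurableType d') (R : realType)
    (P : probability Om R) (P' : probability Om' R) (T t x : R)
    (B : R -> R -> {RV P >-> R}) (B' : R -> R -> {RV P' >-> R}) (s : seq (@cell R)) (g : R -> R) :
  brownian_sheet T B -> brownian_sheet T B' -> t <= T -> x <= T -> all (cell_in t x) s ->
  continuous g -> bounded_fun g ->
  \int[P]_w g (step_integral B s w) = \int[P']_w g (step_integral B' s w).
Proof.
move=> hB hB' tT xT sin cg bg.
have mS := measurable_step_integral B s; have mS' := measurable_step_integral B' s.
apply: (same_law_integral mS mS'); last 3 first.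
- exact: continuous_measurable_fun.
- exact: bounded_comp_integrable.
- exact: bounded_comp_integrable.
apply: (gaussian_same_law mS mS').
- exact: (step_integral_integrable hB tT xT sin).
- exact: (step_integral_integrable hB' tT xT sin).
- exact: (step_integral_sq_integrable hB tT xT sin).
- exact: (step_integral_sq_integrable hB' tT xT sin).
- exact: (step_integral_mean hB tT xT sin).
- exact: (step_integral_mean hB' tT xT sin).
- by rewrite (step_isometry hB tT xT sin) (step_isometry hB' tT xT sin).
- exact: (step_integral_gaussian hB tT xT sin).
- exact: (step_integral_gaussian hB' tT xT sin).
Qed.

(** A particle and the limit are compared through the same cells: each is close
    in mean square to the drift plus the step integral of its own sheet, and these
    two have the same law. *)
Lemma particle_mean_field_close d (Om : measurableType d) d' (Om' : measurableType d') (R : realType)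
    (P : probability Om R) (P' : probability Om' R) (T y a A : R) (aj : nat -> R) (N i : nat)
    (BN YN : nat -> R -> R -> {RV P >-> R}) (B : R -> R -> {RV P' >-> R})
    (t x : R) (g : R -> R) (n : nat) (eps C del : R) :
  0 < T -> (forall j, (1 <= j)%N -> `|aj j| <= A) -> (1 <= i <= N)%N ->
  brownian_sheet_vector T N BN -> particle_system_solution T y aj N BN YN ->
  brownian_sheet T B -> 0 <= t -> t <= T -> 0 <= x -> x <= T ->
  continuous g -> bounded_fun g -> 0 <= eps -> 0 <= C -> 0 < del ->
  (forall z r, `|g (z + r) - g z| <= eps * (1 + z ^+ 2) + C * r ^+ 2) ->
  `|\int[P]_w g (YN i t x w) - \int[P']_w g (mean_field T B y a t x w)| <=
  2 * (eps * (1 + shifted_moment T (drift y a (t, x)))) +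
  C * (6 * wdist T t x n + del + mean_square_rate T y a A aj N).
Proof.
move=> T0 ajA iN hBN hYN hB t0 tT x0 xT cg bg e0 C0 d0 gH.
have hBi := hBN.1 i iN; set m := drift y a (t, x).
pose gm r := g (m + r).
have cgm : continuous gm.
  by move=> r; apply: continuous_comp; [apply: cvgD; [exact: cvg_cst|exact: cvg_id]|exact: cg].
have bgm : bounded_fun gm.
  by have [M [rM gM]] := bg; exists M; split => // r Mr w _; exact: gM.
have law := step_integral_law hBi hB tT xT (wcells_in T0 t0 x0 n) cgm bgm.
have mS d1 (Om1 : measurableType d1) (P1 : probability Om1 R) (B1 : R -> R -> {RV P1 >-> R}) :
    measurable_fun setT (fun w => m + step_integral B1 (wcells T t x n) w).
  by apply: measurable_funD => //; exact: measurable_step_integral.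
have c1 := particle_step_sq a T0 ajA iN hBN hYN n t0 tT x0 xT d0.
have c2 : (\int[P']_w ((mean_field T B y a t x w - (m + step_integral B (wcells T t x n) w)) ^+ 2)%:E <=
    (2 * wdist T t x n)%:E)%E.
  apply: le_trans (noise_field_step_sq T0 hB t0 tT x0 xT n).
  rewrite le_eqVlt; apply/orP; left; apply/eqP; apply: eq_integral => w _.
  by rewrite /mean_field -/m; congr (_ ^+ 2)%:E; ring.
have mY : measurable_fun setT (YN i t x) by exact: measurable_funPT.
have h1 := Rintegral_close mY (mS _ _ _ (BN i)) cg bg e0 C0 gH
  (shifted_moment_le T0 t0 tT x0 xT hBi m n) c1.
have h2 := Rintegral_close (measurable_mean_field T B y a t x) (mS _ _ _ B) cg bg e0 C0 gH
  (shifted_moment_le T0 t0 tT x0 xT hB m n) c2.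
rewrite -[X in `|_ - X|]/(\int[P']_w gm (step_integral B (wcells T t x n) w)) -law distrC in h2.
have := ler_distD (\int[P]_w gm (step_integral (BN i) (wcells T t x n) w))
  (\int[P]_w g (YN i t x w)) (\int[P']_w g (mean_field T B y a t x w)).
move=> h3; apply: le_trans h3 _; apply: le_trans (lerD h1 h2) _.
by rewrite le_eqVlt; apply/orP; left; apply/eqP; ring.
Qed.

Lemma mean_square_rate_cvg0 (R : realType) (T y a A : R) (aj : nat -> R) :
  N%:R^-1 * (\sum_(1 <= j < N.+1) aj j) @[N --> \oo] --> a ->
  mean_square_rate T y a A aj N @[N --> \oo] --> 0.
Proof.
move=> ha.
have inv0 : (N%:R^-1 : R) @[N --> \oo] --> 0.
  by rewrite -(cvg_shiftS (fun N => N%:R^-1 : R)); exact: cvg_harmonic.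
have d0 : `|N%:R^-1 * (\sum_(1 <= j < N.+1) aj j) - a| ^+ 2 @[N --> \oo] --> 0.
  rewrite -[X in _ --> X](_ : `|a - a| ^+ 2 = 0); last by rewrite subrr normr0 expr0n.
  have h : `|N%:R^-1 * (\sum_(1 <= j < N.+1) aj j) - a| @[N --> \oo] --> `|a - a|.
    by apply: cvg_norm; apply: cvgB => //; exact: cvg_cst.
  exact: (cvgM h h).
rewrite -[X in _ --> X](_ : 4 * particle_rate T y a A ^+ 2 *
  (0 + 16 * T ^+ 4 * ((A * T) ^+ 2 * 0)) = 0); last by rewrite !mulr0 addr0 mulr0.
apply: cvgM; first exact: cvg_cst.
apply: cvgD => //; apply: cvgM; first exact: cvg_cst.
by apply: cvgM => //; exact: cvg_cst.
Qed.

Lemma expectation_bounded d (Om : measurableType d) (R : realType) (P : probability Om R)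
    (g : R -> R) (X : {RV P >-> R}) : continuous g -> bounded_fun g ->
  ('E_P[g \o X] = (\int[P]_w g (X w))%:E)%E.
Proof.
move=> cg bg; have iX := bounded_comp_integrable P cg bg (measurable_funPT X).
by rewrite unlock /Rintegral fineK//; exact: (integrable_fin_num measurableT iX).
Qed.

Theorem mainTheorem3 (R : realType) (T y a : R) (aj : nat -> R)
    (hT : 0 < T) (ha : 0 < a)
    (haj_bounded : exists M : R, forall j, (1 <= j)%N -> `|aj j| <= M)
    (haj_mean : N%:R^-1 * (\sum_(1 <= j < N.+1) aj j) @[N --> \oo] --> a)
    (* the N-dimensional sheet and the N-particle system, on a space of their own *)
    (dN : nat -> measure_display) (OmN : forall N, measurableType (dN N))
    (PN : forall N, probability (OmN N) R)
    (BN YN : forall N, nat -> R -> R -> {RV (PN N) >-> R})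
    (hBN : forall N, (1 <= N)%N -> brownian_sheet_vector T N (BN N))
    (hYN : forall N, (1 <= N)%N -> particle_system_solution T y aj N (BN N) (YN N))
    (* the one-dimensional sheet of the limit *)
    (d : measure_display) (Om : measurableType d) (P : probability Om R)
    (B : R -> R -> {RV P >-> R}) (hB : brownian_sheet T B) :
  (forall (i : nat) (t x : R), (1 <= i)%N -> 0 <= t <= T -> 0 <= x <= T ->
     cvg_in_distribution PN (fun N => YN N i t x) P (limit_field y a B t x)) /\
  (* the paths of the limit are taken from a continuous version *)
  (exists Y : R -> R -> {RV P >-> R},
     (forall t x : R, 0 <= t <= T -> 0 <= x <= T ->
        {ae P, forall w, Y t x w = limit_field y a B t x w}) /\
     mean_field_solution T y a B Y).
Proof.
split; last first.
  exists (fun t x => mean_field T B y a t x : {RV P >-> R}); split.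
    by move=> t x; exact: mean_field_limit.
  exact: mean_field_solves.
move=> i t x i1 /[dup] t01 /andP[t0 tT] /[dup] x01 /andP[x0 xT] g cg bg.
have [A ajA] := haj_bounded.
have eL : ('E_P[g \o limit_field y a B t x] = (\int[P]_w g (mean_field T B y a t x w))%:E)%E.
  rewrite -(expectation_bounded (mean_field T B y a t x : {RV P >-> R}) cg bg) unlock.
  have mg (X : {RV P >-> R}) : measurable_fun setT (EFin \o (g \o X)).
    apply/measurable_EFinP; apply: measurableT_comp; last exact: measurable_funPT.
    exact: continuous_measurable_fun.
  apply: ae_eq_integral => //; [exact: mg|exact: (mg (mean_field T B y a t x : {RV P >-> R}))|].
  apply: filterS (mean_field_limit hT hB y a t01 x01) => w e _ /=.
  by rewrite e.
rewrite eL; under eq_fun do rewrite expectation_bounded//.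
apply/cvg_EFin; first exact: nearW.
apply/cvgrPdist_le => eta eta0.
set V := shifted_moment T (drift y a (t, x)).
have V0 : 0 < 1 + V by rewrite ltr_pwDl// shifted_moment_ge0.
have e0 : 0 < eta / (4 * (1 + V)) by rewrite divr_gt0// mulr_gt0.
have [C C0 gH] := bounded_continuous_modulus cg bg e0.
pose k := eta / (16 * (1 + C)).
have k0 : 0 < k by rewrite divr_gt0// mulr_gt0// ltr_pwDl.
have [n _ /(_ n (leqnn n)) wn] := wdist_small hT t0 tT x0 xT k0.
have := mean_square_rate_cvg0 T y A haj_mean; move/cvgrPdist_le => /(_ _ k0) rN.
near=> N.
have iN : (1 <= i <= N)%N by rewrite i1; near: N; exact: nbhs_infty_ge.
have N1 : (1 <= N)%N by case/andP : iN => /leq_trans; exact.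
have rNk : mean_square_rate T y a A aj N <= k.
  apply: le_trans (ler_norm _) _; rewrite -normrN -sub0r; near: N; exact: rN.
have := particle_mean_field_close a n hT ajA iN (hBN N N1) (hYN N N1) hB t0 tT x0 xT cg bg
  (ltW e0) C0 k0 gH.
rewrite -/V distrC => h; apply: le_trans h _.
have -> : 2 * (eta / (4 * (1 + V)) * (1 + V)) = eta / 2 by field; rewrite gt_eqF.
have h1 : 6 * wdist T t x n + k + mean_square_rate T y a A aj N <= 8 * k by lra.
have h2 : C * (6 * wdist T t x n + k + mean_square_rate T y a A aj N) <= (1 + C) * (8 * k).
  have := ler_wpM2l C0 h1; have := ltW k0; nra.
have e8 : (1 + C) * (8 * k) = eta / 2 by rewrite /k; field; rewrite gt_eqF// ltr_pwDl.
rewrite e8 in h2; lra.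
Unshelve. all: by end_near.
Qed.
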